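(* Let $\mathbf{k}$ be an algebraically closed field and let $g\geq 3$ be an integer. Let $\mathcal{T}\subseteq \mathbf{P}^g$ be the tangential variety of the rational normal curve of degree $g$ over $\mathbf{k}$. If $\operatorname{char}(\mathbf{k})=0$ or $\operatorname{char}(\mathbf{k})\geq \frac{g+2}{2}$, then $$K_{\lfloor g/2\rfloor,1}\bigl(\mathcal{T},\mathcal{O}_{\mathcal{T}}(1)\bigr)=0.$$
   Context: The rational normal curve $\Gamma\subseteq\mathbf{P}^g$ is the image of $\mathbf{P}^1$ under $[a:b]\mapsto[a^g:a^{g-1}b:\cdots:b^g]$. Its tangential variety (tangent developable) $\mathcal{T}$ is the surface swept out by the tangent lines to $\Gamma$, with reduced structure. Equivalently, in homogeneous coordinates $z_0,\ldots,z_g$ on $\mathbf{P}^g$, the homogeneous ideal of $\mathcal{T}$ is the kernel of the ring map $\mathbf{k}[z_0,\ldots,z_g]\to\mathbf{k}[t,u,v]$, $z_i\mapsto u\,t^i+i\,v\,t^{i-1}$. Koszul cohomology: for a projective variety $X$ over $\mathbf{k}$ and a very ample line bundle $L$ on $X$, put $S=\operatorname{Sym}H^0(X,L)$ and let $\Gamma_X(L)=\bigoplus_{n\geq 0}H^0(X,L^{n})$, a graded $S$-module. Then $K_{i,j}(X,L):=\operatorname{Tor}_i^S(\Gamma_X(L),\mathbf{k})_{i+j}$. For $X=\mathcal{T}$ and $L=\mathcal{O}_{\mathcal{T}}(1)$, $H^0(\mathcal{T},\mathcal{O}_{\mathcal{T}}(1))$ is the span of $z_0,\ldots,z_g$. 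*)

(* Defs.v *)
From HB Require Import structures.
From mathcomp Require Import all_boot all_order all_algebra.
From mathcomp Require Export fraction.
From mathcomp.multinomials Require Export mpoly.

Set Implicit Arguments.
Unset Strict Implicit.
Unset Printing Implicit Defensive.

Import GRing.Theory.
Local Open Scope ring_scope.

Section GradedTor.
Variables (K : fieldType) (n : nat).
Local Notation S := {mpoly K[n]}.

(* A nonnegatively graded S-module, all of whose pieces are given as additive
   subgroups of one ambient S-module.  The graded module meant is the external
   direct sum of the pieces: no directness inside the ambient is required. *)
Record graded_module := GradedModule {
  gm_ambient : lmodType S;
  gm_piece : nat -> gm_ambient -> Prop;
  gm_piece0 : forall d, gm_piece d 0;
  gm_pieceD : forall d x y, gm_piece d x -> gm_piece d y -> gm_piece d (x + y);
  gm_pieceZ : forall e d (p : S) x, p \is e.-homog -> gm_piece d x ->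
    gm_piece (e + d) (p *: x)
}.

(* A resolution
     ... -> F_2 -> F_1 -> F_0 -> K = S / (X_0, ..., X_(n-1)) -> 0
   with F_i = \bigoplus_(r < gf_rank i) S(- gf_shift i r).  Elements of F_i are
   row vectors; gf_diff i is the matrix of F_(i+1) -> F_i.  The augmentation
   F_0 -> K sends the r-th basis vector to gf_aug r, and a polynomial acts on
   K through its constant coefficient. *)
Record gfree_resolution := GFreeResolution {
  gf_rank : nat -> nat;
  gf_shift : forall i, 'I_(gf_rank i) -> nat;
  gf_diff : forall i, 'M[S]_(gf_rank i.+1, gf_rank i);
  gf_aug : 'I_(gf_rank 0) -> K;
  gf_diff_homog : forall i r c (m : 'X_{1..n}), (gf_diff i r c)@_m != 0 ->
    (mdeg m + gf_shift c = gf_shift r)%N;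
  gf_aug_homog : forall r, gf_aug r != 0 -> gf_shift r = 0%N;
  gf_aug_surj : exists r, gf_aug r != 0;
  gf_exact0 : forall x : 'rV[S]_(gf_rank 0),
    \sum_r (x 0 r)@_0%MM * gf_aug r = 0 <->
    exists y : 'rV[S]_(gf_rank 1), x = y *m gf_diff 0;
  gf_exact : forall i (x : 'rV[S]_(gf_rank i.+1)),
    x *m gf_diff i = 0 <->
    exists y : 'rV[S]_(gf_rank i.+2), x = y *m gf_diff i.+1
}.

Section Tor.
Variables (F : gfree_resolution) (M : graded_module).

(* x represents \sum_r e_r (x) x_r in F_i (x)_S M = M^(gf_rank i); it has
   degree d when x_r lies in M_(d - gf_shift r), which is 0 if d < gf_shift r. *)
Definition tensor_piece i (d : nat) (x : 'I_(gf_rank F i) -> gm_ambient M) :=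
  forall r, if (gf_shift r <= d)%N then gm_piece (d - gf_shift r) (x r)
            else x r = 0.

Definition tensor_diff i (y : 'I_(gf_rank F i.+1) -> gm_ambient M) :
    'I_(gf_rank F i) -> gm_ambient M :=
  fun c => \sum_r gf_diff F i r c *: y r.

Definition tensor_cycle i : ('I_(gf_rank F i) -> gm_ambient M) -> Prop :=
  match i with
  | 0 => fun=> True
  | j.+1 => fun x => forall c, tensor_diff x c = 0
  end.

Definition tensor_homology_eq0 (i d : nat) : Prop :=
  forall x, tensor_piece d x -> tensor_cycle x ->
  exists y, tensor_piece d y /\ forall c, x c = @tensor_diff i y c.

End Tor.

(* Tor_i^S(M, K)_d = 0; the homology does not depend on the resolution F. *)
Definition Tor_eq0 (M : graded_module) (i d : nat) : Prop :=
  forall F : gfree_resolution, tensor_homology_eq0 F M i d.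

End GradedTor.

(* Frac K[t, u, v]; g is a phantom argument that selects the structure of
   K[z_0, ..., z_g]-module defined below. *)
Definition tangent_frac (K : fieldType) (g : nat) : Type :=
  {fraction {mpoly K[3]}}.
HB.instance Definition _ K g := GRing.Field.on (tangent_frac K g).

Section TangentialVariety.
Variables (K : fieldType) (g : nat).
Local Notation S := {mpoly K[g.+1]}.
Local Notation B := {mpoly K[3]}.
Local Notation Q := (tangent_frac K g).
Local Notation t := ('X_0 : B).
Local Notation u := ('X_1 : B).
Local Notation v := ('X_2 : B).

Definition tangent_coord (i : 'I_g.+1) : B := u * t ^+ i + i%:R * v * t ^+ i.-1.

(* The kernel of tangent_map is the homogeneous ideal of the tangential variety
   T, so its image is (isomorphic to) the homogeneous coordinate ring A of T;
   A_d is the image of the forms of degree d. *)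
Definition tangent_map (p : S) : B := p \mPo [tuple tangent_coord i | i < g.+1].

Definition tangent_scale (p : S) (s : Q) : Q :=
  FracField.tofrac (tangent_map p) * s.

Lemma tangent_scaleA p q s :
  tangent_scale p (tangent_scale q s) = tangent_scale (p * q) s.
Proof. by rewrite /tangent_scale /tangent_map rmorphM tofracM mulrA. Qed.

Lemma tangent_scale1 : left_id 1 tangent_scale.
Proof. by move=> s; rewrite /tangent_scale /tangent_map rmorph1 tofrac1 mul1r. Qed.

Lemma tangent_scaleDr : right_distributive tangent_scale +%R.
Proof. by move=> p s s'; rewrite /tangent_scale mulrDr. Qed.

Lemma tangent_scaleDl s : {morph tangent_scale^~ s : p q / p + q}.
Proof.
by move=> p q; rewrite /tangent_scale /tangent_map rmorphD tofracD mulrDl.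
Qed.

HB.instance Definition _ := GRing.Zmodule_isLmodule.Build S Q
  tangent_scaleA tangent_scale1 tangent_scaleDr tangent_scaleDl.

(* H^0(T, O_T(d)).  As A is a domain and the opens D_+(z_i) cover T = Proj A,
   a section is an element of Frac A lying in (A_{z_i})_d for every i, that is,
   with z_i^N s in A_(d + N) for some N.  Since z_0 = u is nonzero this
   condition already forces s to lie in Frac A. *)
Definition tangent_section (d : nat) (s : Q) : Prop :=
  forall i : 'I_g.+1, exists (N : nat) (p : S), p \is (d + N).-homog /\
    ('X_i ^+ N : S) *: s = FracField.tofrac (tangent_map p).

Lemma tangent_section0 d : tangent_section d 0.
Proof.
by move=> i; exists 0%N, 0; rewrite dhomog0 scaler0 /tangent_map rmorph0 tofrac0.
Qed.

Lemma tangent_sectionD d s s' :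
  tangent_section d s -> tangent_section d s' -> tangent_section d (s + s').
Proof.
move=> Hs Hs' i; have [N [p [hp ep]]] := Hs i; have [N' [q [hq eq]]] := Hs' i.
have hX e : ('X_i ^+ e : S) \is e.-homog.
  by rewrite -[e in e.-homog]mul1n dhomogMn // dhomogX /= mdeg1.
exists (N + N')%N, ('X_i ^+ N' * p + 'X_i ^+ N * q); split.
  apply: rpredD.
    by rewrite addnA addnC; apply: dhomogM.
  by rewrite addnCA; apply: dhomogM.
rewrite scalerDr {1}addnC !exprD -!scalerA ep eq.
by rewrite /tangent_map rmorphD !rmorphM tofracD !tofracM.
Qed.

Lemma tangent_sectionZ e d (p : S) s :
  p \is e.-homog -> tangent_section d s -> tangent_section (e + d) (p *: s).
Proof.
move=> hp Hs i; have [N [q [hq eq]]] := Hs i.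
exists N, (p * q); split; first by rewrite -addnA; apply: dhomogM.
by rewrite scalerA mulrC -scalerA eq /tangent_map rmorphM tofracM.
Qed.

(* The section module \bigoplus_(d >= 0) H^0(T, O_T(d)). *)
Definition tangent_section_module : graded_module K g.+1 :=
  GradedModule tangent_section0 tangent_sectionD tangent_sectionZ.

(* K_{i,j}(T, O_T(1)) = 0 *)
Definition tangent_koszul_eq0 (i j : nat) : Prop :=
  Tor_eq0 tangent_section_module i (i + j).

End TangentialVariety.

(* Main.v *)
(* Comparing free resolutions, Tor may be computed with the Koszul complex of S = Sym H^0(O(1)).
   Since z_0 = u and z_1 = ut + v are coprime, the sections of O(1) are the combinations of the z_i and
   those of O are the constants.  Put i = g/2 and m = g - i.  A Koszul cycle is a family (cc_k) of
   exterior forms of degree i such that sum_k cc_k (x) z_k is killed by the Koszul differential;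
   reading the latter at (u, v) = (1, 0) and (0, 1) gives, for all s,
     sum_(a + k = s) e_a _| cc_k = 0 and sum_(a + k = s) a k (e_a _| cc_k) = 0,
   and the cycle is a boundary as soon as e_a _| cc_k is alternating in (a, k).  Form the polynomial
   F(x_1, ..., x_i; y) whose coefficient at x^c y^k is the full contraction of cc_k with e_(c_1), ...,
   e_(c_i).  It is alternating in the x's and vanishes at x_j = y, so F is the Vandermonde determinant
   of all variables times some G, symmetric in the x's and of degree at most m in each variable; the
   second relation becomes (y d/dy - x_1 d/dx_1) G = 0 on x_1 = y.  One has to show that G is symmetric
   in all variables.  In terms of the coefficients c(x-exponents, y-exponent) of G the relation is
   sum_(a + b = s) (b - a) c(r + a, b) = 0, i.e., c kills the multiples of the s-th coefficients
   u_(b, s) of the Wronskians of sum_a X_a T^a and T^b, whereas symmetry of c means that c kills all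
   syzygies sum_b p_b X_b = 0 with p_b of degree m - 1 in K[X_0, ..., X_m].  By a dimension count the
   two spaces agree if the map f |-> (sum_s f_s u_(b, s))_b is injective on (2m - 1)-tuples of forms of
   degree m - 2.  This follows from the exactness, in low degrees, of the complex with differential
   z |-> sum_b d/de_b (u_b /\ z) on exterior forms with polynomial coefficients in e_0, ..., e_m, which
   is proved by letting the coefficients X_a be specialized to 0 one at a time; only here and in the
   sign arguments are 1, ..., m required to be invertible in K. *)
Require Import Defs.
From HB Require Import structures.
From mathcomp Require Import all_boot all_order all_algebra.
From mathcomp Require Import fingroup perm.
From mathcomp Require Import ring lra zify.
From Stdlib Require Import IndefiniteDescription.
Set Implicit Arguments. Unset Strict Implicit. Unset Printing Implicit Defensive.
Import GRing.Theory.
Local Open Scope ring_scope.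

(** * Exterior algebra *)

(** Passage from exactness to injectivity: a tuple f with sum_s f_s u_(b, s) = 0 for all b,
    contracted into the volume form, gives a form of degree n - 1, n = 2m - 1, annihilated by every
    u_b. Exactness shows that X_1 times this form is divisible by the product of the u_b with b <>
    1. That product has degree m in the X_a, whereas X_1 f has degree m - 1; hence f = 0. The number
    n counts the values of a + b - 1 for a <> b in 0, ..., m, and it is also the one for which the
    dimension count closes up. The obstacle is that the u_b are dependent, sum_b X_b u_b = 0, and
    that the others have dual vectors only up to a power of some nonzero X_k. The dual vectors yield
    an explicit homotopy, hence exactness up to a power of X_k. This power is cancelled by looking
    at X_k = 0, at the price of exactness with one coefficient fewer, exterior degree one lower and
    polynomial degree one higher. The sum of the two degrees does not grow, which keeps the integers
    to be inverted at most m. *)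

Section Exterior.
Variables (R : comNzRingType) (n : nat).
Implicit Types (u v w : 'I_n -> R) (A B : {set 'I_n}) (a b : 'I_n).

(** The value of a form at [A] is the coefficient of the product of the basis vectors e_a, a in [A],
    in increasing order. *)
Definition ext := {ffun {set 'I_n} -> R^o}.
HB.instance Definition _ := GRing.Lmodule.on ext.
Implicit Types z : ext.

(** The sign of moving e_a to its place in the ordered product; the strict comparison makes it
    insensitive to whether a belongs to [A]. *)
Definition esgn a A : R := (-1) ^+ #|[set b in A | (b < a)%N]|.

Definition wedge u z : ext := [ffun A : {set 'I_n} => (\sum_(a in A) esgn a A * u a * z (A :\ a) : R^o)].
Definition contr v z : ext := [ffun A : {set 'I_n} => (\sum_(a | a \notin A) esgn a A * v a * z (a |: A) : R^o)].

Lemma esgn_sqr a A : esgn a A * esgn a A = 1.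
Proof. by rewrite /esgn -expr2 sqrr_sign. Qed.

Lemma esgnU1 a A : esgn a (a |: A) = esgn a A.
Proof.
rewrite /esgn; congr (_ ^+ #|pred_of_set _|); apply/setP=> b; rewrite !inE.
by case: (b =P a) => // ->; rewrite ltnn !andbF.
Qed.

Lemma esgnD1 a A : esgn a (A :\ a) = esgn a A.
Proof.
rewrite /esgn; congr (_ ^+ #|pred_of_set _|); apply/setP=> b; rewrite !inE.
by case: (b =P a) => // ->; rewrite ltnn !andbF.
Qed.

Lemma esgnU b a A : b \notin A -> esgn a (b |: A) = (-1) ^+ (b < a)%N * esgn a A.
Proof.
move=> bA; rewrite /esgn -exprD; congr (_ ^+ _).
case: (ltnP b a) => ba /=.
  have -> : [set c in b |: A | (c < a)%N] = b |: [set c in A | (c < a)%N].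
    by apply/setP=> c; rewrite !inE; case: (c =P b) => // ->; rewrite ba.
  by rewrite cardsU1 inE (negbTE bA).
congr #|pred_of_set _|; apply/setP=> c; rewrite !inE.
by case: (c =P b) => // ->; rewrite ltnNge ba /= !andbF.
Qed.

Lemma esgnD b a A : b \in A -> esgn a (A :\ b) = (-1) ^+ (b < a)%N * esgn a A.
Proof.
move=> bA; rewrite -[in RHS](setD1K bA) esgnU ?setD11 //.
by rewrite mulrA -signr_addb addbb mul1r.
Qed.

Lemma signr_lt a b : a != b -> (-1) ^+ (a < b)%N = - (-1) ^+ (b < a)%N :> R.
Proof.
move=> ab; case: ltngtP => [_|_|/val_inj E]; rewrite ?expr1 ?expr0 ?opprK //.
by rewrite E eqxx in ab.
Qed.

(** Pairs are matched along the order of [enum_rank]; the separate hypothesis on the diagonal avoids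
    a division by 2. *)
Lemma sum_antisym (T : finType) (F : T -> T -> R) :
  (forall x y, F x y = - F y x) -> (forall x, F x x = 0) -> \sum_x \sum_y F x y = 0.
Proof.
move=> Fa F0.
rewrite pair_big /= (bigID (fun p : T * T => (enum_rank p.1 < enum_rank p.2)%N)) /=.
rewrite [X in _ + X](bigID (fun p : T * T => (enum_rank p.2 < enum_rank p.1)%N)) /=.
rewrite [X in _ + (_ + X)]big1 ?addr0; last first.
  move=> [x y] /=; rewrite -!leqNgt => /andP[h1 h2].
  have /val_inj/enum_rank_inj -> : val (enum_rank x) = val (enum_rank y).
    by apply/eqP; rewrite eqn_leq h1 h2.
  exact: F0.
rewrite [X in _ + X](reindex_inj (h := fun p : T * T => (p.2, p.1))) /=; last first.
  by move=> [x y] [z t] [-> ->].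
rewrite [X in _ + X](eq_bigl (fun p : T * T => (enum_rank p.1 < enum_rank p.2)%N)).
  by rewrite -big_split big1 //= => -[x y] _ /=; rewrite [F y x]Fa subrr.
move=> [x y] /=; case: ltnP => //= h.
by rewrite ltnNge ltnW.
Qed.

Lemma wedgeD u : {morph wedge u : x y / x + y}.
Proof.
by move=> x y; apply/ffunP=> A; rewrite !ffunE -big_split; apply: eq_bigr => a _; rewrite ffunE mulrDr.
Qed.
Lemma wedgeZ u c z : wedge u (c *: z) = c *: wedge u z.
Proof.
apply/ffunP=> A; rewrite !ffunE scaler_sumr; apply: eq_bigr => a _.
by rewrite ffunE /GRing.scale /= mulrCA.
Qed.
Lemma wedge_linear u : linear (wedge u).
Proof. by move=> c x y; rewrite wedgeD wedgeZ. Qed.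
HB.instance Definition _ u := GRing.isLinear.Build R ext ext *:%R (wedge u) (wedge_linear u).

Lemma contrD u : {morph contr u : x y / x + y}.
Proof.
by move=> x y; apply/ffunP=> A; rewrite !ffunE -big_split; apply: eq_bigr => a _; rewrite ffunE mulrDr.
Qed.
Lemma contrZ u c z : contr u (c *: z) = c *: contr u z.
Proof.
apply/ffunP=> A; rewrite !ffunE scaler_sumr; apply: eq_bigr => a _.
by rewrite ffunE /GRing.scale /= mulrCA.
Qed.
Lemma contr_linear u : linear (contr u).
Proof. by move=> c x y; rewrite contrD contrZ. Qed.
HB.instance Definition _ u := GRing.isLinear.Build R ext ext *:%R (contr u) (contr_linear u).

Lemma setD1C A a b : A :\ a :\ b = A :\ b :\ a.
Proof. by rewrite !setDDl setUC. Qed.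

Lemma wedgeB u z1 z2 : wedge u (z1 - z2) = wedge u z1 - wedge u z2.
Proof. exact: raddfB. Qed.

Lemma wedge_wedge u v z : wedge u (wedge v z) = - wedge v (wedge u z).
Proof.
apply/ffunP=> A; rewrite !ffunE -sumrN.
transitivity (\sum_(a in A) \sum_(b in A | b != a)
   esgn a A * esgn b (A :\ a) * u a * v b * z (A :\ a :\ b)).
  apply: eq_bigr => a aA; rewrite ffunE mulr_sumr.
  by apply: eq_big => [b|b _]; [rewrite !inE andbC | ring].
transitivity (\sum_(b in A) \sum_(a in A | a != b)
   esgn a A * esgn b (A :\ a) * u a * v b * z (A :\ a :\ b)).
  rewrite (exchange_big_dep (mem A)) /=; last by move=> a b _ /andP[].
  by apply: eq_bigr => b bA; apply: eq_bigl => a; rewrite bA eq_sym.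
apply: eq_bigr => b bA; rewrite ffunE mulr_sumr -sumrN.
apply: eq_big => [a|a /andP[aA ab]]; first by rewrite !inE andbC.
rewrite esgnD // (esgnD _ bA) signr_lt // setD1C; ring.
Qed.
(** [wedge_wedge] would give this only after a division by 2, which the coefficient ring need not
    allow. *)
Lemma wedge_sqr u z : wedge u (wedge u z) = 0.
Proof.
apply/ffunP=> A; rewrite !ffunE.
pose F a b := if (a \in A) && (b \in A) && (a != b) then
   esgn a A * esgn b (A :\ a) * u a * u b * z (A :\ a :\ b) else 0.
transitivity (\sum_a \sum_b F a b).
  rewrite big_mkcond; apply: eq_bigr => a _; rewrite /F.
  case aA: (a \in A) => /=; last by rewrite big1.
  rewrite ffunE mulr_sumr big_mkcond; apply: eq_bigr => b _.
  rewrite !inE [b == a]eq_sym andbC; case: ifP => // _; ring.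
apply: sum_antisym => [a b|a]; rewrite /F; last by rewrite eqxx andbF.
rewrite [b == a]eq_sym [(b \in A) && _]andbC; case: ifP => [/andP[/andP[aA bA] ab]|]; last by rewrite oppr0.
rewrite esgnD // (esgnD _ bA) signr_lt // setD1C; ring.
Qed.

Lemma contr_contr u v z : contr u (contr v z) = - contr v (contr u z).
Proof.
apply/ffunP=> A; rewrite !ffunE -sumrN.
transitivity (\sum_(a | a \notin A) \sum_(b | (b \notin A) && (b != a))
   esgn a A * esgn b (a |: A) * u a * v b * z (b |: (a |: A))).
  apply: eq_bigr => a aA; rewrite ffunE mulr_sumr.
  by apply: eq_big => [b|b _]; [rewrite !inE negb_or andbC | ring].
transitivity (\sum_(b | b \notin A) \sum_(a | (a \notin A) && (a != b))
   esgn a A * esgn b (a |: A) * u a * v b * z (b |: (a |: A))).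
  rewrite (exchange_big_dep [pred b | b \notin A]) /=; last by move=> a b _ /andP[].
  by apply: eq_bigr => b bA; apply: eq_bigl => a; rewrite bA eq_sym.
apply: eq_bigr => b bA; rewrite ffunE mulr_sumr -sumrN.
apply: eq_big => [a|a /andP[aA ab]]; first by rewrite !inE negb_or andbC.
rewrite esgnU // (esgnU _ bA) signr_lt // setUCA; ring.
Qed.

(** Contraction is an antiderivation: the terms replacing some b in [A] by some a outside [A] occur
    in both products with opposite signs, and the remaining ones, over a outside and inside [A],
    make up the whole pairing. *)
Lemma contr_wedge v u z :
  contr v (wedge u z) = (\sum_a v a * u a) *: z - wedge u (contr v z).
Proof.
apply/eqP; rewrite eq_sym subr_eq eq_sym; apply/eqP/ffunP=> A; rewrite !ffunE.
transitivity (\sum_(a | a \notin A) (v a * u a * z A + \sum_(b in A)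
     esgn a A * esgn b (a |: A) * v a * u b * z ((a |: A) :\ b))
   + \sum_(b in A) (v b * u b * z A + \sum_(a | a \notin A)
     esgn b A * esgn a (A :\ b) * v a * u b * z (a |: (A :\ b)))).
  congr (_ + _).
    apply: eq_bigr => a aA; rewrite ffunE big_setU1 //= setU1K // esgnU1 mulrDr.
    congr (_ + _); first by rewrite -[RHS]mul1r -(esgn_sqr a A); ring.
    by rewrite mulr_sumr; apply: eq_bigr => b _; ring.
  apply: eq_bigr => b bA; rewrite ffunE (bigD1 b) ?setD11 //= setD1K // esgnD1 mulrDr.
  congr (_ + _); first by rewrite -[RHS]mul1r -(esgn_sqr b A); ring.
  rewrite mulr_sumr; apply: eq_big => [a|a _]; last by ring.
  rewrite !inE; case: (a =P b) => [->|_] /=; first by rewrite bA.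
  by rewrite andbT.
rewrite !big_split /= addrACA [X in _ + X](_ : _ = 0) ?addr0; last first.
  rewrite exchange_big /= -big_split big1 //= => b bA.
  rewrite -big_split big1 //= => a aA.
  have ab : a != b by apply: contraNneq aA => ->.
  rewrite esgnU // (esgnD _ bA) signr_lt //.
  have -> : (a |: A) :\ b = a |: A :\ b.
    by apply/setP=> c; rewrite !inE; case: (c =P a) => // ->; rewrite ab.
  by ring.
rewrite /GRing.scale /= mulr_suml [RHS](bigID (fun a => a \in A)) /= addrC.
by congr (_ + _); rewrite mulr_suml.
Qed.

Definition extdeg l z := forall A, #|A| != l -> z A = 0.

Lemma extdeg_wedge l u z : extdeg l z -> extdeg l.+1 (wedge u z).
Proof.
move=> hz A hA; rewrite ffunE big1 // => a aA; rewrite hz ?mulr0 //.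
by move: hA; rewrite (cardsD1 a) aA add1n eqSS.
Qed.

Lemma extdeg_contr l u z : extdeg l.+1 z -> extdeg l (contr u z).
Proof.
move=> hz A hA; rewrite ffunE big1 // => a aA; rewrite hz ?mulr0 //.
by rewrite cardsU1 aA add1n eqSS.
Qed.

Lemma contr_extdeg0 u z : extdeg 0 z -> contr u z = 0.
Proof.
move=> hz; apply/ffunP=> A; rewrite !ffunE big1 // => a aA; rewrite hz ?mulr0 //.
by rewrite cardsU1 aA.
Qed.

Lemma extdeg0_0 l : extdeg l 0. Proof. by move=> A _; rewrite ffunE. Qed.
Lemma extdegD l z1 z2 : extdeg l z1 -> extdeg l z2 -> extdeg l (z1 + z2).
Proof. by move=> h1 h2 A hA; rewrite ffunE h1 // h2 // addr0. Qed.
Lemma extdegZ l c z : extdeg l z -> extdeg l (c *: z).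
Proof. by move=> h A hA; rewrite ffunE h // scaler0. Qed.
Lemma extdeg_sum l (I : finType) (P : pred I) (F : I -> ext) :
  (forall i, P i -> extdeg l (F i)) -> extdeg l (\sum_(i | P i) F i).
Proof.
move=> h; elim/big_rec: _ => [|i x Pi hx]; [exact: extdeg0_0 | exact: extdegD (h i Pi) hx].
Qed.

(** The volume form. Contracting it with v encodes v as a form of degree n - 1 ([contr_evol]), whose
    product with u vanishes when the pairing of u and v does. *)
Definition evol : ext := [ffun A : {set 'I_n} => ((A == setT)%:R : R^o)].

Lemma extdeg_evol : extdeg n evol.
Proof.
move=> A hA; rewrite ffunE; case: eqP => // E.
by rewrite E cardsT card_ord eqxx in hA.
Qed.

Lemma wedge_evol u : wedge u evol = 0.
Proof.
apply/ffunP=> A; rewrite !ffunE big1 // => a aA; rewrite ffunE.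
case: eqP => [E|_]; last by rewrite mulr0.
by move: (in_setT a); rewrite -E setD11.
Qed.

Lemma contr_evol v a : contr v evol ([set: 'I_n] :\ a) = esgn a ([set: 'I_n] :\ a) * v a.
Proof.
rewrite !ffunE (bigD1 a) ?setD11 //= setD1K ?inE // ffunE eqxx mulr1 big1 ?addr0 // => b /andP[].
by rewrite !inE andbT negbK => ->.
Qed.
End Exterior.
Arguments wedge : simpl never.
Arguments contr : simpl never.
Arguments esgn : simpl never.

(** * Homogeneous polynomials, derivatives and Euler's formula *)

Section Homogeneous.
Variables (R : comNzRingType) (n : nat).
Implicit Types p q : {mpoly R[n]}.

Lemma pihomogM d e q p : q \is d.-homog ->
  pihomog mdeg (d + e) (q * p) = q * pihomog mdeg e p.
Proof.
move=> hq; pose k := (maxn (msize p) e).+1.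
rewrite {1}(@pihomog_partitionE _ _ mdeg k p); last by rewrite /k; lia.
rewrite mulr_sumr raddf_sum /=.
have ek : (e < k)%N by rewrite /k; lia.
rewrite (bigD1 (Ordinal ek)) //= big1 ?addr0.
  by rewrite pihomog_dE // dhomogM // pihomogP.
move=> i ie; apply: (@pihomog_ne0 _ _ mdeg (d + i)); last by rewrite dhomogM // pihomogP.
by rewrite eqn_add2l; apply: contraNneq ie => E; apply/eqP/val_inj.
Qed.

Lemma mderiv_homog d p b : p \is d.+1.-homog -> p^`M(b) \is d.-homog.
Proof.
move=> /dhomogP hp; apply/dhomogP => m; rewrite mcoeff_msupp mcoeff_deriv => h.
have : (m + U_(b))%MM \in msupp p.
  by rewrite mcoeff_msupp; apply: contraNneq h => ->; rewrite mul0rn.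
by move/hp => /=; rewrite mdegD mdeg1 addn1 => -[].
Qed.

Lemma mderiv_homog0 p b : p \is 0.-homog -> p^`M(b) = 0.
Proof.
move=> /dhomogP hp; apply/mpolyP => m; rewrite mcoeff_deriv mcoeff0.
case: (boolP ((m + U_(b))%MM \in msupp p)) => [/hp /=|/memN_msupp_eq0 ->]; last by rewrite mul0rn.
by rewrite mdegD mdeg1 addn1.
Qed.

Lemma mpoly_euler d p : p \is d.-homog -> \sum_b 'X_b * p^`M(b) = d%:R *: p.
Proof.
move=> /dhomogP hp; rewrite [in RHS](mpolyE p) scaler_sumr.
transitivity (\sum_b \sum_(m <- msupp p) 'X_b * (p@_m *: 'X_[m])^`M(b)).
  by apply: eq_bigr => b _; rewrite {1}(mpolyE p) raddf_sum mulr_sumr.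
rewrite exchange_big /=; apply: eq_big_seq => m /hp /= hm.
rewrite scalerA -hm mdegE natr_sum mulr_suml scaler_suml.
apply: eq_bigr => b _; rewrite mderivZ mderivX -!scalerAr scalerA [_ * p@_m]mulrC.
case: (m b =P 0%N) => [->|/eqP mb]; first by rewrite mulr0 !scale0r.
by congr (_ *: _); rewrite -mpolyXD; congr ('X_[_]); rewrite addmC submK // lep1mP.
Qed.
End Homogeneous.

(** * The Wronskian complex *)

Lemma sum_two (V : nmodType) (I : finType) (b k : I) (F : I -> V) : b != k ->
  (forall c, c != k -> c != b -> F c = 0) -> \sum_c F c = F b + F k.
Proof.
move=> bk h; rewrite (bigD1 b) //= (bigD1 k) 1?eq_sym //= big1 ?addr0 //.
by move=> c /andP[cb ck]; apply: h.
Qed.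

(* What is used of the polynomial ring pa_alg in the variables pa_var over
   pa_base: constants, partial derivatives and homogeneous elements. *)
Record polyalg (m : nat) := PolyAlg {
  pa_base : idomainType;
  pa_alg : idomainType;
  pa_const : {rmorphism pa_base -> pa_alg};
  pa_der : 'I_m.+1 -> {additive pa_alg -> pa_alg};
  pa_var : 'I_m.+1 -> pa_alg;
  pa_hom : nat -> pa_alg -> Prop;
  pa_derM : forall b p q, pa_der b (p * q) = pa_der b p * q + p * pa_der b q;
  pa_derC : forall b a, pa_der b (pa_const a) = 0;
  pa_derX : forall b c, pa_der b (pa_var c) = (c == b)%:R;
  pa_der_comm : forall b c p, pa_der b (pa_der c p) = pa_der c (pa_der b p);
  pa_const_inj : injective pa_const;
  pa_hom0 : forall j, pa_hom j 0;
  pa_homB : forall j p q, pa_hom j p -> pa_hom j q -> pa_hom j (p - q);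
  pa_homCM : forall j a p, pa_hom j p -> pa_hom j (pa_const a * p);
  pa_homX : forall b, pa_hom 1 (pa_var b);
  pa_homXM : forall j b p, pa_hom j p -> pa_hom j.+1 (pa_var b * p);
  pa_hom_der : forall j b p, pa_hom j.+1 p -> pa_hom j (pa_der b p);
  pa_hom0_der : forall b p, pa_hom 0 p -> pa_der b p = 0;
  pa_hom_factor : forall j p q, pa_hom 1 p -> pa_hom j.+1 (p * q) ->
    exists2 q', pa_hom j q' & p * q = p * q';
  pa_euler : forall j p, pa_hom j p -> \sum_b pa_var b * pa_der b p = pa_const j%:R * p
}.

Section WronskiComplex.
Variables (m n : nat) (W : polyalg m).
Local Notation A := (pa_base W).
Local Notation B := (pa_alg W).
Local Notation C := (pa_const W).
Local Notation D := (@pa_der _ W).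
Local Notation X := (@pa_var _ W).
Local Notation hom := (@pa_hom _ W).
Local Notation E := (ext B n).
Implicit Types (z y w : E) (v : 'I_n -> A) (b : 'I_m.+1).

Definition cvec v : 'I_n -> B := fun s => C (v s).

Definition ederiv b z : E := [ffun S : {set 'I_n} => (D b (z S) : B^o)].

Lemma ederiv_is_additive b : additive (ederiv b).
Proof. by move=> x y; apply/ffunP=> S; rewrite !ffunE raddfB. Qed.
HB.instance Definition _ b := GRing.isAdditive.Build E E (ederiv b) (ederiv_is_additive b).

Lemma ederivZ b p z : ederiv b (p *: z) = D b p *: z + p *: ederiv b z.
Proof. by apply/ffunP=> S; rewrite !ffunE pa_derM. Qed.

Lemma ederivC b c z : ederiv b (ederiv c z) = ederiv c (ederiv b z).
Proof. by apply/ffunP=> S; rewrite !ffunE pa_der_comm. Qed.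

Lemma esgnE (a : 'I_n) S : esgn B a S = C (esgn A a S).
Proof. by rewrite /esgn rmorphXn rmorphN rmorph1. Qed.

Lemma ederiv_wedge b v z : ederiv b (wedge (cvec v) z) = wedge (cvec v) (ederiv b z).
Proof.
apply/ffunP=> S; rewrite !ffunE raddf_sum; apply: eq_bigr => a _.
by rewrite ffunE /= !pa_derM esgnE !pa_derC mul0r mulr0 !add0r mul0r add0r.
Qed.

Lemma ederiv_contr b v z : ederiv b (contr (cvec v) z) = contr (cvec v) (ederiv b z).
Proof.
apply/ffunP=> S; rewrite !ffunE raddf_sum; apply: eq_bigr => a _.
by rewrite ffunE /= !pa_derM esgnE !pa_derC mul0r mulr0 !add0r mul0r add0r.
Qed.

Definition ehom j z := forall S, hom j (z S).

Lemma homD j (p q : B) : hom j p -> hom j q -> hom j (p + q).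
Proof. by move=> hp hq; rewrite -[q]opprK -[- q]sub0r; do 2?apply: pa_homB => //; apply: pa_hom0. Qed.

Lemma hom_sum j (I : finType) (P : pred I) (F : I -> B) :
  (forall i, P i -> hom j (F i)) -> hom j (\sum_(i | P i) F i).
Proof. by move=> h; elim/big_rec: _ => [|i x Pi hx]; [exact: pa_hom0 | apply: homD (h i Pi) hx]. Qed.

Lemma ehom0 j : ehom j 0. Proof. by move=> S; rewrite ffunE; apply: pa_hom0. Qed.
Lemma ehomB j z y : ehom j z -> ehom j y -> ehom j (z - y).
Proof. by move=> h1 h2 S; rewrite !ffunE; apply: pa_homB. Qed.
Lemma ehomD j z y : ehom j z -> ehom j y -> ehom j (z + y).
Proof. by move=> h1 h2 S; rewrite ffunE; apply: homD. Qed.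
Lemma ehomX j b z : ehom j z -> ehom j.+1 (X b *: z).
Proof. by move=> h S; rewrite ffunE; apply: pa_homXM. Qed.
Lemma ehomZC j a z : ehom j z -> ehom j (C a *: z).
Proof. by move=> h S; rewrite ffunE; apply: pa_homCM. Qed.
Lemma ehom_sum j (I : finType) (P : pred I) (F : I -> E) :
  (forall i, P i -> ehom j (F i)) -> ehom j (\sum_(i | P i) F i).
Proof. by move=> h S; rewrite sum_ffunE; apply: hom_sum => i /h. Qed.

Lemma ehom_wedge j v z : ehom j z -> ehom j (wedge (cvec v) z).
Proof.
move=> h S; rewrite ffunE; apply: hom_sum => a _.
by rewrite esgnE -rmorphM; apply: pa_homCM.
Qed.
Lemma ehom_contr j v z : ehom j z -> ehom j (contr (cvec v) z).
Proof.
move=> h S; rewrite ffunE; apply: hom_sum => a _.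
by rewrite esgnE -rmorphM; apply: pa_homCM.
Qed.
Lemma ehom_ederiv j b z : ehom j.+1 z -> ehom j (ederiv b z).
Proof. by move=> h S; rewrite ffunE; apply: pa_hom_der. Qed.
Lemma ederiv_ehom0 b z : ehom 0 z -> ederiv b z = 0.
Proof. by move=> h; apply/ffunP=> S; rewrite !ffunE pa_hom0_der. Qed.

Lemma euler_ext j z : ehom j z -> \sum_b X b *: ederiv b z = C j%:R *: z.
Proof.
move=> h; apply/ffunP=> S; rewrite sum_ffunE ffunE [RHS](esym (pa_euler (h S))).
by apply: eq_bigr => b _; rewrite !ffunE.
Qed.

Variable xi : 'I_m.+1 -> A.

(* The s-th coefficient of the Wronskian of sum_a (xi a) T^a and T^b. *)
Definition wron b : 'I_n -> A :=
  fun s => \sum_(a : 'I_m.+1 | (a + b == s.+1)%N) (b%:R - a%:R) * xi a.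

(** The Wronskian of sum_a (xi a) T^a with itself vanishes. *)
Lemma sum_wron s : \sum_b xi b * wron b s = 0.
Proof.
rewrite /wron; under eq_bigr => b _ do rewrite mulr_sumr big_mkcond.
apply: sum_antisym => [x y|x]; last by rewrite subrr mul0r mulr0; case: ifP.
by rewrite addnC; case: ifP => _; rewrite ?oppr0 //; ring.
Qed.

(** Multiplication by this element commutes with [wdiff] because of [sum_wron], so that cycles and
    boundaries make sense modulo its multiples. *)
Definition eform : B := \sum_a C (xi a) * X a.

Lemma D_eform b : D b eform = C (xi b).
Proof.
rewrite raddf_sum (bigD1 b) //= pa_derM pa_derC mul0r add0r pa_derX eqxx mulr1 big1 ?addr0 // => a ab.
by rewrite pa_derM pa_derC mul0r add0r pa_derX (negbTE ab) mulr0.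
Qed.

Definition wdiff z : E := \sum_b wedge (cvec (wron b)) (ederiv b z).

Lemma wdiff_is_additive : additive wdiff.
Proof.
by move=> x y; rewrite /wdiff -sumrB; apply: eq_bigr => b _; rewrite !raddfB.
Qed.
HB.instance Definition _ := GRing.isAdditive.Build E E wdiff wdiff_is_additive.

Lemma wdiffZC a z : wdiff (C a *: z) = C a *: wdiff z.
Proof.
rewrite /wdiff scaler_sumr; apply: eq_bigr => b _.
by rewrite ederivZ pa_derC scale0r add0r wedgeZ.
Qed.

Lemma wedge_scale_sum (I : finType) (c : I -> A) (f : I -> 'I_n -> A) z :
  \sum_i C (c i) *: wedge (cvec (f i)) z = wedge (cvec (fun s => \sum_i c i * f i s)) z.
Proof.
apply/ffunP=> S; rewrite sum_ffunE ffunE.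
transitivity (\sum_i \sum_(a in S) esgn B a S * C (c i * f i a) * z (S :\ a)).
  apply: eq_bigr => i _; rewrite !ffunE.
  rewrite [LHS]mulr_sumr; apply: eq_bigr => a _; rewrite rmorphM /cvec; ring.
rewrite exchange_big; apply: eq_bigr => a _ /=.
by rewrite /cvec rmorph_sum mulr_sumr mulr_suml.
Qed.

Lemma wedge0 z : wedge (cvec (fun=> 0)) z = 0.
Proof. by apply/ffunP=> S; rewrite !ffunE big1 // => a _; rewrite /cvec rmorph0 mulr0 mul0r. Qed.

Lemma eq_wedge u v z : u =1 v -> wedge (cvec u) z = wedge (cvec v) z.
Proof. by move=> e; apply/ffunP=> S; rewrite !ffunE; apply: eq_bigr => a _; rewrite /cvec e. Qed.

Lemma sum_wedge_wron z : \sum_b C (xi b) *: wedge (cvec (wron b)) z = 0.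
Proof. by rewrite wedge_scale_sum -[RHS](wedge0 z); apply: eq_wedge => s; exact: sum_wron. Qed.

Lemma wdiff_eform w : wdiff (eform *: w) = eform *: wdiff w.
Proof.
transitivity (\sum_b (C (xi b) *: wedge (cvec (wron b)) w +
    eform *: wedge (cvec (wron b)) (ederiv b w))).
  by apply: eq_bigr => b _; rewrite ederivZ D_eform raddfD /= !wedgeZ.
rewrite big_split /= [X in X + _](sum_wedge_wron w).
rewrite add0r.
by rewrite /wdiff [RHS]scaler_sumr.
Qed.

(** Derivatives commute, whereas multiplications by vectors anticommute. *)
Lemma wdiff_wdiff z : wdiff (wdiff z) = 0.
Proof.
rewrite /wdiff; apply/ffunP=> S.
transitivity (\sum_b \sum_c wedge (cvec (wron b)) (wedge (cvec (wron c)) (ederiv b (ederiv c z))) S).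
  rewrite sum_ffunE; apply: eq_bigr => b _; rewrite !raddf_sum sum_ffunE.
  by apply: eq_bigr => c _ /=; rewrite ederiv_wedge.
rewrite ffunE; apply: sum_antisym => [b c|b]; last by rewrite wedge_sqr ffunE.
by rewrite wedge_wedge ederivC ffunE.
Qed.

Lemma ehom_wdiff j z : ehom j.+1 z -> ehom j (wdiff z).
Proof. by move=> h; apply: ehom_sum => b _; apply/ehom_wedge/ehom_ederiv. Qed.

Lemma extdeg_ederiv l b z : extdeg l z -> extdeg l (ederiv b z).
Proof. by move=> h S hS; rewrite ffunE h // raddf0. Qed.

(* y is homogeneous of exterior degree l - 1; for l = 0 this means y = 0. *)
Definition extpred l z := forall S : {set 'I_n}, #|S|.+1 != l -> z S = 0.

Lemma extpredD l z1 z2 : extpred l z1 -> extpred l z2 -> extpred l (z1 + z2).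
Proof. by move=> h1 h2 S hS; rewrite ffunE h1 // h2 // addr0. Qed.
Lemma extpredZ l c z : extpred l z -> extpred l (c *: z).
Proof. by move=> h S hS; rewrite ffunE h // scaler0. Qed.
Lemma extpred_sum l (I : finType) (P : pred I) (F : I -> E) :
  (forall i, P i -> extpred l (F i)) -> extpred l (\sum_(i | P i) F i).
Proof.
by move=> h S hS; rewrite sum_ffunE big1 // => i /h ->.
Qed.
Lemma extpred_contr l v z : extdeg l z -> extpred l (contr (cvec v) z).
Proof.
case: l => [|l] h; first by rewrite contr_extdeg0 // => S _; rewrite ffunE.
by move=> S; rewrite eqSS; apply: extdeg_contr.
Qed.
Lemma extdeg_wdiff l z : extpred l z -> extdeg l (wdiff z).
Proof.
case: l => [|l] h.
  by rewrite (_ : z = 0) ?raddf0; [exact: extdeg0_0 | apply/ffunP=> S; rewrite h // ffunE].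
by apply: extdeg_sum => b _; apply/extdeg_wedge/extdeg_ederiv => S hS; rewrite h.
Qed.

Fixpoint wchain (bs : seq 'I_m.+1) z : E :=
  if bs is b :: bs' then wedge (cvec (wron b)) (wchain bs' z) else z.

Lemma wchain_is_linear bs : linear (wchain bs).
Proof. by elim: bs => //= b bs IH c x y; rewrite IH linearP. Qed.
HB.instance Definition _ bs := GRing.isLinear.Build B E E *:%R (wchain bs) (wchain_is_linear bs).

Lemma wchain_wedge bs v z :
  wchain bs (wedge (cvec v) z) = (-1) ^+ size bs *: wedge (cvec v) (wchain bs z).
Proof.
elim: bs => [|b bs IH] /=; first by rewrite scale1r.
by rewrite IH linearZ /= wedge_wedge exprS mulN1r scaleNr scalerN.
Qed.

Lemma wchain_mem bs b z : b \in bs -> wchain bs (wedge (cvec (wron b)) z) = 0.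
Proof.
elim: bs => //= c bs IH; rewrite inE => /orP[/eqP <-|/IH ->]; last by rewrite raddf0.
by rewrite wchain_wedge linearZ /= wedge_sqr scaler0.
Qed.

(** * Exactness up to a multiple, from dual vectors *)

Section Local.
Variables (k : 'I_m.+1) (dl' : A) (nu : 'I_m.+1 -> 'I_n -> A).
Hypothesis xik : xi k != 0.
Let dl := xi k * dl'.
Hypothesis nu_wron : forall b c, b != k -> c != k ->
  \sum_s nu b s * wron c s = dl *+ (b == c).

(** Pair [sum_wron] with [nu b] and cancel [xi k]; this is why [dl] is taken to be a multiple of
    [xi k]. *)
Lemma nu_wron_k b : b != k -> \sum_s nu b s * wron k s = - (xi b * dl').
Proof.
move=> bk; apply: (mulfI xik).
have : \sum_c xi c * \sum_s nu b s * wron c s = 0.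
  under eq_bigr => c _ do rewrite mulr_sumr.
  rewrite exchange_big big1 //= => s _.
  under eq_bigr => c _ do rewrite mulrCA.
  by rewrite -mulr_sumr sum_wron mulr0.
rewrite (bigD1 k) //= (bigD1 b) //= (nu_wron bk bk) eqxx [X in _ + (_ + X)]big1 ?addr0 => [E|c /andP[ck cb]].
  have /eqP := E; rewrite addr_eq0 => /eqP ->; rewrite mulr1n /dl; ring.
by rewrite nu_wron // eq_sym (negbTE cb) mulr0.
Qed.

(** A homotopy of Koszul type: it trades a factor u_b, b <> k, for the variable e_b. *)
Definition whomot z : E := \sum_(b | b != k) X b *: contr (cvec (nu b)) z.
(** The number operator: a product of t vectors u_b, b <> k, is multiplied by t times [dl] (see
    [wnum_wedge]). *)
Definition wnum z : E := \sum_(b | b != k) wedge (cvec (wron b)) (contr (cvec (nu b)) z).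

Lemma whomot_is_linear : linear whomot.
Proof.
move=> c x y; rewrite /whomot scaler_sumr -big_split; apply: eq_bigr => b _ /=.
by rewrite linearP /= scalerDr !scalerA [_ * c]mulrC.
Qed.
HB.instance Definition _ := GRing.isLinear.Build B E E *:%R whomot whomot_is_linear.
Lemma wnum_is_linear : linear wnum.
Proof.
by move=> c x y; rewrite /wnum scaler_sumr -big_split; apply: eq_bigr => b _ /=; rewrite !linearP.
Qed.
HB.instance Definition _ := GRing.isLinear.Build B E E *:%R wnum wnum_is_linear.

(** As in the Koszul complex, the anticommutator counts the polynomial degree plus the number of
    factors u_b. The index k, which has no dual vector, is eliminated by [nu_wron_k] and leaves a
    multiple of [eform]. *)
Lemma whomotP j z : ehom j z ->
  whomot (wdiff z) + wdiff (whomot z)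
  = wnum z + C (dl * j%:R) *: z - (C dl' * eform) *: ederiv k z.
Proof.
move=> hz.
have E1 : wdiff (whomot z) = wnum z + \sum_(b | b != k) \sum_c
    X b *: wedge (cvec (wron c)) (contr (cvec (nu b)) (ederiv c z)).
  rewrite /whomot raddf_sum -big_split; apply: eq_bigr => b bk /=.
  rewrite /wdiff (eq_bigr (fun c => wedge (cvec (wron c)) (D c (X b) *: contr (cvec (nu b)) z)
     + X b *: wedge (cvec (wron c)) (contr (cvec (nu b)) (ederiv c z)))); last first.
    by move=> c _; rewrite ederivZ raddfD /= -wedgeZ ederiv_contr.
  rewrite big_split; congr (_ + _); rewrite (bigD1 b) //= big1 ?addr0.
    by rewrite pa_derX eqxx scale1r.
  by move=> c cb; rewrite pa_derX eq_sym (negbTE cb) scale0r raddf0.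
have E2 : whomot (wdiff z) + \sum_(b | b != k) \sum_c
    X b *: wedge (cvec (wron c)) (contr (cvec (nu b)) (ederiv c z)) =
   \sum_(b | b != k) \sum_c (X b * C (\sum_s nu b s * wron c s)) *: ederiv c z.
  rewrite -big_split; apply: eq_bigr => b bk; rewrite /= raddf_sum scaler_sumr -big_split.
  apply: eq_bigr => c _ /=; rewrite contr_wedge scalerBr subrK scalerA.
  by congr (_ * _ *: _); rewrite rmorph_sum; apply: eq_bigr => s _; rewrite /= rmorphM.
rewrite E1 addrCA E2 -addrA; congr (_ + _).
transitivity (\sum_(b | b != k) ((C dl * X b) *: ederiv b z
    - (C dl' * (C (xi b) * X b)) *: ederiv k z)).
  apply: eq_bigr => b bk.
  rewrite (sum_two bk) => [|c ck cb].
    rewrite (nu_wron bk bk) eqxx mulr1n (nu_wron_k bk).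
    have -> : X b * C (- (xi b * dl')) = - (C dl' * (C (xi b) * X b)) :> B.
      by rewrite rmorphN rmorphM; ring.
    by rewrite scaleNr [X b * C dl]mulrC.
  by rewrite nu_wron // eq_sym (negbTE cb) mulr0n rmorph0 mulr0 scale0r.
have F : C dl' * eform = C dl * X k + C dl' * \sum_(b | b != k) C (xi b) * X b.
  by rewrite /eform (bigD1 k) //= /dl rmorphM; ring.
have G : C (dl * j%:R) *: z
    = (C dl * X k) *: ederiv k z + \sum_(b | b != k) (C dl * X b) *: ederiv b z.
  rewrite rmorphM -scalerA -(euler_ext hz) (bigD1 k) //= scalerDr scalerA; congr (_ + _).
  by rewrite scaler_sumr; apply: eq_bigr => b _; rewrite scalerA.
have H : \sum_(b | b != k) (C dl' * (C (xi b) * X b)) *: ederiv k z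
    = (C dl' * \sum_(b | b != k) C (xi b) * X b) *: ederiv k z.
  by rewrite mulr_sumr scaler_suml.
rewrite sumrB H G F scalerDl.
set P := \sum_(b | b != k) _ *: ederiv b z.
set Q := (C dl' * _) *: _; set T := (C dl * _) *: _.
by rewrite opprD addrACA subrr add0r.
Qed.

(** The falling factorial of the number operator, the product of the operators [wnum] - r dl for r <
    t (see [wfallS]). Written as t contractions followed by t multiplications, it visibly kills
    forms of degree less than t. *)
Fixpoint wfall t z : E := if t is t'.+1 then
  \sum_(b | b != k) wedge (cvec (wron b)) (wfall t' (contr (cvec (nu b)) z)) else z.

Lemma wfallE t z : wfall t.+1 z =
  \sum_(b | b != k) wedge (cvec (wron b)) (wfall t (contr (cvec (nu b)) z)).
Proof. by []. Qed.

Lemma wfall_extdeg l z : extdeg l z -> wfall l.+1 z = 0.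
Proof.
elim: l z => [|l IH] z hz.
  by rewrite /= big1 // => b _; rewrite contr_extdeg0 // raddf0.
rewrite wfallE big1 // => b _.
by rewrite IH ?raddf0 //; apply: extdeg_contr.
Qed.

Lemma wnum_wedge b z : b != k -> wnum (wedge (cvec (wron b)) z)
   = C dl *: wedge (cvec (wron b)) z + wedge (cvec (wron b)) (wnum z).
Proof.
move=> bk; rewrite /wnum raddf_sum.
rewrite (eq_bigr (fun c => C (dl *+ (c == b)) *: wedge (cvec (wron c)) z +
   wedge (cvec (wron b)) (wedge (cvec (wron c)) (contr (cvec (nu c)) z)))).
  rewrite big_split; congr (_ + _); rewrite (bigD1 b) //= eqxx big1 ?addr0 // => c /andP[_ cb].
  by rewrite (negbTE cb) rmorph0 scale0r.
move=> c ck; rewrite contr_wedge raddfB /= wedgeZ -nu_wron // [in RHS]wedge_wedge; congr (_ *: _ - _).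
by rewrite rmorph_sum; apply: eq_bigr => s _; rewrite /= rmorphM.
Qed.

Lemma wfallS t z : wfall t.+1 z = wnum (wfall t z) - C (dl *+ t) *: wfall t z.
Proof.
elim: t z => [|t IH] z; first by rewrite rmorph0 scale0r subr0.
rewrite wfallE (eq_bigr (fun b => wnum (wedge (cvec (wron b)) (wfall t (contr (cvec (nu b)) z)))
   - C (dl *+ t.+1) *: wedge (cvec (wron b)) (wfall t (contr (cvec (nu b)) z)))).
  by rewrite sumrB -raddf_sum -scaler_sumr.
move=> b bk; rewrite IH wnum_wedge // mulrS rmorphD scalerDl.
rewrite wedgeB.
rewrite [wedge _ (_ *: _)]wedgeZ.
by rewrite opprD addrA [_ + wedge _ _]addrC addrK.
Qed.

Lemma ehom_wnum j z : ehom j z -> ehom j (wnum z).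
Proof. by move=> h; apply: ehom_sum => b _; apply/ehom_wedge/ehom_contr. Qed.
Lemma extdeg_wnum l z : extdeg l z -> extdeg l (wnum z).
Proof.
move=> h; apply: extdeg_sum => b _; case: l h => [|l] h.
  by rewrite contr_extdeg0 // raddf0; exact: extdeg0_0.
exact/extdeg_wedge/extdeg_contr.
Qed.

Definition wbound j l z := exists y w, [/\ ehom j.+1 y, extpred l y & z = wdiff y + eform *: w].

Lemma wboundD j l z y : wbound j l z -> wbound j l y -> wbound j l (z + y).
Proof.
move=> [y1 [w1 [h1 h2 ->]]] [y2 [w2 [h3 h4 ->]]]; exists (y1 + y2), (w1 + w2).
by split; [exact: ehomD | exact: extpredD | rewrite raddfD scalerDr addrACA].
Qed.
Lemma wboundZC j l a z : wbound j l z -> wbound j l (C a *: z).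
Proof.
move=> [y [w [h1 h2 ->]]]; exists (C a *: y), (C a *: w).
by split; [exact: ehomZC | exact: extpredZ | rewrite wdiffZC scalerDr !scalerA [eform * _]mulrC].
Qed.

(** By the homotopy formula, the number operator acts on cycles modulo [eform] as - j dl up to
    boundaries. *)
Lemma wbound_num j l z : ehom j z -> extdeg l z -> (exists w, wdiff z = eform *: w) ->
  wbound j l (wnum z + C (dl * j%:R) *: z).
Proof.
move=> h1 h2 [w hw]; exists (whomot z), (whomot w + C dl' *: ederiv k z).
split.
- by apply: ehom_sum => b _; apply/ehomX/ehom_contr.
- by apply: extpred_sum => b _; apply/extpredZ/extpred_contr.
have := whomotP h1; rewrite hw linearZ /= => /(congr1 (+%R^~ ((C dl' * eform) *: ederiv k z))).
rewrite subrK => <-; rewrite scalerDr scalerA [eform * _]mulrC addrA; congr (_ + _).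
by rewrite addrC.
Qed.

Lemma wbound_cycle j l z : wbound j l z -> exists w, wdiff z = eform *: w.
Proof.
move=> [y [w [_ _ ->]]]; exists (wdiff w).
by rewrite raddfD /= wdiff_wdiff wdiff_eform add0r.
Qed.

(** Since [wnum] acts as - j dl up to boundaries, [wfall t] acts as the product of the - dl (j + r),
    r < t. For t = l + 1 it kills z, so this product times z is a boundary. *)
Lemma wlocal j l z : ehom j z -> extdeg l z -> (exists w, wdiff z = eform *: w) ->
  wbound j l (C (\prod_(r < l.+1) (dl * (j + r)%:R)) *: z).
Proof.
move=> h1 h2 h3.
suff H t : [/\ ehom j (wfall t z), extdeg l (wfall t z) &
     wbound j l (wfall t z - C ((-1) ^+ t * \prod_(r < t) (dl * (j + r)%:R)) *: z)].
  have [_ _] := H l.+1; rewrite wfall_extdeg // sub0r -scaleNr -rmorphN => h.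
  have := wboundZC ((-1) ^+ l) h; rewrite scalerA -rmorphM exprS mulN1r mulNr opprK mulrA.
  by rewrite -expr2 sqrr_sign mul1r.
elim: t => [|t [g1 g2 g3]].
  split=> //=; rewrite big_ord0 mulr1 rmorph1 scale1r subrr.
  by exists 0, 0; split; rewrite ?raddf0 ?scaler0 ?addr0 // => S; rewrite ffunE //; exact: pa_hom0.
have hd : wfall t.+1 z = (wnum (wfall t z) + C (dl * j%:R) *: wfall t z)
     - C (dl * (j + t)%:R) *: wfall t z.
  rewrite wfallS -addrA -scalerBl; congr (_ + _); rewrite -scaleNr; congr (_ *: _).
  by rewrite natrD mulrDr rmorphD opprD addrA subrr add0r mulr_natr.
split.
- by rewrite wfallS -scaleNr -rmorphN; apply: ehomD (ehom_wnum g1) (ehomZC _ g1).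
- by rewrite wfallS -scaleNr; apply: extdegD (extdeg_wnum g2) (extdegZ _ g2).
set e := (_ * \prod_(r < t) _) in g3; set b := wfall t z - _ in g3.
have Eb : wfall t z = b + C e *: z by rewrite subrK.
have hb : ehom j b by rewrite /b -scaleNr -rmorphN; exact: ehomD g1 (ehomZC _ h1).
have hb' : extdeg l b by rewrite /b -scaleNr; exact: extdegD g2 (extdegZ _ h2).
have := wboundD (wbound_num hb hb' (wbound_cycle g3)) (wboundD (wboundZC e (wbound_num h1 h2 h3))
    (wboundZC (- (dl * (j + t)%:R)) g3)).
set r := dl * (j + t)%:R in hd *.
have H1 : wnum (wfall t z) + C (dl * j%:R) *: wfall t z =
    (wnum b + C (dl * j%:R) *: b) + C e *: (wnum z + C (dl * j%:R) *: z).
  rewrite Eb linearD /= (linearZ _ z) /= !scalerDr !scalerA.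
  by rewrite [C (dl * _) * C e]mulrC addrACA.
have H2 : C r *: wfall t z = C r *: b + C (e * r) *: z.
  by rewrite {1}Eb scalerDr scalerA -rmorphM [r * e]mulrC.
have -> : (-1) ^+ t.+1 * \prod_(i < t.+1) (dl * (j + i)%:R) = - (e * r).
  by rewrite /e /r big_ord_recr /= exprS mulN1r !mulNr !mulrA.
congr wbound; rewrite hd H1 H2 !rmorphN !scaleNr opprK opprD.
by rewrite [in RHS]addrA subrK -[in RHS]addrA.
Qed.
Lemma wchain_contr bs b z : b != k -> b \notin bs -> k \notin bs ->
  contr (cvec (nu b)) (wchain bs z) = (-1) ^+ size bs *: wchain bs (contr (cvec (nu b)) z).
Proof.
move=> bk; elim: bs => [|c bs IH] /=; first by rewrite scale1r.
rewrite !inE !negb_or => /andP[bc bbs] /andP[kc kbs]; rewrite eq_sym in kc.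
rewrite contr_wedge [X in X *: _](_ : _ = 0).
  by rewrite scale0r sub0r IH // linearZ /= exprS mulN1r scaleNr.
transitivity (C (\sum_s nu b s * wron c s)); last by rewrite nu_wron // (negbTE bc) rmorph0.
by rewrite rmorph_sum; apply: eq_bigr => s _; rewrite /= rmorphM.
Qed.

(** Induction on the chain: if its product with z is 0, then dl z minus u_b times the contraction of
    z with [nu b] is killed by the chain without b. Thus a multiple of z lies in the ideal of the
    u_b. *)
Lemma wchain_eq0 l bs z : uniq bs -> k \notin bs -> ehom 0 z -> extdeg l z -> wchain bs z = 0 ->
  exists y : 'I_m.+1 -> E, [/\ forall b, ehom 0 (y b), forall b, extpred l (y b) &
    C (dl ^+ size bs) *: z = \sum_b wedge (cvec (wron b)) (y b)].
Proof.
move=> ubs kbs hz dz; elim: bs z ubs kbs hz dz => [|b bs IH] z /=.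
  move=> _ _ _ _ ->; exists (fun=> 0); split=> [b|b S _|]; rewrite ?ffunE //; first exact: ehom0.
  by rewrite scaler0 big1 // => b _; rewrite raddf0.
rewrite inE negb_or eq_sym => /andP[bbs ubs] /andP[bk kbs] hz dz h.
have nub : \sum_s cvec (nu b) s * cvec (wron b) s = C dl.
  transitivity (C (\sum_s nu b s * wron b s)); last by rewrite nu_wron // eqxx.
  by rewrite rmorph_sum; apply: eq_bigr => s _; rewrite /= rmorphM.
have E1 : C dl *: wchain bs z = wedge (cvec (wron b)) (contr (cvec (nu b)) (wchain bs z)).
  by apply/eqP; rewrite -subr_eq0 -nub -contr_wedge h raddf0.
have h2 : wchain bs (C dl *: z - wedge (cvec (wron b)) (contr (cvec (nu b)) z)) = 0.
  rewrite linearB linearZ /= E1 wchain_contr // linearZ /= wchain_wedge; exact: subrr.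
have hc : ehom 0 (contr (cvec (nu b)) z) by exact: ehom_contr.
have [||y [y1 y2 y3]] := IH _ ubs kbs _ _ h2.
- by apply: ehomB; [exact: ehomZC | exact: ehom_wedge].
- rewrite -scaleN1r; apply: extdegD; apply: extdegZ => //.
  case: (l) dz => [|l'] dz; last exact/extdeg_wedge/extdeg_contr.
  by rewrite contr_extdeg0 // raddf0; exact: extdeg0_0.
exists (fun c => y c + if c == b then C (dl ^+ size bs) *: contr (cvec (nu b)) z else 0); split=> [c|c|].
- by apply: ehomD => //; case: ifP => _; [exact: ehomZC | exact: ehom0].
- apply: extpredD => //; case: ifP => _; last by move=> S _; rewrite ffunE.
  exact/extpredZ/extpred_contr.
under eq_bigr do rewrite raddfD /=.
rewrite big_split /= -y3 (bigD1 b) //= eqxx big1 ?addr0 => [|c /negbTE ->]; last by rewrite raddf0.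
by rewrite [wedge _ (_ *: _)]wedgeZ -scalerDr subrK scalerA -rmorphM exprSr.
Qed.

(** A form annihilated by u_b is, up to [dl], u_b times its contraction with [nu b], and the
    contraction is still annihilated by the other vectors; so they split off one after the other. *)
Lemma wchain_exact l bs f : uniq bs -> k \notin bs -> ehom 0 f -> extdeg (size bs + l)%N f ->
  (forall b, b \in bs -> wedge (cvec (wron b)) f = 0) ->
  exists t, [/\ ehom 0 t, extdeg l t & C (dl ^+ size bs) *: f = wchain bs t].
Proof.
elim: bs f => [|b bs IH] f /=; first by exists f; rewrite expr0 rmorph1 scale1r.
rewrite inE negb_or eq_sym => /andP[bbs ubs] /andP[bk kbs] hf df h.
have nub c : c != k -> \sum_s cvec (nu b) s * cvec (wron c) s = C (dl *+ (b == c)).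
  move=> ck; transitivity (C (\sum_s nu b s * wron c s)); last by rewrite nu_wron.
  by rewrite rmorph_sum; apply: eq_bigr => s _; rewrite /= rmorphM.
have E1 : C dl *: f = wedge (cvec (wron b)) (contr (cvec (nu b)) f).
  have := contr_wedge (cvec (nu b)) (cvec (wron b)) f.
  rewrite h ?mem_head // raddf0 nub // eqxx => /eqP; rewrite eq_sym subr_eq0 => /eqP //.
have [|||t [t1 t2 t3]] := IH (contr (cvec (nu b)) f) ubs kbs.
- exact: ehom_contr.
- exact: extdeg_contr.
- move=> c cbs; have ck : c != k by apply: contraNneq kbs => <-.
  have := contr_wedge (cvec (nu b)) (cvec (wron c)) f.
  rewrite h ?inE ?cbs ?orbT // raddf0 nub // (_ : b == c = false).
    by rewrite rmorph0 scale0r sub0r => /eqP; rewrite eq_sym oppr_eq0 => /eqP.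
  by apply: contraNF bbs => /eqP ->.
exists t; split=> //; rewrite -t3 wedgeZ -E1 scalerA -rmorphM exprSr //.
Qed.
End Local.
End WronskiComplex.

(** * Dual vectors of the Wronskians, up to a power of one coefficient *)

Section DualVectors.
Variables (m : nat) (W : polyalg m).
Local Notation A := (pa_base W).
Variables (xi : 'I_m.+1 -> A) (k : 'I_m.+1).
Hypothesis xi_lt : forall a : 'I_m.+1, (a < k)%N -> xi a = 0.
Hypothesis natU : forall i, (0 < i <= m)%N -> (i%:R : A) \is a GRing.unit.

Lemma subn_unit (b c : 'I_m.+1) : b != c -> (b%:R - c%:R : A) \is a GRing.unit.
Proof.
move=> bc; case: (ltngtP b c) => [h|h|/val_inj E]; last by rewrite E eqxx in bc.
  rewrite -opprB unitrN -natrB 1?ltnW //; apply: natU; have := ltn_ord c; lia.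
by rewrite -natrB 1?ltnW //; apply: natU; have := ltn_ord b; lia.
Qed.

(** Column b collects the entries of index k + b - 1 of all the u_c. As xi vanishes below k, this is
    triangular with diagonal entries (b - k) xi_k. Row and column k, where the diagonal would
    vanish, are replaced by those of xi_k times the identity. *)
Let Q : 'M[A]_m.+1 := \matrix_(c, b) if (c == k) || (b == k) then xi k *+ (c == b) else
  \sum_(a : 'I_m.+1 | (a + c == k + b)%N) (c%:R - a%:R) * xi a.

Let detQ : exists2 u, u \is a GRing.unit & \det Q = u * xi k ^+ m.+1.
Proof.
rewrite -det_tr det_trig; last first.
  apply/is_trig_mxP => b c bc; rewrite !mxE.
  case: ifP => _; first by rewrite (_ : c == b = false) //; apply/eqP => E; rewrite E ltnn in bc.
  by rewrite big1 // => a /eqP E; rewrite xi_lt ?mulr0 //; lia.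
exists (\prod_(b : 'I_m.+1) if b == k then 1 else (b%:R - k%:R)).
  by apply: rpred_prod => b _; case: ifPn => [_|bk]; [exact: unitr1 | exact: subn_unit].
have -> : xi k ^+ m.+1 = \prod_(b < m.+1) xi k by rewrite prodr_const card_ord.
rewrite -big_split; apply: eq_bigr => b _ /=.
rewrite !mxE eqxx orbb; case: ifP => [_|bk]; first by rewrite mul1r.
rewrite (bigD1 k) /=; last by rewrite addnC.
rewrite big1 ?addr0 // => a /andP[/eqP E ak].
by case/eqP: ak; apply/val_inj => /=; lia.
Qed.

(** The b-th vector is column b of the adjugate of [Q], divided by the unit part of the determinant,
    with its entry b' placed at index k + b' - 1. *)
Lemma dual_vectors : exists nu : 'I_m.+1 -> 'I_(m.*2.-1) -> A,
  forall b c, b != k -> c != k -> \sum_s nu b s * wron xi c s = xi k ^+ m.+1 *+ (b == c).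
Proof.
have [u uU dQ] := detQ.
exists (fun b s => u^-1 * \sum_(b' : 'I_m.+1 | (b' != k) && (k + b' == s.+1)%N) \adj Q b' b).
move=> b c bk ck.
under eq_bigr => s _ do rewrite -mulrA mulr_suml.
rewrite -mulr_sumr (exchange_big_dep (fun b' => b' != k)) /=; last by move=> s b' _ /andP[].
have /matrixP/(_ c b) := mul_mx_adj Q; rewrite !mxE dQ (bigD1 k) //= mxE eqxx orbT (negbTE ck) mul0r add0r.
rewrite [b == c]eq_sym => E; apply: (mulrI uU); rewrite mulrA divrr // mul1r mulrnAr -E.
apply: eq_bigr => b' b'k; have -> : Q c b' = \sum_(a : 'I_m.+1 | (a + c == k + b')%N) (c%:R - a%:R) * xi a.
  by rewrite mxE (negbTE ck) (negbTE b'k).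
(* As b' differs from k, the sum k + b' lies between 1 and 2m - 1: the index is in range and its
   predecessor is not truncated. *)
have hs : ((k + b').-1 < m.*2.-1)%N.
  have := ltn_ord k; have := ltn_ord b'; move/eqP: b'k => b'k.
  have : val b' <> val k by move=> h; apply: b'k; apply: val_inj.
  by rewrite /=; lia.
have h1 : (k + b').-1.+1 = (k + b')%N.
  have : val b' <> val k by move=> h; move/eqP: b'k; apply; apply: val_inj.
  by rewrite /=; lia.
rewrite (big_pred1 (Ordinal hs)) => [|s] /=.
  by rewrite mulrC; congr (_ * _); apply: eq_bigl => a /=; rewrite h1.
rewrite b'k /=; apply/eqP/eqP => [h|->] /=; last by rewrite h1.
by apply/val_inj; rewrite /= h.
Qed.
End DualVectors.

(* W1 is W0 with one more parameter x adjoined to the base; sp_red sets x = 0. *)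
Record specialization m (W0 W1 : polyalg m) (x : pa_base W1) := Specialization {
  sp_base : {rmorphism pa_base W1 -> pa_base W0};
  sp_red : {rmorphism pa_alg W1 -> pa_alg W0};
  sp_lift : {rmorphism pa_alg W0 -> pa_alg W1};
  sp_liftK : cancel sp_lift sp_red;
  sp_const : forall a, sp_red (pa_const W1 a) = pa_const W0 (sp_base a);
  sp_var : forall b, sp_red (pa_var W1 b) = pa_var W0 b;
  sp_der : forall b p, sp_red (pa_der W1 b p) = pa_der W0 b (sp_red p);
  sp_hom : forall j p, pa_hom j p -> pa_hom j (sp_red p);
  sp_lift_hom : forall j p, pa_hom j p -> pa_hom j (sp_lift p);
  sp_param : sp_base x = 0;
  sp_ker : forall p, sp_red p = 0 ->
    exists2 q, p = pa_const W1 x * q & forall j, pa_hom j p -> pa_hom j q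
}.

Definition wexact m n (W : polyalg m) (xi : 'I_m.+1 -> pa_base W) j l :=
  forall z : ext (pa_alg W) n, ehom j z -> extdeg l z ->
  (exists w, wdiff xi z = eform xi *: w) -> wbound xi j l z.

(** * Cancelling a coefficient by setting it to zero *)

Section Descent.
Variables (m : nat) (W0 W1 : polyalg m) (k : 'I_m.+1).
Variables (xi0 : 'I_m.+1 -> pa_base W0) (xi1 : 'I_m.+1 -> pa_base W1).
Variable S : specialization W0 (xi1 k).
Hypothesis red_xi : forall b, sp_base S (xi1 b) = xi0 b.
Hypothesis xik : xi1 k != 0.
Hypothesis form0 : eform xi0 != 0.
Local Notation n := (m.*2.-1).
Local Notation E0 := (ext (pa_alg W0) n).
Local Notation E1 := (ext (pa_alg W1) n).
Local Notation C0 := (pa_const W0).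
Local Notation C1 := (pa_const W1).
Local Notation x := (xi1 k).

Definition ered (z : E1) : E0 := [ffun T : {set 'I_n} => (sp_red S (z T) : (pa_alg W0)^o)].
Definition elift (z : E0) : E1 := [ffun T : {set 'I_n} => (sp_lift S (z T) : (pa_alg W1)^o)].

Lemma ered_is_additive : additive ered.
Proof. by move=> y z; apply/ffunP=> T; rewrite !ffunE raddfB. Qed.
HB.instance Definition _ := GRing.isAdditive.Build E1 E0 ered ered_is_additive.

Lemma eredZ p z : ered (p *: z) = sp_red S p *: ered z.
Proof. by apply/ffunP=> T; rewrite !ffunE; exact: rmorphM. Qed.

Lemma eliftK : cancel elift ered.
Proof. by move=> z; apply/ffunP=> T; rewrite !ffunE sp_liftK. Qed.

Lemma ered_wedge (v : 'I_n -> pa_base W1) z :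
  ered (wedge (cvec v) z) = wedge (cvec (fun s => sp_base S (v s))) (ered z).
Proof.
apply/ffunP=> T; rewrite !ffunE raddf_sum; apply: eq_bigr => a _ /=.
by rewrite !rmorphM !ffunE esgnE /cvec !sp_const esgnE /esgn rmorphXn rmorphN rmorph1.
Qed.

Lemma ered_wron b z : ered (wedge (cvec (wron xi1 b)) z) = wedge (cvec (wron xi0 b)) (ered z).
Proof.
rewrite ered_wedge; apply: eq_wedge => s; rewrite rmorph_sum; apply: eq_bigr => a _ /=.
by rewrite rmorphM rmorphB !rmorph_nat red_xi.
Qed.

Lemma ered_wdiff z : ered (wdiff xi1 z) = wdiff xi0 (ered z).
Proof.
rewrite /wdiff raddf_sum; apply: eq_bigr => b _ /=; rewrite ered_wron; congr (wedge _ _).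
by apply/ffunP=> T; rewrite !ffunE sp_der.
Qed.

Lemma ered_wchain bs z : ered (wchain xi1 bs z) = wchain xi0 bs (ered z).
Proof. by elim: bs => //= b bs IH; rewrite ered_wron IH. Qed.

Lemma red_eform : sp_red S (eform xi1) = eform xi0.
Proof.
rewrite rmorph_sum; apply: eq_bigr => b _ /=.
by rewrite rmorphM sp_const red_xi sp_var.
Qed.

Lemma ered_hom j z : ehom j z -> ehom j (ered z).
Proof. by move=> h T; rewrite ffunE; apply: sp_hom. Qed.
Lemma elift_hom j z : ehom j z -> ehom j (elift z).
Proof. by move=> h T; rewrite ffunE; apply: sp_lift_hom. Qed.
Lemma ered_extpred l z : extpred l z -> extpred l (ered z).
Proof. by move=> h T hT; rewrite ffunE h // rmorph0. Qed.
Lemma elift_extpred l z : extpred l z -> extpred l (elift z).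
Proof. by move=> h T hT; rewrite ffunE h // rmorph0. Qed.

Lemma Cx_neq0 : C1 x != 0.
Proof. by apply: contraNneq xik => h; apply/eqP/(@pa_const_inj _ W1); rewrite h rmorph0. Qed.

Lemma escale_inj (R : idomainType) (a : R) (z : ext R n) : a != 0 -> a *: z = 0 -> z = 0.
Proof.
move=> a0 /ffunP h; apply/ffunP=> T; have := h T; rewrite !ffunE => /eqP.
by rewrite [_ == 0]mulf_eq0 (negbTE a0) /= => /eqP.
Qed.

Lemma ered_ker z : ered z = 0 ->
  exists q, [/\ z = C1 x *: q, forall j, ehom j z -> ehom j q & forall l, extpred l z -> extpred l q].
Proof.
move=> h; have h' T : exists q : pa_alg W1, z T = C1 x * q /\ forall j, pa_hom j (z T) -> pa_hom j q.
  have := congr1 (fun f : E0 => f T) h; rewrite !ffunE => /(sp_ker (s := S))[q e hq].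
  by exists q.
have [f hf] := fin_all_exists h'.
exists [ffun T : {set 'I_n} => (f T : (pa_alg W1)^o)]; split.
- by apply/ffunP=> T; rewrite !ffunE; case: (hf T).
- by move=> j hz T; rewrite ffunE; case: (hf T) => _; apply.
move=> l hz T hT; rewrite ffunE; case: (hf T); rewrite hz // => /eqP.
by rewrite eq_sym mulf_eq0 (negbTE Cx_neq0) /= => /eqP.
Qed.

Lemma eform_hom : pa_hom 1 (eform xi0).
Proof. by apply: hom_sum => b _; apply/pa_homCM/pa_homX. Qed.

(** [pa_hom_factor] provides some homogeneous cofactor, which in a domain must be the given one. *)
Lemma eform_factor j l (w : E0) : ehom j.+1 (eform xi0 *: w) -> extpred l (eform xi0 *: w) ->
  ehom j w /\ extpred l w.
Proof.
move=> h1 h2; split=> T; last first.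
  move=> hT; have := h2 T hT; rewrite ffunE => /eqP.
  by rewrite [_ == 0]mulf_eq0 (negbTE form0) /= => /eqP.
have := h1 T; rewrite ffunE => /(pa_hom_factor eform_hom)[q hq /eqP].
by rewrite -subr_eq0 -mulrBr mulf_eq0 (negbTE form0) subr_eq0 /= => /eqP ->.
Qed.

(** At x = 0, y becomes a cycle modulo [eform] of degrees j + 1 and l - 1, hence a boundary by the
    exactness assumed there; lifting the boundary leaves a remainder divisible by x. For l = 0, y
    itself is 0. *)
Lemma descent_split j l (y : E1) (w : E0) : (l = 0%N \/ wexact n xi0 j.+1 l.-1) ->
  ehom j.+1 y -> extpred l y -> wdiff xi0 (ered y) = eform xi0 *: w ->
  exists y1 w1 y2, [/\ y = wdiff xi1 y1 + eform xi1 *: w1 + C1 x *: y2,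
     ehom j w1, ehom j.+1 y2 & extpred l y2].
Proof.
case: l => [|l] hX h1 h2 hy.
  have -> : y = 0 by apply/ffunP=> T; rewrite h2 // ffunE.
  by exists 0, 0, 0; split; rewrite ?raddf0 ?scaler0 ?addr0 //; try exact: ehom0; move=> T _; rewrite ffunE.
case: hX => // hX; have [|||y0 [w0 [hy0 ey0 E]]] := hX (ered y).
- exact: ered_hom.
- by move=> T hT; rewrite (ered_extpred h2).
- by exists w.
have hf : ehom j.+1 (eform xi0 *: w0) /\ extpred l.+1 (eform xi0 *: w0).
  have -> : eform xi0 *: w0 = ered y - wdiff xi0 y0 by rewrite E addrC addKr.
  split; first by apply: ehomB; [exact: ered_hom | exact: ehom_wdiff].
  rewrite -scaleN1r; apply: extpredD; first exact: ered_extpred.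
  by apply: extpredZ => T hT; apply: (extdeg_wdiff xi0 ey0).
have [hw0 ew0] := eform_factor hf.1 hf.2.
pose y1 := elift y0; pose w1 := elift w0.
have [|y2 [E2 hy2 ey2]] := @ered_ker (y - (wdiff xi1 y1 + eform xi1 *: w1)).
  by rewrite raddfB raddfD /= ered_wdiff eredZ red_eform !eliftK E subrr.
exists y1, w1, y2; split.
- by rewrite -E2 addrC subrK.
- exact: elift_hom.
- apply: hy2; apply: ehomB => //; apply: ehomD; first exact/ehom_wdiff/elift_hom.
  move=> T; rewrite ffunE -add1n.
  have := elift_hom hw0 T => hT; rewrite /eform [_ *: _]mulr_suml; apply: hom_sum => b _.
  by rewrite -mulrA; apply/pa_homCM/pa_homXM.
apply: ey2; rewrite -scaleN1r; apply: extpredD => //; apply: extpredZ.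
apply: extpredD; last exact/extpredZ/elift_extpred.
by move=> T hT; apply: (extdeg_wdiff xi1 (elift_extpred ey0)).
Qed.

(** x and [eform xi1] form a regular sequence, since the form remains nonzero at x = 0. *)
Lemma form1_div (z w : E1) : C1 x *: z = eform xi1 *: w -> exists w', z = eform xi1 *: w'.
Proof.
move=> h; have : ered w = 0.
  apply: (escale_inj form0); rewrite -red_eform -eredZ -h eredZ sp_const sp_param rmorph0.
  by rewrite scale0r.
move=> /ered_ker[q [E _ _]]; exists q.
apply/eqP; rewrite -subr_eq0; apply/eqP/(escale_inj Cx_neq0).
by rewrite scalerBr h E !scalerA mulrC subrr.
Qed.

(** In x^(N+1) z = d y + e w, y is a cycle modulo e at x = 0. Splitting it as d y1 + e w1 + x y2
    makes x (x^N z - d y2) a multiple of e, and x can be cancelled. *)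
Lemma wbound_descent j l N (z : E1) : (l = 0%N \/ wexact n xi0 j.+1 l.-1) ->
  wbound xi1 j l (C1 (x ^+ N) *: z) -> wbound xi1 j l z.
Proof.
move=> hX; elim: N => [|N IH]; first by rewrite expr0 rmorph1 scale1r.
move=> [y [w [hy ey E]]]; apply: IH.
have Er : wdiff xi0 (ered y) = eform xi0 *: - ered w.
  have := congr1 ered E; rewrite exprS rmorphM -scalerA eredZ sp_const sp_param rmorph0 scale0r.
  rewrite raddfD /= ered_wdiff eredZ red_eform scalerN => /eqP.
  by rewrite eq_sym addr_eq0 => /eqP.
have [y1 [w1 [y2 [Ey hw1 hy2 ey2]]]] := descent_split hX hy ey Er.
have [|w' Ew'] := @form1_div (C1 (x ^+ N) *: z - wdiff xi1 y2) (wdiff xi1 w1 + w).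
  rewrite scalerBr scalerA -rmorphM -exprS E Ey !raddfD /= wdiff_wdiff add0r wdiff_eform wdiffZC.
  by rewrite [X in X - _]addrAC addrK.
exists y2, w'; split=> //.
by rewrite -Ew' addrC subrK.
Qed.

Hypothesis xi1_lt : forall a : 'I_m.+1, (a < k)%N -> xi1 a = 0.
Hypothesis natU : forall i, (0 < i <= m)%N -> (i%:R : pa_base W1) \is a GRing.unit.

(** [wlocal] makes z a boundary up to a power of x and the integers j, ..., j + l. These are units
    as 0 < j and j + l <= m, and [wbound_descent] removes the power of x. *)
Lemma wexact_descent j l : (0 < j)%N -> (j + l <= m)%N ->
  (l = 0%N \/ wexact n xi0 j.+1 l.-1) -> wexact n xi1 j l.
Proof.
move=> j0 jl hX z hz dz hw; have [nu hnu] := dual_vectors xi1_lt natU.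
have h := @wlocal _ _ _ xi1 k (x ^+ m) nu xik _ j l z hz dz hw.
have {h} := h _; rewrite -exprS => /(_ hnu).
have -> : \prod_(r < l.+1) (x ^+ m.+1 * (j + r)%:R) = x ^+ (m.+1 * l.+1) * \prod_(r < l.+1) (j + r)%:R.
  by rewrite big_split /= prodr_const card_ord exprM.
set u := \prod_(r < _) _ => h.
have uU : u \is a GRing.unit.
  by apply: rpred_prod => r _; apply: natU; have := ltn_ord r; lia.
apply: (wbound_descent hX (N := m.+1 * l.+1)).
have := wboundZC u^-1 h; rewrite scalerA -rmorphM [u^-1 * _]mulrC mulrK //.
Qed.

(** In polynomial degree 0, combinations of the u_b are boundaries of elements linear in the e_b, so
    [wchain_eq0] makes a multiple of z a boundary. When x is cancelled, the term in [eform]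
    disappears because [wdiff] kills its cofactor of degree 0. *)
Lemma wchain_descent l bs (z : E1) : uniq bs -> k \notin bs -> (l = 0%N \/ wexact n xi0 1 l.-1) ->
  ehom 0 z -> extdeg l z -> wchain xi1 bs z = 0 ->
  exists y : E1, [/\ ehom 1 y, extpred l y & z = wdiff xi1 y].
Proof.
move=> ubs kbs hX hz dz h0; have [nu hnu] := dual_vectors xi1_lt natU.
have h := @wchain_eq0 _ _ _ xi1 k (x ^+ m) nu _ l bs z ubs kbs hz dz h0.
have {h} := h _; rewrite -exprS => /(_ hnu) [yb [y1 y2]]; rewrite -exprM.
have : exists y : E1, [/\ ehom 1 y, extpred l y & \sum_b wedge (cvec (wron xi1 b)) (yb b) = wdiff xi1 y].
  exists (\sum_b pa_var W1 b *: yb b); split.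
  - by apply: ehom_sum => b _; apply: ehomX.
  - by apply: extpred_sum => b _; apply: extpredZ.
  rewrite /wdiff; apply: eq_bigr => b _; congr (wedge _ _).
  rewrite raddf_sum (bigD1 b) //= ederivZ pa_derX eqxx scale1r ederiv_ehom0 // scaler0 addr0.
  rewrite big1 ?addr0 // => c cb; rewrite ederivZ pa_derX (negbTE cb) scale0r add0r.
  by rewrite ederiv_ehom0 // scaler0.
move=> [y [hy ey ->]]; elim: (_ * _)%N y hy ey => [|N IH] y hy ey.
  by rewrite expr0 rmorph1 scale1r => E; exists y.
move=> E.
have Er : wdiff xi0 (ered y) = eform xi0 *: 0.
  have := congr1 ered E; rewrite exprS rmorphM -scalerA eredZ sp_const sp_param rmorph0 scale0r.
  by rewrite ered_wdiff scaler0 => <-.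
have [u1 [w1 [u2 [Ey hw1 hu2 eu2]]]] := descent_split hX hy ey Er.
apply: (IH u2) => //; apply/eqP; rewrite -subr_eq0; apply/eqP/(escale_inj Cx_neq0).
rewrite scalerBr scalerA -rmorphM -exprS E Ey !raddfD /= wdiff_wdiff add0r wdiff_eform wdiffZC.
rewrite addrK /wdiff big1 ?scaler0 // => b _.
by rewrite ederiv_ehom0 // raddf0.
Qed.
Section TopDescent.
Variables (c : 'I_m.+1) (r : seq 'I_m.+1).
Hypothesis all_idx : forall b, (b == k) || (b == c) || (b \in r).
Hypothesis uniq_idx : uniq [:: k, c & r].
Hypothesis xic : xi1 c != 0.

(** In sum_b xi_b u_b = 0, multiplied by the chain over [r], only the indices k and c survive. *)
Lemma wedge_exchange (t : E1) : C1 (xi1 c) *: wedge (cvec (wron xi1 c)) (wchain xi1 r t)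
  = - (C1 x *: wedge (cvec (wron xi1 k)) (wchain xi1 r t)).
Proof.
apply/eqP; rewrite -addr_eq0 -(sum_wedge_wron xi1 (wchain xi1 r t)); apply/eqP/esym.
apply: sum_two => [|b bk bc]; first by move: uniq_idx; rewrite /= inE eq_sym; case: eqP.
have br : b \in r by have := all_idx b; rewrite (negbTE bk) (negbTE bc).
have := wchain_mem xi1 t br; rewrite wchain_wedge => /(congr1 (fun y => (-1) ^+ size r *: y)).
by rewrite scalerA -expr2 sqrr_sign scale1r scaler0 => ->; rewrite scaler0.
Qed.

(** [wchain_exact] divides x^N f by the chain over c and [r]; [wedge_exchange] trades c for k at the
    cost of a factor xi_c, so that the chain is the one of the hypothesis at x = 0. There the
    cofactor becomes a boundary, and boundaries are killed by the chain, so x can be cancelled. *)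
Lemma wchain_top_descent l (f : E1) :
  (forall z : E0, ehom 0 z -> extdeg l z -> wchain xi0 (k :: r) z = 0 ->
     exists y, [/\ ehom 1 y, extpred l y & z = wdiff xi0 y]) ->
  ehom 0 f -> extdeg ((size r).+1 + l)%N f ->
  (forall b, wedge (cvec (wron xi1 b)) f = 0) ->
  exists2 t : E1, ehom 0 t & C1 (xi1 c) *: f = wchain xi1 (k :: r) t.
Proof.
move=> hX hf df hu; have [nu hnu] := dual_vectors xi1_lt natU.
have ucr : uniq (c :: r) by case/andP: uniq_idx.
have kcr : k \notin c :: r by case/andP: uniq_idx.
have h := @wchain_exact _ _ _ xi1 k (x ^+ m) nu _ l (c :: r) f ucr kcr hf df (fun b _ => hu b).
have {h} := h _; rewrite -exprS => /(_ hnu) [t0 [ht0 et0]]; rewrite -exprM /=.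
set N := (_ * _)%N => E.
have : exists t : E1, [/\ ehom 0 t, extdeg l t &
    C1 (xi1 c) *: (C1 (x ^+ N) *: f) = wchain xi1 (k :: r) t].
  exists (- (C1 x *: t0)); split.
  - by rewrite -scaleNr -rmorphN; apply: ehomZC.
  - by rewrite -scaleNr; apply: extdegZ.
  rewrite E wedge_exchange [RHS](linearN (wchain xi1 (k :: r))).
  by rewrite [in RHS](linearZ_LR (wchain xi1 (k :: r))).
elim: N {E} => [|N IH] [t [ht et E]].
  by exists t => //; move: E; rewrite expr0 rmorph1 scale1r.
apply: IH.
have Er : wchain xi0 (k :: r) (ered t) = 0.
  rewrite -ered_wchain -E eredZ exprS rmorphM -scalerA eredZ [sp_red S (C1 x)]sp_const sp_param.
  by rewrite rmorph0 scale0r scaler0.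
have [||y0 [hy0 ey0 E0]] := hX (ered t) _ _ Er; first exact: ered_hom.
  by move=> T hT; rewrite ffunE et // rmorph0.
have [|t' [Et ht' et']] := @ered_ker (t - wdiff xi1 (elift y0)).
  by rewrite raddfB /= ered_wdiff eliftK E0 subrr.
exists t'; split.
- by apply: ht'; apply: ehomB => //; apply/ehom_wdiff/elift_hom.
- move=> T hT; apply: (et' l.+1) => [T' hT'|]; last by rewrite eqSS.
  rewrite !ffunE et // sub0r.
  by rewrite (extdeg_wdiff xi1 (elift_extpred ey0) hT') oppr0.
(* For b = c, multiply by xi_c and exchange u_c for u_k, which then occurs twice. *)
have Z0 b (y : E1) : wchain xi1 (k :: r) (wedge (cvec (wron xi1 b)) y) = 0.
  case/orP: (all_idx b) => [/orP[/eqP ->|/eqP ->]|br].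
  - by apply: wchain_mem; rewrite mem_head.
  - have C1c : C1 (xi1 c) != 0.
      by apply: contraNneq xic => h; apply/eqP/(@pa_const_inj _ W1); rewrite h rmorph0.
    apply: (escale_inj C1c); rewrite wchain_wedge scalerA mulrC -scalerA /= wedge_wedge.
    by rewrite scalerN -wedgeZ wedge_exchange -scaleNr wedgeZ wedge_sqr !scaler0 oppr0 scaler0.
  by apply: wchain_mem; rewrite inE br orbT.
apply/eqP; rewrite -subr_eq0; apply/eqP/(escale_inj Cx_neq0); rewrite scalerBr.
rewrite [C1 x *: (C1 (xi1 c) *: _)]scalerA mulrC -scalerA (scalerA (C1 x)) -rmorphM -exprS E.
have Zd (y : E1) : wchain xi1 (k :: r) (wdiff xi1 y) = 0.
  by rewrite /wdiff (raddf_sum (wchain xi1 (k :: r))) big1 // => b _; apply: Z0.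
have -> : C1 x *: wchain xi1 (k :: r) t' = wchain xi1 (k :: r) t.
  rewrite -[LHS](linearZ_LR (wchain xi1 (k :: r))) -Et [LHS](raddfB (wchain xi1 (k :: r))).
  by rewrite [X in _ - X]Zd subr0.
exact: subrr.
Qed.
End TopDescent.
End Descent.

Section DescentAlong.
Variables (m : nat) (W0 W1 : polyalg m) (k : 'I_m.+1) (x : pa_base W1).
Variables (xi0 : 'I_m.+1 -> pa_base W0) (xi1 : 'I_m.+1 -> pa_base W1).
Variable S : specialization W0 x.
Hypothesis xi1k : xi1 k = x.
Hypothesis red_xi : forall b, sp_base S (xi1 b) = xi0 b.
Hypothesis x0 : x != 0.
Hypothesis form0 : eform xi0 != 0.
Hypothesis xi1_lt : forall a : 'I_m.+1, (a < k)%N -> xi1 a = 0.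
Hypothesis natU : forall i, (0 < i <= m)%N -> (i%:R : pa_base W1) \is a GRing.unit.
Local Notation n := (m.*2.-1).
Local Notation E0 := (ext (pa_alg W0) n).
Local Notation E1 := (ext (pa_alg W1) n).

(** The descent is restated with a parameter x only equal to [xi1 k]: in the tower it is literally
    the variable 'X. *)
Lemma wexact_along j l : (0 < j)%N -> (j + l <= m)%N ->
  (l = 0%N \/ wexact n xi0 j.+1 l.-1) -> wexact n xi1 j l.
Proof. by move: S red_xi x0; rewrite -xi1k => S' hS h0; apply: (wexact_descent (S := S')). Qed.

Lemma wchain_along l bs (z : E1) : uniq bs -> k \notin bs -> (l = 0%N \/ wexact n xi0 1 l.-1) ->
  ehom 0 z -> extdeg l z -> wchain xi1 bs z = 0 ->
  exists y : E1, [/\ ehom 1 y, extpred l y & z = wdiff xi1 y].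
Proof. by move: S red_xi x0; rewrite -xi1k => S' hS h0; apply: (wchain_descent (S := S')). Qed.

Lemma wchain_top_along c r l (f : E1) : (forall b, (b == k) || (b == c) || (b \in r)) ->
  uniq [:: k, c & r] -> xi1 c != 0 ->
  (forall z : E0, ehom 0 z -> extdeg l z -> wchain xi0 (k :: r) z = 0 ->
     exists y, [/\ ehom 1 y, extpred l y & z = wdiff xi0 y]) ->
  ehom 0 f -> extdeg ((size r).+1 + l)%N f ->
  (forall b, wedge (cvec (wron xi1 b)) f = 0) ->
  exists2 t : E1, ehom 0 t & pa_const W1 (xi1 c) *: f = wchain xi1 (k :: r) t.
Proof. by move: S red_xi x0; rewrite -xi1k => S' hS h0; move=> a1 a2 a3 a4 a5 a6 a7; apply: (wchain_top_descent (S := S') hS h0 xi1_lt natU a1 a2 a3 a4 a5 a6 a7). Qed.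
End DescentAlong.

(** * Polynomial rings and the specialization of a parameter *)

Section MPolyAlg.
Variables (m : nat) (A : idomainType).
Local Notation B := {mpoly A[m.+1]}.

Lemma mpa_DM (b : 'I_m.+1) (p q : B) : mderiv b (p * q) = mderiv b p * q + p * mderiv b q.
Proof. exact: mderivM. Qed.
Lemma mpa_DC (b : 'I_m.+1) (a : A) : mderiv b (mpolyC m.+1 a) = 0.
Proof. exact: mderivC. Qed.
Lemma mpa_DX (b c : 'I_m.+1) : mderiv b ('X_c : B) = (c == b)%:R.
Proof.
rewrite mderivX mnm1E; case: eqP => [->|_]; last by rewrite scale0r.
by rewrite scale1r (_ : (U_(b) - U_(b))%MM = 0%MM) ?mpolyX0 //; apply/mnmP => i; rewrite mnmBE mnm0E subnn.
Qed.
Lemma mpa_homB j (p q : B) : p \is j.-homog -> q \is j.-homog -> p - q \is j.-homog.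
Proof. exact: rpredB. Qed.
Lemma mpa_homCM j (a : A) (p : B) : p \is j.-homog -> mpolyC m.+1 a * p \is j.-homog.
Proof. by rewrite mul_mpolyC => /(rpredZ a). Qed.
Lemma mpa_homX b : ('X_b : B) \is 1.-homog.
Proof. by rewrite dhomogX /= mdeg1. Qed.
Lemma mpa_homXM j b (p : B) : p \is j.-homog -> 'X_b * p \is j.+1.-homog.
Proof. by move=> h; apply: (dhomogM (mpa_homX b) h). Qed.
Lemma mpa_factor j (p q : B) : p \is 1.-homog -> p * q \is j.+1.-homog ->
  exists2 q' : B, q' \is j.-homog & p * q = p * q'.
Proof.
move=> hp hq; exists (pihomog mdeg j q); first exact: pihomogP.
by rewrite -(pihomogM _ _ hp) add1n pihomog_dE.
Qed.
Lemma mpa_euler j (p : B) : p \is j.-homog -> \sum_b 'X_b * mderiv b p = mpolyC m.+1 j%:R * p.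
Proof. by move/mpoly_euler ->; rewrite mul_mpolyC. Qed.

Definition mpoly_pa : polyalg m :=
  @PolyAlg m A B (@mpolyC m.+1 A) (fun b => mderiv b) (fun b => 'X_b) (fun j p => p \is j.-homog)
    mpa_DM mpa_DC mpa_DX (fun b c p => mderiv_comm c b p) (can_inj (@mpolyCK _ _))
    (fun j => rpred0 _) mpa_homB mpa_homCM mpa_homX mpa_homXM
    (fun j b p => @mderiv_homog _ _ j p b) (fun b p => @mderiv_homog0 _ _ p b) mpa_factor mpa_euler.
End MPolyAlg.

Section MPolySpecialization.
Variables (m : nat) (A : idomainType).
Local Notation A1 := {poly A}.
Local Notation B := {mpoly A[m.+1]}.
Local Notation B1 := {mpoly A1[m.+1]}.

Definition mred : {rmorphism B1 -> B} := map_mpoly (horner_eval (0 : A)).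
Definition mlift : {rmorphism B -> B1} := map_mpoly (@polyC A).

Lemma mredE (p : B1) g : (mred p)@_g = (p@_g).[0].
Proof. exact: mcoeff_map_mpoly. Qed.
Lemma mliftE (p : B) g : (mlift p)@_g = (p@_g)%:P.
Proof. exact: mcoeff_map_mpoly. Qed.

Lemma mliftK : cancel mlift mred.
Proof. by move=> p; apply/mpolyP => g; rewrite mredE mliftE hornerC. Qed.
Lemma mred_const (a : A1) : mred (mpolyC m.+1 a) = mpolyC m.+1 (horner_eval (0 : A) a).
Proof. exact: map_mpolyC. Qed.
Lemma mred_var b : mred 'X_b = 'X_b.
Proof. exact: map_mpolyX. Qed.
Lemma mred_der b p : mred (mderiv b p) = mderiv b (mred p).
Proof. by apply/mpolyP => g; rewrite mredE !mcoeff_deriv mredE hornerMn. Qed.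

Lemma mcoeff_homog (R : nzRingType) j (p : {mpoly R[m.+1]}) :
  (forall g, mdeg g != j -> p@_g = 0) <-> p \is j.-homog.
Proof.
split=> [h|/dhomogP h g hg].
  by apply/dhomogP => g; rewrite mcoeff_msupp /=; apply: contraNeq => /h ->.
by apply: memN_msupp_eq0; apply: contra hg => /h /= ->.
Qed.

Lemma mred_hom j p : p \is j.-homog -> mred p \is j.-homog.
Proof. by move=> /mcoeff_homog h; apply/mcoeff_homog => g /h e; rewrite mredE e horner0. Qed.
Lemma mlift_hom j p : p \is j.-homog -> mlift p \is j.-homog.
Proof. by move=> /mcoeff_homog h; apply/mcoeff_homog => g /h e; rewrite mliftE e. Qed.

(** The coefficients of p have constant term 0, so each is 'X times its [drop_poly 1]. *)
Lemma mred_ker p : mred p = 0 ->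
  exists2 q : B1, p = mpolyC m.+1 'X * q & forall j, p \is j.-homog -> q \is j.-homog.
Proof.
move=> h; pose q : B1 := \sum_(g <- msupp p) drop_poly 1 p@_g *: 'X_[g].
have qE g : q@_g = drop_poly 1 p@_g.
  rewrite raddf_sum /=; case: (boolP (g \in msupp p)) => hg.
    rewrite (bigD1_seq g) //= mcoeffZ mcoeffX eqxx mulr1 big1 ?addr0 // => g' /negbTE ne.
    by rewrite mcoeffZ mcoeffX ne mulr0.
  rewrite (memN_msupp_eq0 hg) drop_poly0r big_seq big1 // => g' hg'.
  rewrite mcoeffZ mcoeffX; case: eqP => [E|]; last by rewrite mulr0.
  by rewrite -E hg' in hg.
exists q => [|j /mcoeff_homog hp]; last by apply/mcoeff_homog => g /hp e; rewrite qE e drop_poly0r.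
apply/mpolyP => g; rewrite mcoeffCM qE -[LHS](poly_take_drop 1) expr1 mulrC.
suff -> : take_poly 1 p@_g = 0 by rewrite add0r.
apply/polyP => i; rewrite coef_take_poly coef0; case: i => [|i] //=.
by rewrite -horner_coef0 -mredE h mcoeff0.
Qed.

Definition mpoly_spec : specialization (mpoly_pa m A) ('X : pa_base (mpoly_pa m A1)) :=
  @Specialization m (mpoly_pa m A) (mpoly_pa m A1) 'X (horner_eval (0 : A)) mred mlift
   mliftK mred_const mred_var mred_der mred_hom mlift_hom (hornerX _) mred_ker.
End MPolySpecialization.

Lemma size_gt1 m : (0 < m)%N -> size [seq b : 'I_m.+1 <- enum 'I_m.+1 | (1 < b)%N] = m.-1.
Proof.
case: m => // m _; rewrite size_filter.
transitivity (count (ltn 1) [seq val b | b <- enum 'I_m.+2]); first by rewrite count_map.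
rewrite val_enum_ord /= add0n -[RHS](size_iota 2); apply/eqP; rewrite -all_count.
by apply/allP => x; rewrite mem_iota => /andP[].
Qed.

(** * The coefficients adjoined one at a time *)

Section Tower.
Variables (K : fieldType) (m : nat).
Hypothesis natU : forall i, (0 < i <= m)%N -> (i%:R : K) != 0.

Fixpoint tower r : idomainType := if r is r'.+1 then {poly (tower r')} else K.

(* The coefficients xi_m, xi_(m-1), ... are adjoined one at a time, so after r
   steps only the last r of them are nonzero. *)
Fixpoint txi r : 'I_m.+1 -> tower r :=
  if r is r'.+1 then fun a => if (a + r' == m)%N then 'X else (txi r' a)%:P else fun=> 0.

Lemma txiE r (a : 'I_m.+1) : (a + r == m)%N -> txi r.+1 a = 'X.
Proof. by rewrite /= => ->. Qed.

Lemma txi_lt r (a : 'I_m.+1) : (a + r <= m)%N -> txi r a = 0.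
Proof.
elim: r => //= r IH h; rewrite (_ : (a + r == m)%N = false); last by lia.
by rewrite IH //; lia.
Qed.

Lemma txi_neq0 r (a : 'I_m.+1) : (m < a + r)%N -> txi r a != 0.
Proof.
elim: r => [|r IH] h; first by have := ltn_ord a; lia.
rewrite /=; case: ifP => [_|/eqP ne]; first exact: (negbT (polyX_eq0 _)).
have := IH (ltac:(lia) : (m < a + r)%N); apply: contra => h'; rewrite -polyC_eq0; exact: h'.
Qed.

Lemma txi_red r b : horner_eval (0 : tower r) (txi r.+1 b) = txi r b.
Proof.
rewrite /= /horner_eval; case: ifP => [/eqP E|_]; last by rewrite hornerC.
by rewrite hornerX txi_lt // E.
Qed.

Lemma tower_natU r i : (0 < i <= m)%N -> (i%:R : tower r) \is a GRing.unit.
Proof.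
elim: r => [|r IH] h; first by rewrite /= unitfE natU.
by have := rmorph_unit (@polyC (tower r)) (IH h); rewrite rmorph_nat.
Qed.

Lemma tower_eform r : (0 < r)%N -> eform (W := mpoly_pa m (tower r)) (txi r) != 0.
Proof.
move=> r0; apply/eqP => /(congr1 (pa_der (mpoly_pa m (tower r)) ord_max)); rewrite D_eform raddf0 => h.
have /eqP[] := @txi_neq0 r ord_max (ltac:(rewrite /=; lia)).
by apply: (@pa_const_inj _ (mpoly_pa m (tower r))); rewrite h rmorph0.
Qed.

Local Notation n := (m.*2.-1).
Local Notation TW r := (mpoly_pa m (tower r)).
Local Notation txiW r := (txi r : 'I_m.+1 -> pa_base (TW r)).

(** Each descent uses up one coefficient and lowers l by one, and the form one level down has to be
    nonzero: hence at least l + 2 coefficients. *)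
Lemma tower_exact l r j : (0 < j)%N -> (j + l <= m)%N -> (l.+2 <= r <= m.+1)%N ->
  wexact (W := mpoly_pa m (tower r)) n (txi r) j l.
Proof.
elim: l r j => [|l IH] [|r] j // j0 jl hr.
all: have kr : (m - r < m.+1)%N by lia.
all: have e : txi r.+1 (Ordinal kr) = 'X by apply: txiE => /=; lia.
all: apply: (@wexact_along m (mpoly_pa m (tower r)) (mpoly_pa m (tower r.+1)) (Ordinal kr) 'X (txi r) (txi r.+1) (mpoly_spec m (tower r)) e) => //.
all: try exact: txi_red.
all: try (exact: (negbT (polyX_eq0 _))).
all: try (by apply: tower_eform; lia).
all: try (by move=> a ha; have /txi_lt : (a + r.+1 <= m)%N by move: ha => /=; lia).
all: try (by move=> i; apply: tower_natU).
  by left.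
by right; apply: IH => //; lia.
Qed.

(** The chain has to avoid m + 1 - r, the smallest index with a nonzero coefficient, which is the
    one specialized. *)
Lemma tower_wchain l r (bs : seq 'I_m.+1) (z : ext (pa_alg (TW r)) n) :
  (l.+2 <= r <= m)%N -> (l < m)%N ->
  uniq bs -> (forall a, a \in bs -> a + r != m.+1)%N ->
  ehom 0 z -> extdeg l z -> wchain (txiW r) bs z = 0 ->
  exists y : ext (pa_alg (TW r)) n, [/\ ehom 1 y, extpred l y & z = wdiff (txiW r) y].
Proof.
case: r z => [|r] z hr lm ubs hbs; first by lia.
have kr : (m - r < m.+1)%N by lia.
have e : txi r.+1 (Ordinal kr) = 'X by apply: txiE => /=; lia.
apply: (@wchain_along m (mpoly_pa m (tower r)) (mpoly_pa m (tower r.+1)) (Ordinal kr) 'X (txi r) (txi r.+1) (mpoly_spec m (tower r)) e) => //.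
all: try exact: txi_red.
all: try (exact: (negbT (polyX_eq0 _))).
all: try (by apply: tower_eform; lia).
all: try (by move=> a ha; have /txi_lt : (a + r.+1 <= m)%N by move: ha => /=; lia).
all: try (by move=> i; apply: tower_natU).
  by apply/negP => /hbs /=; lia.
case: l hr lm => [|l] hr lm; [by left | right; apply: tower_exact => //; lia].
Qed.

Hypothesis m2 : (2 <= m)%N.

(** Here k = 0 and c = 1: one level down, 1 is the smallest index with a nonzero coefficient, and it
    is missing from the chain. The exterior degrees match since 2m - 2 = m + (m - 2). *)
Lemma tower_top (f : ext (pa_alg (TW m.+1)) n) :
  ehom 0 f -> extdeg n.-1 f -> (forall b, wedge (cvec (wron (txiW m.+1) b)) f = 0) ->
  exists2 t : ext (pa_alg (TW m.+1)) n, ehom 0 t &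
    pa_const (TW m.+1) (txi m.+1 (inord 1)) *: f
      = wchain (txiW m.+1) (ord0 :: [seq b : 'I_m.+1 <- enum 'I_m.+1 | (1 < b)%N]) t.
Proof.
move=> hf df hu; set r := [seq b <- _ | _].
have e : txi m.+1 ord0 = 'X by apply: txiE => /=; lia.
have e1 : val (inord 1 : 'I_m.+1) = 1%N by rewrite /= inordK //; lia.
have ur : uniq [:: ord0, inord 1 & r].
  rewrite /= !inE !mem_filter /= e1 /= filter_uniq ?enum_uniq // andbT orbF.
  by apply/eqP => /(congr1 val); rewrite e1.
have ar b : (b == ord0) || (b == inord 1) || (b \in r).
  rewrite mem_filter mem_enum andbT -!val_eqE /= e1.
  by case: (val b) => [|[|i]].
have sr : size r = m.-1 by apply: size_gt1; lia.
apply: (@wchain_top_along m (mpoly_pa m (tower m)) (mpoly_pa m (tower m.+1)) ord0 'X (txi m) (txi m.+1) (mpoly_spec m (tower m)) e _ _ _ _ _ _ m.-2) => //.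
all: try exact: txi_red.
all: try (exact: (negbT (polyX_eq0 _))).
all: try (by apply: tower_eform; lia).
all: try (by move=> i; apply: tower_natU).
- by apply: txi_neq0; rewrite e1; lia.
- move=> z hz dz hc; apply: (@tower_wchain m.-2 m _ z _ _ _ _ hz dz hc); try lia.
  + case/and3P: ur => h1 h2 h3; apply/andP; split; last exact: h3.
    by move: h1; rewrite inE negb_or => /andP[].
  + move=> a; rewrite inE mem_filter => /orP[/eqP -> | /andP[h _]]; rewrite /=; lia.
by have -> : ((size r).+1 + m.-2 = n.-1)%N by rewrite sr; lia.
Qed.
End Tower.

(** * Injectivity of multiplication by the Wronskians *)

Section WronskiInjective.
Variables (K : fieldType) (m : nat).
Hypothesis natU : forall i, (0 < i <= m)%N -> (i%:R : K) != 0.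
Hypothesis m2 : (2 <= m)%N.
Local Notation S := {mpoly K[m.+1]}.
Local Notation n := (m.*2.-1).
Local Notation W := (mpoly_pa m (tower K m.+1)).
Local Notation xi := (txi K m.+1 : 'I_m.+1 -> pa_base W).

Definition mwron (b : 'I_m.+1) (s : 'I_n) : S :=
  \sum_(a : 'I_m.+1 | (a + b == s.+1)%N) (b%:R - a%:R) * 'X_a.

(* The grading of the polynomial ring in the xi, seen as a morphism to S['X]. *)
Lemma tower_grading r : exists (i : {rmorphism K -> tower K r}) (h : {rmorphism tower K r -> {poly S}}),
  (forall c, h (i c) = (c%:MP)%:P) /\
  (forall a : 'I_m.+1, (m < a + r)%N -> h (txi K r a) = ('X_a)%:P * 'X).
Proof.
elim: r => [|r [i [h [hi hx]]]].
  exists idfun, (@polyC S \o @mpolyC m.+1 K); split=> // a ha.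
  by have := ltn_ord a; lia.
(* The variable adjoined at step r + 1 is the coefficient of index m - r. *)
pose c : {poly S} := if insub (m - r)%N is Some a then ('X_a)%:P * 'X else 0.
exists (@polyC (tower K r) \o i), (horner_eval c \o map_poly h); split=> [k|a ha].
  by rewrite /= /horner_eval map_polyC hornerC /= hi.
rewrite /= /horner_eval; case: ifP => [/eqP E|/eqP ne].
  rewrite map_polyX hornerX /c (_ : (m - r)%N = a); first by rewrite valK.
  by lia.
by rewrite map_polyC hornerC /= hx //; lia.
Qed.

Lemma mwron_injective (f : 'I_n -> S) :
  (forall s, f s \is m.-2.-homog) -> (forall b, \sum_s f s * mwron b s = 0) ->
  forall s, f s = 0.
Proof.
move=> hf hu.
have [i [h [hi hx]]] := tower_grading m.+1.
pose phi : {rmorphism S -> tower K m.+1} := mmap i (txi K m.+1).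
have hphi d p : p \is d.-homog -> h (phi p) = p%:P * 'X^d.
  move=> /dhomogP hp; rewrite /phi /= /mmap rmorph_sum.
  rewrite [X in _ = X%:P * _](mpolyE p) rmorph_sum mulr_suml; apply: eq_big_seq => g /hp /= hg /=.
  rewrite rmorphM hi /mmap1 rmorph_prod -mul_mpolyC polyCM -mulrA; congr (_ * _).
  rewrite mpolyXE_id rmorph_prod -hg mdegE -[X in _ = _ * X]prodrXr -big_split; apply: eq_bigr => a _ /=.
  by rewrite !rmorphXn /= hx ?exprMn //; have := ltn_ord a; lia.
have phiX a : phi 'X_a = xi a by exact: (etrans (mmapX _ _ _) (mmap1U _ _)).
have phiw b s : phi (mwron b s) = wron xi b s.
  rewrite rmorph_sum; apply: eq_bigr => a _ /=.
  by rewrite rmorphM rmorphB !rmorph_nat phiX.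
pose v : 'I_n -> pa_base W := fun s => phi (f s).
pose ft : ext (pa_alg W) n := contr (cvec v) (evol _ n).
have ft_hom : ehom 0 ft.
  apply: ehom_contr => T; rewrite ffunE; case: (_ == _); last exact: pa_hom0.
  exact: dhomog1.
have ft_deg : extdeg n.-1 ft.
  apply: extdeg_contr; rewrite prednK; last by lia.
  exact: extdeg_evol.
have ft_wedge b : wedge (cvec (wron xi b)) ft = 0.
  have := contr_wedge (cvec v) (cvec (wron xi b)) (evol _ n).
  rewrite wedge_evol raddf0 (_ : \sum_a _ = 0).
    by rewrite scale0r sub0r => /esym/eqP; rewrite oppr_eq0 => /eqP.
  transitivity (pa_const W (phi (\sum_s f s * mwron b s))); last by rewrite hu !rmorph0.
  rewrite (rmorph_sum phi) (rmorph_sum (pa_const W)); apply: eq_bigr => s _.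
  by rewrite /cvec /v (rmorphM phi) (rmorphM (pa_const W)) phiw.
have [t _ E] := tower_top natU m2 ft_hom ft_deg ft_wedge.
set bs := _ :: _ in E.
have sbs : size bs = m.
  by rewrite /= size_gt1 //; lia.
(* Take the constant term in the e_a and record the degree in the xi by a variable 'X; each
   Wronskian contributes a factor 'X. *)
pose th : {rmorphism pa_alg W -> {poly S}} := h \o @mcoeff m.+1 (tower K m.+1) 0%MM.
have th_wron b (s : 'I_n) : exists q, th (pa_const W (wron xi b s)) = q * 'X.
  exists (\sum_(a : 'I_m.+1 | (a + b == s.+1)%N) (b%:R - a%:R) * ('X_a)%:P).
  rewrite /th /= mcoeffC eqxx mulr1 rmorph_sum mulr_suml; apply: eq_bigr => a _ /=.
  by rewrite rmorphM rmorphB !rmorph_nat hx ?mulrA //; have := ltn_ord a; lia.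
have th_chain cs T : exists q, th (wchain xi cs t T) = q * 'X^(size cs).
  elim: cs T => [|b cs IH] T; first by exists (th (t T)); rewrite mulr1.
  have hq a : exists q, th (esgn (pa_alg W) a T * cvec (W := W) (wron xi b) a * wchain xi cs t (T :\ a)) = q * 'X^((size cs).+1).
    have [q1 e1] := th_wron b a; have [q2 e2] := IH (T :\ a).
    exists (th (esgn (pa_alg W) a T) * q1 * q2); rewrite !rmorphM e2 [th (cvec _ _)]e1 exprS; ring.
  have [q hq'] := fin_all_exists hq.
  exists (\sum_(a in T) q a); rewrite ffunE rmorph_sum mulr_suml.
  by apply: eq_bigr => a _; rewrite -hq'.
move=> s; have [q] := th_chain bs ([set: 'I_n] :\ s).
set T := _ :\ s; set sg : pa_alg W := esgn _ s T.
rewrite -E ffunE [ft T]contr_evol [_ *: _]mulrA rmorphM [th (_ * _)]rmorphM sbs.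
have -> : th (pa_const W (xi (inord 1))) = ('X_(inord 1))%:P * 'X.
  by rewrite /th /= mcoeffC eqxx mulr1 hx // ; lia.
have -> : th (cvec (W := W) v s) = (f s)%:P * 'X^(m.-2).
  by rewrite /th /= mcoeffC eqxx mulr1; exact: (hphi m.-2).
move=> /(congr1 ( *%R (th sg))) E2.
have sg2 : th sg * th sg = 1 by rewrite -rmorphM esgn_sqr rmorph1.
have {E2} : ('X_(inord 1) * f s)%:P * 'X^(m.-1) = (th sg * q) * 'X^m.
  rewrite -mulrA -E2 (_ : m.-1 = m.-2.+1) ?exprS; last by lia.
  rewrite polyCM -[LHS]mul1r -sg2; ring.
(* The right side is divisible by 'X^m, so the coefficient at m - 1 on the left is 0. *)
move=> /(congr1 (fun p : {poly S} => p`_m.-1)); rewrite !coefMXn ltnn subnn coefC eqxx.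
rewrite (_ : m.-1 < m)%N; last by lia.
move=> /eqP; rewrite mulf_eq0 => /orP[/eqP h0|/eqP //].
by have := mcoeffXU K (inord 1 : 'I_m.+1) (inord 1); rewrite h0 eqxx mcoeff0 => /esym/eqP; rewrite oner_eq0.
Qed.
End WronskiInjective.

(** * All linear syzygies of the variables come from the Wronskians *)

Section WronskiSurjective.
Variables (K : fieldType) (m : nat).
Hypothesis natU : forall i, (0 < i <= m)%N -> (i%:R : K) != 0.
Hypothesis m2 : (2 <= m)%N.
Local Notation S := {mpoly K[m.+1]}.
Local Notation n := (m.*2.-1).
Local Notation H q := (dhomog m.+1 K q).
Local Notation mwron := (@mwron K m).

(** The Euler characteristic of 0 -> S_(m-2)^n -> S_(m-1)^(m+1) -> S_m -> 0, the dimension of S_d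
    being 'C(d + m, d). *)
Lemma binomial_count : (n * 'C(m.-2 + m, m.-2) + 'C(m + m, m) = m.+1 * 'C(m.-1 + m, m.-1))%N.
Proof.
case: m m2 => [|[|k]] // _.
change ((k.+2).*2.-1 * 'C(k + k.+2, k) + 'C(k.+2 + k.+2, k.+2) = k.+3 * 'C(k.+1 + k.+2, k.+1))%N.
have -> : (k.+2.*2.-1 = k.*2.+3)%N by lia.
have -> : (k + k.+2 = k.*2.+2)%N by lia.
have -> : (k.+1 + k.+2 = k.*2.+3)%N by lia.
have -> : (k.+2 + k.+2 = k.*2.+4)%N by lia.
have -> : (k.*2.+3 * 'C(k.*2.+2, k) = k.+1 * 'C(k.*2.+3, k.+1))%N by rewrite -mul_bin_diag.
have -> : 'C(k.*2.+4, k.+2) = (2 * 'C(k.*2.+3, k.+1))%N.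
  rewrite binS -[X in (X + _)%N](@bin_sub k.*2.+3 k.+2) ?mul2n -?addnn; last by lia.
  by congr (_ + _)%N; congr 'C(_, _); lia.
by lia.
Qed.

Lemma dhomogM_deg d e k (p q : S) : p \is d.-homog -> q \is e.-homog -> (d + e = k)%N ->
  p * q \is k.-homog.
Proof. by move=> hp hq <-; apply: dhomogM. Qed.

Lemma mwron_homog b s : mwron b s \is 1.-homog.
Proof.
apply: rpred_sum => a _; rewrite -!mpolyC_nat -mpolyCB mul_mpolyC rpredZ //.
by rewrite dhomogX /= mdeg1.
Qed.

Lemma sum_mwron s : \sum_b 'X_b * mwron b s = 0.
Proof.
rewrite /mwron; under eq_bigr => b _ do rewrite mulr_sumr big_mkcond.
apply: sum_antisym => [x y|x]; last by rewrite subrr mul0r mulr0; case: ifP.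
by rewrite addnC; case: ifP => _; rewrite ?oppr0 //; ring.
Qed.

Lemma wmul_homog (f : {ffun 'I_n -> H m.-2}) b : \sum_s (f s : S) * mwron b s \is m.-1.-homog.
Proof.
apply: rpred_sum => s _; apply: dhomogM_deg (dhomog_is_dhomog (f s)) (mwron_homog _ _) _; lia.
Qed.

Definition wmul (f : {ffun 'I_n -> H m.-2}) : {ffun 'I_m.+1 -> H m.-1} :=
  [ffun b => DHomog (wmul_homog f b)].

Lemma wmul_linear : linear wmul.
Proof.
move=> c f g; apply/ffunP => b; apply: val_inj; rewrite !ffunE /= scaler_sumr -big_split.
by apply: eq_bigr => s _ /=; rewrite !ffunE /= mulrDl scalerAl.
Qed.
HB.instance Definition _ := GRing.isLinear.Build K _ _ _ wmul wmul_linear.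

Lemma vmul_homog (v : {ffun 'I_m.+1 -> H m.-1}) : \sum_b 'X_b * (v b : S) \is m.-homog.
Proof.
apply: rpred_sum => b _; apply: (@dhomogM_deg 1 m.-1).
- by rewrite dhomogX /= mdeg1.
- exact: dhomog_is_dhomog.
by lia.
Qed.

Definition vmul (v : {ffun 'I_m.+1 -> H m.-1}) : H m := DHomog (vmul_homog v).

Lemma vmul_linear : linear vmul.
Proof.
move=> c f g; apply: val_inj => /=; rewrite scaler_sumr -big_split.
by apply: eq_bigr => s _ /=; rewrite !ffunE /= mulrDr scalerAr.
Qed.
HB.instance Definition _ := GRing.isLinear.Build K _ _ _ vmul vmul_linear.

Lemma vmul_wmul f : vmul (wmul f) = 0.
Proof.
apply: val_inj => /=; transitivity (\sum_s (f s : S) * \sum_b 'X_b * mwron b s).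
  under [RHS]eq_bigr => s _ do rewrite mulr_sumr.
  rewrite [RHS]exchange_big /=; apply: eq_bigr => b _; rewrite ffunE /= mulr_sumr.
  by apply: eq_bigr => s _; ring.
by rewrite big1 // => s _; rewrite sum_mwron mulr0.
Qed.

(** The image lies in the kernel of [vmul]; [wmul] is injective, and [vmul] is onto by Euler's
    formula, m being invertible. So [binomial_count] gives equal dimensions. *)
Lemma wmul_onto (v : {ffun 'I_m.+1 -> H m.-1}) :
  \sum_b 'X_b * (v b : S) = 0 -> exists f, v = wmul f.
Proof.
move=> hv; have hv0 : vmul v = 0 by apply: val_inj.
suff E : limg (linfun wmul) = lker (linfun vmul).
  have /memv_imgP[f _ ->] : v \in limg (linfun wmul) by rewrite E memv_ker lfunE /= hv0.
  by exists f; rewrite lfunE.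
apply/eqP; rewrite eqEdim; apply/andP; split.
  by apply/subvP => _ /memv_imgP[f _ ->]; rewrite memv_ker !lfunE /= vmul_wmul.
have kw : lker (linfun wmul) = 0%VS.
  apply/eqP/lker0P => f g; rewrite !lfunE /= => fg; apply/ffunP => s.
  apply: val_inj; apply/eqP; rewrite -subr_eq0; apply/eqP.
  apply: (mwron_injective natU m2 (f := fun s => (f s : S) - (g s : S))) => [s'|b].
    by apply: rpredB; exact: dhomog_is_dhomog.
  have := congr1 (fun h : {ffun 'I_m.+1 -> H m.-1} => (h b : S)) fg; rewrite !ffunE /= => e.
  under eq_bigr => s' _ do rewrite mulrBl.
  by rewrite sumrB e subrr.
have iv : limg (linfun vmul) = fullv.
  apply/eqP; rewrite eqEsubv subvf; apply/subvP => p _; apply/memv_imgP.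
  have hd b : (m%:R^-1 *: mderiv b (p : S)) \is m.-1.-homog.
    apply/rpredZ/mderiv_homog; rewrite prednK; last by lia.
    exact: dhomog_is_dhomog.
  exists [ffun b => DHomog (hd b)]; first exact: memvf.
  rewrite lfunE; apply: val_inj => /=; under eq_bigr => b _ do rewrite ffunE /= -scalerAr.
  rewrite -scaler_sumr (mpoly_euler (dhomog_is_dhomog p)) scalerA mulVf ?scale1r //.
  by apply: natU; lia.
have := limg_ker_dim (linfun wmul) fullv; have := limg_ker_dim (linfun vmul) fullv.
rewrite !capfv kw dimv0 add0n iv !dimvf.
have -> : dim {ffun 'I_m.+1 -> H m.-1} = (m.+1 * 'C(m.-1 + m, m.-1))%N.
  by transitivity (#|'I_m.+1| * 'C(m.-1 + m, m.-1))%N; last by rewrite card_ord.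
have -> : dim {ffun 'I_n -> H m.-2} = (n * 'C(m.-2 + m, m.-2))%N.
  by transitivity (#|'I_n| * 'C(m.-2 + m, m.-2))%N; last by rewrite card_ord.
have -> : dim (H m) = 'C(m + m, m) by [].
by have := binomial_count; lia.
Qed.

Section Functional.
Variable c : 'X_{1..m.+1} -> 'I_m.+1 -> K.

Definition coef_form b (p : S) : K := \sum_(h : 'X_{1..m.+1 < m}) p@_h * c h b.

Lemma coef_form_linear b : scalar (coef_form b).
Proof.
move=> k p q; rewrite /coef_form mulr_sumr -big_split; apply: eq_bigr => h _ /=.
by rewrite mcoeffD mcoeffZ mulrDl mulrA.
Qed.
HB.instance Definition _ b := GRing.isLinear.Build K S K *%R (coef_form b) (coef_form_linear b).

Lemma coef_formX b g : (mdeg g < m)%N -> coef_form b 'X_[g] = c g b.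
Proof.
move=> hg; rewrite /coef_form (bigD1 (BMultinom hg)) //= mcoeffX eqxx mul1r big1 ?addr0 // => h.
rewrite -val_eqE /= mcoeffX eq_sym => /negbTE ->; exact: mul0r.
Qed.

(* If the form sum_b p_b e_b |-> sum_b coef_form b p_b kills the Wronskian
   relations, it kills all the relations x_a e_b = x_b e_a. *)
Lemma wronskian_symmetric :
  (forall g (s : 'I_n), mdeg g = m.-2 -> \sum_(b : 'I_m.+1) \sum_(a : 'I_m.+1 | (a + b == s.+1)%N)
     (b%:R - a%:R) * c (g + U_(a))%MM b = 0) ->
  forall g a b, mdeg g = m.-2 -> c (g + U_(a))%MM b = c (g + U_(b))%MM a.
Proof.
move=> hc g a b hg.
have gd x : (mdeg (g + U_(x)) < m)%N by rewrite mdegD mdeg1; lia.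
have Xhom x : ('X_[g + U_(x)] : S) \is m.-1.-homog by rewrite dhomogX /= mdegD mdeg1; apply/eqP; lia.
(* The relation X_a e_b - X_b e_a times the monomial X^g; the functional takes on it the difference
   of the two sides. *)
pose v b' : S := 'X_[g + U_(a)] *+ (b' == b) - 'X_[g + U_(b)] *+ (b' == a).
have hv b' : v b' \is m.-1.-homog by apply: rpredB; apply: rpredMn.
have [|f /ffunP hf] := @wmul_onto [ffun b' => DHomog (hv b')].
  under eq_bigr => b' _ do rewrite ffunE /= mulrBr !mulrnAr.
  rewrite sumrB (bigD1 b) //= eqxx big1 ?addr0 => [|b' /negbTE ->]; last by [].
  rewrite [X in _ - X](bigD1 a) //= eqxx [X in _ - (_ + X)]big1 ?addr0 => [|b' /negbTE ->]; last by [].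
  by rewrite !mulr1n !mpolyXD; ring.
have : \sum_b' coef_form b' (v b') = 0.
  transitivity (\sum_b' coef_form b' (\sum_s (f s : S) * mwron b' s)).
    by apply: eq_bigr => b' _; have := congr1 (fun p : H m.-1 => coef_form b' (p : S)) (hf b'); rewrite !ffunE /=.
  under eq_bigr => b' _ do rewrite raddf_sum.
  rewrite exchange_big big1 //= => s _.
  under eq_bigr => b' _ do rewrite [f s : S](mpolyE (f s)) mulr_suml raddf_sum.
  rewrite exchange_big /= big_seq big1 // => h hh.
  have hd : mdeg h = m.-2 by have /dhomogP/(_ _ hh) := dhomog_is_dhomog (f s).
  transitivity ((f s : S)@_h * \sum_(b' : 'I_m.+1) \sum_(a' : 'I_m.+1 | (a' + b' == s.+1)%N)
     (b'%:R - a'%:R) * c (h + U_(a'))%MM b'); last by rewrite hc ?mulr0.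
  rewrite mulr_sumr; apply: eq_bigr => b' _; rewrite -scalerAl linearZ /=; congr (_ * _).
  rewrite mulr_sumr raddf_sum; apply: eq_bigr => a' _.
  rewrite /= mulrCA -mpolyXD -!mpolyC_nat -mpolyCB mul_mpolyC linearZ /= coef_formX //.
  by rewrite mdegD mdeg1 hd; lia.
under eq_bigr => b' _ do rewrite raddfB /= !raddfMn /= !coef_formX // mulNrn.
rewrite sumrB (bigD1 b) //= eqxx big1 ?addr0 => [|b' /negbTE ->]; last by [].
rewrite [X in _ - X](bigD1 a) //= eqxx [X in _ - (_ + X)]big1 ?addr0 => [|b' /negbTE ->]; last by [].
by rewrite !mulr1n => /eqP; rewrite subr_eq0 => /eqP.
Qed.
End Functional.
End WronskiSurjective.

(** * Alternating polynomials *)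

Section IteratedContraction.
Variables (R : comNzRingType) (n : nat).
Implicit Types (z : ext R n) (v : 'I_n -> R).

Definition contrs (e : seq ('I_n -> R)) z : ext R n := foldr (@contr R n) z e.

Lemma contrs_cat e1 e2 z : contrs (e1 ++ e2) z = contrs e1 (contrs e2 z).
Proof. exact: foldr_cat. Qed.

Lemma contrs0 e : contrs e 0 = 0.
Proof. by elim: e => //= v e ->; rewrite raddf0. Qed.

Lemma contrsD e z1 z2 : contrs e (z1 + z2) = contrs e z1 + contrs e z2.
Proof. by elim: e => //= v e ->; rewrite raddfD. Qed.

Lemma contrsZ e c z : contrs e (c *: z) = c *: contrs e z.
Proof. by elim: e => //= v e ->; rewrite contrZ. Qed.

Lemma contr_contrs v e z : contr v (contrs e z) = (-1) ^+ size e *: contrs e (contr v z).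
Proof.
elim: e => [|w e IH] /=; first by rewrite scale1r.
by rewrite contr_contr IH contrZ exprS mulN1r scaleNr.
Qed.

(** The sign c depends on a and [e] alone, neither on f nor on z, so it cancels when contractions
    with different vectors are compared. *)
Lemma contrs_front (I : eqType) (a : I) (e : seq I) : a \in e ->
  exists c : R, forall (f : I -> 'I_n -> R) z,
    contrs (map f e) z = c *: contrs (map f (a :: rem a e)) z.
Proof.
elim: e => // x e IH; rewrite inE /=; have [->|nxa] /= := eqVneq x a.
  by move=> _; exists 1 => f z; rewrite scale1r.
move=> ae; have {ae IH} [c Hc] := IH ae; exists (- c) => f z.
by rewrite Hc contrZ /= contr_contr scalerN scaleNr.
Qed.

Lemma contrs_tperm (I : finType) (a b : I) (e : seq I) (f : I -> 'I_n -> R) z :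
  uniq e -> a \in e -> b \in e -> a != b ->
  contrs [seq f (tperm a b j) | j <- e] z = - contrs (map f e) z.
Proof.
move=> ue ae be nab.
have [c1 H1] := contrs_front ae.
have be' : b \in rem a e by rewrite mem_rem_uniq // !inE eq_sym nab.
have [c2 H2] := contrs_front be'.
have E : [seq f (tperm a b j) | j <- rem b (rem a e)] = [seq f j | j <- rem b (rem a e)].
  apply/eq_in_map => j; rewrite mem_rem_uniq ?rem_uniq // inE mem_rem_uniq // inE.
  by case/and3P => njb nja _; rewrite tpermD // eq_sym.
by rewrite H1 [in RHS]H1 /= !H2 !contrZ /= -!scalerN tpermL tpermR contr_contr E.
Qed.

Lemma contrs_mem0 (I : eqType) (a : I) (e : seq I) (f : I -> 'I_n -> R) z :
  a \in e -> contr (f a) z = 0 -> contrs (map f e) z = 0.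
Proof.
move=> ae az; have [c ->] := contrs_front ae.
by rewrite /= contr_contrs az contrs0 !scaler0.
Qed.

Lemma contr_eps_eq0 l z : extdeg l z ->
  (forall e : seq 'I_n, size e = l -> contrs [seq (fun b => (b == a)%:R) | a <- e] z set0 = 0) ->
  z = 0.
Proof.
elim: l z => [|l IH] z dz Hz.
  by apply/ffunP => A; rewrite ffunE; case: (eqVneq A set0) => [->|nA];
    [exact: (Hz [::])|apply: dz; rewrite cards_eq0].
have H a : contr (fun b => (b == a)%:R) z = 0.
  apply: IH; first exact: extdeg_contr.
  move=> e se; have := Hz (rcons e a); rewrite size_rcons se => /(_ erefl).
  by rewrite map_rcons -cats1 contrs_cat.
apply/ffunP => A; rewrite ffunE; case: (set_0Vmem A) => [->|[a aA]].
  by apply: dz; rewrite cards0.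
have := congr1 (fun f : ext R n => f (A :\ a)) (H a); rewrite !ffunE (bigD1 a) ?setD11 //= big1; last first.
  by move=> b /andP[_ /negPf->]; rewrite mulr0 mul0r.
rewrite eqxx mulr1 setD1K // addr0 => /(congr1 ( *%R (esgn R a (A :\ a)))).
by rewrite mulrA esgn_sqr mul1r mulr0.
Qed.

End IteratedContraction.

Lemma mpoly_morph_eq (R B : comNzRingType) N (f g : {rmorphism {mpoly R[N]} -> B}) :
  (forall c, f c%:MP = g c%:MP) -> (forall j, f 'X_j = g 'X_j) -> f =1 g.
Proof.
move=> fgC fgX p; rewrite (mpolyE p) !rmorph_sum /=; apply: eq_bigr => m _.
rewrite -mul_mpolyC !rmorphM fgC mpolyXE_id !rmorph_prod; congr (_ * _).
by apply: eq_bigr => j _; rewrite !rmorphXn /= fgX.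
Qed.

(** * Restriction of polynomials to a diagonal *)

Section Identification.
Variables (K : idomainType) (N : nat).
Local Notation R := {mpoly K[N]}.
Implicit Types (p q r : R) (a b : 'I_N) (h : 'X_{1..N}).

Definition subst_var a r : {rmorphism R -> R} :=
  comp_mpoly [tuple (if j == a then r else 'X_j : R) | j < N].

Lemma subst_varX a r j : subst_var a r 'X_j = if j == a then r else 'X_j.
Proof. by rewrite /subst_var /= comp_mpolyXU -tnth_nth tnth_mktuple. Qed.

Lemma subst_varC a r (c : K) : subst_var a r c%:MP = c%:MP.
Proof. by rewrite /subst_var /= comp_mpolyC. Qed.

(** The factor theorem: the property passes to sums and products and holds for constants and
    variables. *)
Lemma subst_var_dvd a r p : exists q, p - subst_var a r p = ('X_a - r) * q.
Proof.
pose P p := exists q, p - subst_var a r p = ('X_a - r) * q.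
have PD x y : P x -> P y -> P (x + y).
  by case=> q Hq [q' Hq']; exists (q + q'); rewrite mulrDr -Hq -Hq' rmorphD; ring.
have PM x y : P x -> P y -> P (x * y).
  case=> q Hq [q' Hq']; exists (q * y + subst_var a r x * q').
  by rewrite mulrDr mulrA -Hq mulrCA -Hq' rmorphM; ring.
have PC c : P c%:MP by exists 0; rewrite subst_varC subrr mulr0.
have PX j : P 'X_j.
  rewrite /P subst_varX; case: eqP => [->|_]; last by exists 0; rewrite subrr mulr0.
  by exists 1; rewrite mulr1.
have PE m : P 'X_[m].
  rewrite mpolyXE_id; elim/big_ind: _ => // [|j _]; first exact: PC 1.
  elim: (m j) => [|k IH]; first by rewrite expr0; exact: PC 1.
  by rewrite exprS; apply: (PM ('X_j) ('X_j ^+ k)).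
rewrite -[exists q, _]/(P p) (mpolyE p); elim/big_ind: _ => // [|m _].
  by rewrite -[0]mpolyC0; exact: PC.
by rewrite -mul_mpolyC; apply: (PM (p@_m)%:MP 'X_[m]).
Qed.

Definition ident a b := subst_var a 'X_b.

Lemma identX a b j : ident a b 'X_j = if j == a then 'X_b else 'X_j.
Proof. exact: subst_varX. Qed.

Lemma identC a b (c : K) : ident a b c%:MP = c%:MP.
Proof. exact: subst_varC. Qed.

Definition msymr s : {rmorphism R -> R} := @msym N K s.

Lemma msymXU s j : msym s ('X_j : R) = 'X_(s j).
Proof.
rewrite msymX; congr 'X_[_]; apply/mnmP => k.
by rewrite mnmE !mnm1E; congr (nat_of_bool _); apply/eqP/eqP => [->|<-]; rewrite ?permKV ?permK.
Qed.

Lemma ident_sym a b p : ident a b (msym (tperm a b) p) = ident a b p.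
Proof.
apply: (@mpoly_morph_eq _ _ _ (ident a b \o msymr (tperm a b)) (ident a b)) => [c|j] /=.
  by rewrite -[c%:MP]mulr1 mul_mpolyC msymZ msym1.
by rewrite -!/(ident a b _) msymXU !identX; case: tpermP => [->|->|]; rewrite ?eqxx //; case: eqP.
Qed.

Lemma mcoeffXM_eq0 b p h : h b = 0%N -> ('X_b * p)@_h = 0.
Proof.
move=> E; rewrite mcoeffM big1 // => -[h1 h2] /= /eqP eh.
rewrite mcoeffX; case: eqP => [eb|_]; last by rewrite mul0r.
by move/mnmP: eh => /(_ b); rewrite mnmDE -eb mnm1E eqxx E.
Qed.

Lemma mcoeff_euler b p h : ('X_b * p^`M(b))@_h = (h b)%:R * p@_h.
Proof.
case E: (h b) => [|k].
  by rewrite mul0r mcoeffXM_eq0.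
have -> : h = (U_(b) + (h - U_(b)))%MM.
  by apply/mnmP => j; rewrite mnmDE mnmBE mnm1E; case: eqP => [<-|]; lia.
rewrite mulrC mcoeffMX mcoeff_deriv mnmBE E mnm1E eqxx subn1 /= [(_ + U_(b))%MM]addmC mulr_natl.
by [].
Qed.

Lemma ident_mnm a b h : a != b -> ident a b 'X_[h] =
  'X_[[multinom (if j == a then 0%N else if j == b then h a + h b else h j)%N | j < N]].
Proof.
move=> nab; rewrite !mpolyXE_id rmorph_prod (bigD1 a) // [RHS](bigD1 a) //= !mnmE eqxx.
rewrite (bigD1 b) 1?eq_sym //= [in RHS](bigD1 b) 1?eq_sym //= !mnmE eqxx [b == a]eq_sym (negPf nab).
rewrite !rmorphXn -!/(ident a b _) !identX eqxx [b == a]eq_sym (negPf nab) mulrA -exprD expr0 mul1r.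
congr (_ * _); apply: eq_bigr => j /andP[/negPf ja /negPf jb].
by rewrite rmorphXn -!/(ident a b _) identX mnmE ja jb.
Qed.

(** The monomials that restrict to X^h X_b^s are those distributing the exponent s over X_a and
    X_b. *)
Lemma mcoeff_ident a b p h s : a != b -> h a = 0%N -> h b = 0%N ->
  (ident a b p)@_(h + U_(b) *+ s) =
  \sum_(k < s.+1) p@_(h + U_(a) *+ k + U_(b) *+ (s - k)).
Proof.
move=> nab ha hb; rewrite {1}(mpolyE p) rmorph_sum raddf_sum /=.
transitivity (\sum_(m <- msupp p) \sum_(k < s.+1) p@_m * ('X_[m] : R)@_(h + U_(a) *+ k + U_(b) *+ (s - k))); last first.
  rewrite exchange_big; apply: eq_bigr => k _ /=.
  rewrite [in RHS](mpolyE p) raddf_sum /=.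
  by apply: eq_bigr => m _; rewrite mcoeffZ.
apply: eq_bigr => m _; rewrite -!/(ident a b _) -mul_mpolyC rmorphM identC ident_mnm // mcoeffCM.
rewrite -mulr_sumr; congr (_ * _); rewrite mcoeffX.
have nba : b == a = false by rewrite eq_sym (negPf nab).
have E (k : 'I_s.+1) : (m == h + U_(a) *+ k + U_(b) *+ (s - k))%MM =
   ([multinom (if j == a then 0%N else if j == b then m a + m b else m j)%N | j < N] == h + U_(b) *+ s)%MM && (m a == k).
  apply/eqP/andP => [->|[/eqP/mnmP H /eqP mk]].
    split; last by rewrite !(mnmDE, mulmnE, mnm1E) ha eqxx nba /=; lia.
    apply/eqP/mnmP => j; rewrite !(mnmE, mnmDE, mulmnE, mnm1E) !eqxx nba (negPf nab) ha hb !(eq_sym _ j).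
    case: (eqVneq j a) => [->|nja]; first by rewrite (negPf nab) ha.
    by case: (eqVneq j b) => [->|njb] /=; have := ltn_ord k; lia.
  apply/mnmP => j; have := H j; have := H b; have := ltn_ord k.
  rewrite !(mnmE, mnmDE, mulmnE, mnm1E) !eqxx nba hb !(eq_sym _ j).
  case: (eqVneq j a) => [->|nja]; first by rewrite (negPf nab) ha; lia.
  by case: (eqVneq j b) => [->|njb] /=; lia.
under eq_bigr => k _ do rewrite mcoeffX E.
case: eqP => [/mnmP H|_] /=; last by rewrite big1.
have ms : (m a < s.+1)%N.
  have := H b; rewrite !(mnmE, mnmDE, mulmnE, mnm1E) !eqxx nba hb; lia.
rewrite (bigD1 (Ordinal ms)) //= eqxx big1 ?addr0 // => k /eqP nk.
by case: eqP => // e; case: nk; apply: val_inj.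
Qed.

Lemma sub_vars_dvd a b p : ident a b p = 0 -> exists q, p = ('X_a - 'X_b) * q.
Proof. by move=> H; have [q] := subst_var_dvd a 'X_b p; rewrite -/(ident a b) H subr0 => ->; exists q. Qed.

(** The coefficient of p at h + U_a is q_h - q_(h + U_a - U_b), so q_h = 0 follows by induction on
    the exponent of X_b. With [P] a lower bound on an exponent, this bounds the degree of q. *)
Lemma factor_coef_eq0 a b p q (P : 'X_{1..N} -> Prop) : p = ('X_a - 'X_b) * q -> a != b ->
  (forall h, P h -> (0 < h b)%N -> P (h + U_(a) - U_(b))%MM) ->
  (forall h, P h -> p@_(h + U_(a)) = 0) -> forall h, P h -> q@_h = 0.
Proof.
move=> -> nab PS H h; have [k] := ubnP (h b); elim: k h => // k IH h hk Ph.
have := H _ Ph; rewrite mulrBl mcoeffB !(mulrC 'X__) addmC mcoeffMX.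
case E: (h b) => [|j].
  rewrite [q * 'X_b]mulrC mcoeffXM_eq0 ?subr0 // mnmDE mnm1E (negPf nab) E //.
have eh : (U_(a) + h)%MM = (U_(b) + (h + U_(a) - U_(b)))%MM.
  apply/mnmP => l; rewrite !(mnmDE, mnmBE, mnm1E); case: (eqVneq b l) => [<-|_]; lia.
rewrite eh mcoeffMX (IH (h + U_(a) - U_(b))%MM) ?subr0 //; last by apply: PS; rewrite ?E.
by rewrite !(mnmDE, mnmBE, mnm1E) (negPf nab) eqxx; lia.
Qed.

End Identification.

(** * Division by the Vandermonde determinant *)

Section VandermondeDivision.
Variables (K : idomainType) (N : nat).
Local Notation R := {mpoly K[N]}.
Implicit Types (p q : R) (a b c : 'I_N) (h : 'X_{1..N}) (ab : 'I_N * 'I_N).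

Lemma subX_neq0 a b : a != b -> ('X_a - 'X_b : R) != 0.
Proof.
move=> nab; apply/eqP => /(congr1 (mcoeff U_(a))) /eqP.
by rewrite mcoeffB mcoeff0 !mcoeffXU eqxx (eq_sym b) (negPf nab) subr0 oner_eq0.
Qed.

Lemma ident_swap0 a b p : ident K a b p = 0 -> ident K b a p = 0.
Proof.
move=> H; have [q ->] := sub_vars_dvd H.
by rewrite rmorphM rmorphB !identX eqxx; case: eqP => [->|_]; rewrite subrr mul0r.
Qed.

Definition vfactor ab : R := 'X_(ab.2) - 'X_(ab.1).

Lemma ident_vfactor_neq0 ab ab' : (ab.1 < ab.2)%N -> (ab'.1 < ab'.2)%N -> ab != ab' ->
  ident K ab.2 ab.1 (vfactor ab') != 0.
Proof.
case: ab ab' => [a b] [c d] /= ltab ltcd nab.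
rewrite /vfactor rmorphB !identX /=; case: (eqVneq d b) => [ed|ndb].
  have /negPf -> : c != b by rewrite -ed -val_eqE /= neq_ltn ltcd.
  by rewrite subX_neq0 //; apply: contraNneq nab => ->; rewrite ed.
case: (eqVneq c b) => [ec|ncb]; rewrite subX_neq0 // -val_eqE /= neq_ltn ?ltcd ?orbT //.
by rewrite (ltn_trans ltab) ?orbT // -ec.
Qed.

Definition vpairs : seq ('I_N * 'I_N) := [seq ab : 'I_N * 'I_N <- enum {: 'I_N * 'I_N} | (ab.1 < ab.2)%N].

(** The linear factors are divided out one at a time: those already removed stay nonzero on the
    diagonal of the next pair, so the quotient vanishes there. Each factor lowers the degree in its
    two variables by one. *)
Lemma vandermonde_factor_seq F (l : seq ('I_N * 'I_N)) :
  (forall a b, a != b -> ident K a b F = 0) -> uniq l -> all (fun ab : 'I_N * 'I_N => ab.1 < ab.2)%N l ->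
  exists2 q, F = \prod_(ab <- l) vfactor ab * q &
    forall c d, (forall h, (d < h c)%N -> F@_h = 0) ->
    forall h, (d < h c + count (fun ab : 'I_N * 'I_N => (ab.1 == c) || (ab.2 == c)) l)%N -> q@_h = 0.
Proof.
move=> HF; elim: l => [|[a b] l IH] /=.
  by move=> _ _; exists F; rewrite ?big_nil ?mul1r // => c d H h; rewrite addn0; exact: H.
move=> /andP[nl ul] /andP[ltab al]; have [q Fq Hq] := IH ul al.
have nba : b != a by rewrite -val_eqE /= neq_ltn ltab orbT.
have := HF b a nba; rewrite {1}Fq rmorphM => /eqP; rewrite mulf_eq0 => /orP[|/eqP].
  rewrite rmorph_prod prodf_seq_eq0 => /hasP[ab abl] /=; rewrite (negPf (@ident_vfactor_neq0 (a,b) ab _ _ _)) //.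
    by move/allP: al; exact.
  by apply: contraNneq nl => ->.
move=> /sub_vars_dvd [q' Hq']; exists q'; first by rewrite Fq big_cons Hq' mulrCA mulrA.
move=> c d HFc; have {HFc} Hc := Hq c d HFc.
case: (eqVneq b c) Hc => [<-|nbc] Hc.
  rewrite orbT; apply: (factor_coef_eq0 Hq' nba) => h.
    by rewrite !(mnmDE, mnmBE, mnm1E) eqxx (eq_sym a) (negPf nba); lia.
  by move=> Hh; apply: Hc; rewrite mnmDE mnm1E eqxx; lia.
have Hq'' : q = ('X_a - 'X_b) * - q' by rewrite Hq'; ring.
case: (eqVneq a c) Hc => [<-|nac] Hc /=.
  move=> h Hh; apply/eqP; rewrite -oppr_eq0 -mcoeffN; apply/eqP; move: h Hh.
  have nab : a != b by rewrite eq_sym.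
  apply: (factor_coef_eq0 Hq'' nab) => h.
    by rewrite !(mnmDE, mnmBE, mnm1E) eqxx (negPf nba); lia.
  by move=> Hh; apply: Hc; rewrite mnmDE mnm1E eqxx; lia.
apply: (factor_coef_eq0 Hq' nba) => h.
  by rewrite !(mnmDE, mnmBE, mnm1E) (negPf nac) (negPf nbc); lia.
by move=> Hh; apply: Hc; rewrite mnmDE mnm1E (negPf nbc); lia.
Qed.

Definition vand : R := \prod_(ab : 'I_N * 'I_N | (ab.1 < ab.2)%N) vfactor ab.

Lemma count_vpairs c :
  (N.-1 <= count (fun ab : 'I_N * 'I_N => (ab.1 == c) || (ab.2 == c)) vpairs)%N.
Proof.
have -> : N.-1 = size (enum (predC1 c)) by rewrite -cardE cardC1 card_ord.
rewrite -size_filter -filter_predI.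
pose f (j : 'I_N) := if (j < c)%N then (j, c) else (c, j).
rewrite -(size_map f); apply: uniq_leq_size.
  rewrite map_inj_in_uniq ?enum_uniq // => i j _ _ /=; rewrite /f.
  by do 2!case: ifP => //; [move=> _ _ []|move=> H1 H2 [] e1 e2; move: H1 H2; rewrite -e2 e1 ltnn|move=> H1 H2 [] e1 e2; move: H1 H2; rewrite -e1 e2 ltnn|move=> _ _ []].
move=> ab /mapP[j]; rewrite mem_enum !inE => njc -> {ab}.
rewrite mem_filter mem_enum inE andbT /= /f; case: ltngtP => [h|h|/val_inj e] /=.
- by rewrite eqxx orbT.
- by rewrite eqxx h.
by rewrite e eqxx in njc.
Qed.

Lemma vandermonde_factor F : (forall a b, a != b -> ident K a b F = 0) ->
  exists2 q, F = vand * q &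
    forall c d, (forall h, (d < h c)%N -> F@_h = 0) -> forall h, (d < h c + N.-1)%N -> q@_h = 0.
Proof.
move=> HF; have [||q Fq Hq] := @vandermonde_factor_seq F vpairs HF.
- by rewrite filter_uniq // enum_uniq.
- by apply/allP => ab; rewrite mem_filter => /andP[].
exists q; first by rewrite Fq; congr (_ * _); rewrite /vpairs big_filter big_enum_cond; apply: eq_bigl.
move=> c d Hd h Hh; apply: (Hq c d Hd); apply: leq_trans Hh _.
by rewrite leq_add2l count_vpairs.
Qed.

Lemma vand_det : vand = \det (Vandermonde N (\row_j ('X_j : R))).
Proof.
rewrite det_Vandermonde pair_big_dep; apply: eq_bigr => -[a b] _.
by rewrite !mxE.
Qed.

(** Exchanging two variables exchanges two columns of the determinant. *)
Lemma msym_vand a b : a != b -> msym (tperm a b) vand = - vand.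
Proof.
move=> nab; rewrite vand_det -[LHS]/(msymr K (tperm a b) _) -det_map_mx.
have -> : map_mx (msymr K (tperm a b)) (Vandermonde N (\row_j ('X_j : R))) =
   col_perm (tperm a b) (Vandermonde N (\row_j ('X_j : R))).
  by apply/matrixP => i j; rewrite !mxE rmorphXn /= msymXU.
by rewrite col_permE det_mulmx det_perm odd_permV odd_tperm nab expr1 mulrN1.
Qed.

Lemma ident_vand_cofactor a b : (a < b)%N ->
  exists2 w, vand = ('X_a - 'X_b) * w & ident K a b w != 0.
Proof.
move=> ltab; exists (- \prod_(ab : 'I_N * 'I_N | (ab.1 < ab.2)%N && (ab != (a, b))) vfactor ab).
  by rewrite /vand (bigD1 (a, b)) //= /vfactor /=; ring.
apply/negP => /eqP /ident_swap0 /eqP; rewrite rmorphN oppr_eq0 rmorph_prod.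
apply/negP/prodf_neq0 => ab /andP[h n]; apply: (@ident_vfactor_neq0 (a, b)) => //.
by rewrite eq_sym.
Qed.

End VandermondeDivision.

(** Induction with a prefix [r] of entries already in place: the next entry x is brought to the
    front by adjacent exchanges. *)
Lemma perm_eq_adjacent (T : eqType) (A : Type) (k : nat) (f : seq T -> A) :
  (forall s x y t, (size s + size t).+2 = k -> f (s ++ [:: x, y & t]) = f (s ++ [:: y, x & t])) ->
  forall s t, size s = k -> perm_eq s t -> f s = f t.
Proof.
move=> Hf s; rewrite -[s]cat0s => t; rewrite -[t]cat0s; move: [::] => r.
elim: s r t => [|x s IH] r t; first by rewrite perm_cat2l perm_sym => _ /perm_nilP ->.
rewrite size_cat perm_cat2l /= => sk pst.
have : x \in t by rewrite -(perm_mem pst) inE eqxx.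
move=> xt; move: pst; case/splitPr: xt => t1 t2; rewrite perm_sym -cat1s perm_catCA cat1s perm_cons perm_sym => pst.
have sst : size s = size (t1 ++ t2) by apply: perm_size.
rewrite -cat_rcons (IH (rcons r x) (t1 ++ t2)); first last.
- by rewrite perm_cat2l.
- by rewrite size_cat size_rcons; lia.
rewrite size_cat in sst; have {}sk : (size r + (size t1 + size t2).+1 = k)%N by lia.
move=> {IH pst s sst}; elim: t1 r sk => [|y t1 IH] r sk; first by rewrite cat_rcons.
rewrite cat_rcons /= Hf; last by rewrite size_cat /= in sk *; lia.
by rewrite -cat_rcons -cat_rcons IH ?size_rcons ?cat_rcons //=; move: sk => /=; lia.
Qed.

(** * Euler operators on a diagonal *)

Section EulerOperator.
Variables (K : idomainType) (N : nat).
Local Notation R := {mpoly K[N]}.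

Definition eulerop (b : 'I_N) (p : R) : R := 'X_b * p^`M(b).

Lemma eulerM b p q : eulerop b (p * q) = eulerop b p * q + p * eulerop b q.
Proof. by rewrite /eulerop mderivM; ring. Qed.

Lemma eulerX b c : eulerop b 'X_c = if b == c then 'X_c else 0.
Proof.
rewrite /eulerop mderivX mnm1E eq_sym; case: eqP => [->|_]; last by rewrite scale0r mulr0.
have -> : (U_(c) - U_(c) = 0)%MM by apply/mnmP => j; rewrite mnmBE mnm0E subnn.
by rewrite scale1r mpolyX0 mulr1.
Qed.

Lemma eulerB b p q : eulerop b (p - q) = eulerop b p - eulerop b q.
Proof. by rewrite /eulerop mderivB mulrBr. Qed.

Lemma eulerN b p : eulerop b (- p) = - eulerop b p.
Proof. by rewrite /eulerop mderivN mulrN. Qed.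

Lemma msym_euler (a b : 'I_N) p : eulerop b (msym (tperm a b) p) = msym (tperm a b) (eulerop a p).
Proof.
apply/mpolyP => h; rewrite mcoeff_euler !mcoeff_sym mcoeff_euler mnmE tpermL.
by [].
Qed.

(* If [w] is symmetric then [(X_a - X_b) w G] and [G] satisfy the same second order condition along
   the diagonal [X_a = X_b], up to the unit [w]. *)
Lemma ident_euler_symmetric a b w G : a != b ->
  msym (tperm a b) w = w -> ident K a b w != 0 ->
  ident K a b (eulerop a (eulerop b (('X_a - 'X_b) * (w * G)))) = 0 ->
  ident K a b (eulerop b G - eulerop a G) = 0.
Proof.
move=> nab sw w0.
have ia : ident K a b 'X_a = 'X_b by rewrite identX eqxx.
have ib : ident K a b 'X_b = 'X_b by rewrite identX eq_sym (negPf nab).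
have ew : ident K a b (eulerop b w) = ident K a b (eulerop a w).
  by rewrite -{1}sw msym_euler ident_sym.
have D x y : eulerop a (x + y) = eulerop a x + eulerop a y by rewrite /eulerop mderivD mulrDr.
have -> P : eulerop a (eulerop b (('X_a - 'X_b) * P)) =
    'X_a * eulerop b P - 'X_b * eulerop a P + ('X_a - 'X_b) * eulerop a (eulerop b P).
  rewrite (eulerM b) eulerB !(eulerX b) (eq_sym b) eqxx (negPf nab) sub0r D !(eulerM a) eulerN eulerB.
  by rewrite !(eulerX a) eqxx (negPf nab); ring.
(* Y only occurs multiplied by X_a - X_b, which vanishes on the diagonal. *)
set Y := eulerop a (eulerop b (w * G)); move: Y => Y.
rewrite !eulerM; move: ew; set wa := eulerop a w; set wb := eulerop b w; set Ga := eulerop a G; set Gb := eulerop b G.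
have Xb : ('X_b : R) != 0.
  by apply/eqP => /(congr1 (mcoeff U_(b)))/eqP; rewrite mcoeffXU eqxx mcoeff0 oner_eq0.
move: Xb ia ib w0 wa wb Ga Gb; move: (ident K a b) ('X_a : R) ('X_b : R) => s x y y0 sx sy w0 wa wb Ga Gb ew.
rewrite !(rmorphD, rmorphN, rmorphM) sx sy ew => H.
have : y * (s w * (s Gb - s Ga)) = 0 by rewrite -H; ring.
by move/eqP; rewrite !mulf_eq0 (negPf y0) (negPf w0) => /eqP.
Qed.

End EulerOperator.

Lemma sum_antidiagonal (A : nmodType) (m s : nat) (F : nat -> nat -> A) :
  (forall a b, (m < a)%N || (m < b)%N -> F a b = 0) ->
  \sum_(b < m.+1) \sum_(a < m.+1 | (a + b == s)%N) F a b = \sum_(k < s.+1) F k (s - k)%N.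
Proof.
move=> F0; rewrite (exchange_big_dep predT) //=.
transitivity (\sum_(a < m.+1 | (a < s.+1)%N) F a (s - a)%N).
  rewrite [RHS]big_mkcond; apply: eq_bigr => a _; case: ltnP => has; last first.
    by rewrite big1 // => b; lia.
  case: (ltnP (s - a) m.+1) => hb; last first.
    rewrite F0 ?hb ?orbT // big1 // => b; have := ltn_ord b; lia.
  by rewrite (big_pred1 (Ordinal hb)) // => b /=; rewrite -val_eqE /=; lia.
rewrite (big_ord_widen_cond (m + s).+1 (fun a => (a < s.+1)%N) (fun a => F a (s - a)%N)) ?ltnS ?leq_addr //.
rewrite (big_ord_widen (m + s).+1 (fun a => F a (s - a)%N)) ?ltnS ?leq_addl //.
rewrite big_mkcondr; apply: eq_bigr => a _; case: ltnP => // ma.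
by rewrite F0 ?ma.
Qed.

Section UnitCovectors.
Variables (K : fieldType) (g : nat).

(** Indexed by all natural numbers and zero beyond g, so that antidiagonal sums carry no range
    condition. *)
Definition eps (k : nat) : 'I_g.+1 -> K := fun b => (b == k :> nat)%:R.

Lemma contr_eps_out k (z : ext K g.+1) : (g < k)%N -> contr (eps k) z = 0.
Proof.
move=> gk; apply/ffunP => A; rewrite !ffunE big1 // => a _.
by rewrite /eps; case: eqP => [e|]; [have := ltn_ord a; lia|rewrite mulr0 mul0r].
Qed.

End UnitCovectors.

(** * The alternating condition for Koszul cycles *)

Section CycleSymmetry.
Variables (K : fieldType) (g q : nat).
Local Notation m := (g - q.+1)%N.
Hypothesis natU : forall i, (0 < i <= m)%N -> (i%:R : K) != 0.
Hypothesis m2 : (2 <= m)%N.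
Hypothesis mq : (m <= q.+2)%N.
Local Notation R := {mpoly K[q.+2]}.
Local Notation N := q.+2.
Local Notation X0 := (@ord0 q.+1).
Local Notation XM := (@ord_max q.+1).
Implicit Types h : 'X_{1..N}.

Local Notation eps := (@eps K g).

Variable cc : nat -> ext K g.+1.
Hypothesis cc_deg : forall k, extdeg q.+1 (cc k).
Hypothesis cc_out : forall k, (g < k)%N -> cc k = 0.
Hypothesis C1 : forall s, \sum_(k < s.+1) contr (eps k) (cc (s - k)) = 0.
Hypothesis C2 : forall s, \sum_(k < s.+1) (k * (s - k))%:R *: contr (eps k) (cc (s - k)) = 0.

Definition inner_vars : seq 'I_N := [seq inord j | j <- iota 1 q].
(** The last variable [XM] plays the role of y. [ord0] comes at the end of the list so that the
    contraction with its exponent acts first on the cycle, as in [C1] and [C2]. *)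
Definition x_vars : seq 'I_N := rcons inner_vars ord0.

Lemma mem_inner_vars j : (j \in inner_vars) = (j != X0) && (j != XM).
Proof.
apply/mapP/andP => [[k]|[n0 nM]].
  rewrite mem_iota => hk ->; rewrite -!val_eqE /= inordK; lia.
exists (val j); last by rewrite inord_val.
by case: j n0 nM => j hj; rewrite -!val_eqE mem_iota /=; lia.
Qed.

Lemma uniq_inner_vars : uniq inner_vars.
Proof.
rewrite map_inj_in_uniq ?iota_uniq // => j k; rewrite !mem_iota => hj hk.
by move/(congr1 val); rewrite /= !inordK; lia.
Qed.

Lemma mem_x_vars j : (j \in x_vars) = (j != XM).
Proof. by rewrite mem_rcons inE mem_inner_vars; case: eqP => [->|]. Qed.

Lemma uniq_x_vars : uniq x_vars.
Proof. by rewrite rcons_uniq uniq_inner_vars mem_inner_vars eqxx. Qed.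

Definition cycle_coef (h : 'X_{1..N}) : K :=
  contrs [seq eps (h j) | j <- x_vars] (cc (h XM)) set0.

Lemma cycle_coef_out h j : (g < h j)%N -> cycle_coef h = 0.
Proof.
move=> gh; rewrite /cycle_coef; case: (eqVneq j XM) gh => [->|nj] gh.
  by rewrite cc_out // contrs0 ffunE.
rewrite (@contrs_mem0 _ _ _ j _ (fun j => eps (h j))) ?mem_x_vars ?ffunE //.
by rewrite contr_eps_out.
Qed.

(** Exponents above g give coefficient 0, so total degree at most N g suffices. *)
Definition cycle_poly : R := \sum_(h : 'X_{1..N < (N * g).+1}) cycle_coef h *: 'X_[h].

Lemma mcoeff_cycle_poly h : cycle_poly@_h = cycle_coef h.
Proof.
case: (ltnP (mdeg h) (N * g).+1) => hd; first by rewrite /cycle_poly (mcoeff_mpoly cycle_coef).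
have [j gj] : exists j, (g < h j)%N.
  apply/existsP; rewrite -[X in is_true X]negbK negb_exists; apply/negP => /forallP H.
  suff : (mdeg h <= N * g)%N by lia.
  rewrite mdegE -[X in (_ <= X * _)%N](card_ord N) -sum_nat_const.
  by apply: leq_sum => j _; have := H j; lia.
rewrite (cycle_coef_out gj) /cycle_poly raddf_sum big1 // => k _ /=; rewrite mcoeffZ mcoeffX.
case: eqP => [e|_]; last by rewrite mulr0.
by have := bmdeg k; rewrite e; lia.
Qed.

Lemma two_neq0 : (2%:R : K) != 0.
Proof. by apply: natU; rewrite m2. Qed.

Lemma msym_cycle_poly a b : a != b -> a != XM -> b != XM -> msym (tperm a b) cycle_poly = - cycle_poly.
Proof.
move=> nab aM bM; apply/mpolyP => h; rewrite mcoeff_sym mcoeffN !mcoeff_cycle_poly /cycle_coef.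
rewrite mnmE tpermD // 1?eq_sym //.
transitivity (contrs [seq eps (h (tperm a b j)) | j <- x_vars] (cc (h XM)) set0).
  by congr (contrs _ _ _); apply: eq_map => j; rewrite mnmE.
by rewrite (contrs_tperm (fun j => eps (h j))) ?uniq_x_vars ?mem_x_vars // ffunE.
Qed.

Lemma mcoeff_ident0 a b (p : R) h : a != b -> h a != 0%N -> (ident K a b p)@_h = 0.
Proof.
move=> nab ha; rewrite (mpolyE p) rmorph_sum raddf_sum big1_seq //= => k _.
rewrite -!/(ident K a b _) -mul_mpolyC rmorphM identC mcoeffCM ident_mnm // mcoeffX.
case: eqP => [e|_]; last by rewrite mulr0.
by move: ha; rewrite -e mnmE eqxx.
Qed.

Lemma ident_eq0 a b (p : R) : a != b ->
  (forall h s, h a = 0%N -> h b = 0%N ->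
     \sum_(k < s.+1) p@_(h + U_(a) *+ k + U_(b) *+ (s - k)) = 0) ->
  ident K a b p = 0.
Proof.
move=> nab H; apply/mpolyP => h; rewrite mcoeff0.
case: (eqVneq (h a) 0%N) => [ha|ha]; last exact: mcoeff_ident0.
pose h' : 'X_{1..N} := [multinom (if j == b then 0%N else h j) | j < N].
have -> : h = (h' + U_(b) *+ h b)%MM.
  apply/mnmP => j; rewrite mnmDE mulmnE mnm1E mnmE eq_sym.
  by case: eqP => [->|_]; rewrite /= ?muln1 ?muln0 ?mul1n ?mul0n ?addn0.
have h'a : h' a = 0%N by rewrite mnmE (negPf nab).
have h'b : h' b = 0%N by rewrite mnmE eqxx.
by rewrite mcoeff_ident // H.
Qed.

Lemma nX0M : X0 != XM. Proof. by []. Qed.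

Lemma cycle_coef_split h : cycle_coef h = contrs [seq eps (h j) | j <- inner_vars] (contr (eps (h X0)) (cc (h XM))) set0.
Proof. by rewrite /cycle_coef map_rcons -cats1 contrs_cat. Qed.

Lemma contrs_sum e (I : finType) (F : I -> ext K g.+1) A :
  contrs e (\sum_i F i) A = \sum_i contrs e (F i) A.
Proof.
transitivity ((\sum_i contrs e (F i)) A); last by rewrite sum_ffunE.
by congr ((_ : ext K g.+1) A); elim/big_rec2: _ => [|i x y _ <-]; rewrite ?contrs0 ?contrsD.
Qed.

Lemma cycle_coef_shift h s (k : 'I_s.+1) : h X0 = 0%N -> h XM = 0%N ->
  cycle_coef (h + U_(X0) *+ k + U_(XM) *+ (s - k)) =
  contrs [seq eps (h j) | j <- inner_vars] (contr (eps k) (cc (s - k))) set0.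
Proof.
move=> h0 hM; rewrite cycle_coef_split !(mnmDE, mulmnE, mnm1E) h0 hM !eqxx /=.
rewrite !mul0n !mul1n !addn0 !add0n; congr (contrs _ _ _).
apply/eq_in_map => j; rewrite mem_inner_vars !(mnmDE, mulmnE, mnm1E) => /andP[/negPf n0 /negPf nM].
by rewrite !(eq_sym _ j) n0 nM !mul0n !addn0.
Qed.

Lemma ident_cycle_poly0 : ident K X0 XM cycle_poly = 0.
Proof.
apply: ident_eq0 => // h s h0 hM.
under eq_bigr => k _ do rewrite mcoeff_cycle_poly cycle_coef_shift //.
by rewrite -contrs_sum C1 contrs0 ffunE.
Qed.

Lemma ident_euler_cycle_poly : ident K X0 XM (eulerop X0 (eulerop XM cycle_poly)) = 0.
Proof.
apply: ident_eq0 => // h s h0 hM.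
transitivity (contrs [seq eps (h j) | j <- inner_vars]
   (\sum_(k < s.+1) (k * (s - k))%:R *: contr (eps k) (cc (s - k))) set0); last by rewrite C2 contrs0 ffunE.
rewrite contrs_sum; apply: eq_bigr => k _.
rewrite !mcoeff_euler mcoeff_cycle_poly cycle_coef_shift // contrsZ ffunE mulrA -natrM.
by rewrite !(mnmDE, mulmnE, mnm1E) h0 hM !eqxx /= !mul0n !mul1n !addn0 !add0n.
Qed.

(** For an x and y, exchange this x with [X0] and apply [ident_cycle_poly0]. For two x's,
    alternation shows that twice the restriction is 0, and 2 is invertible. *)
Lemma ident_cycle_poly (a b : 'I_N) : a != b -> ident K a b cycle_poly = 0.
Proof.
have sw c d : ident K c d cycle_poly = 0 -> ident K d c cycle_poly = 0 by exact: ident_swap0.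
have H (c : 'I_N) : c != XM -> ident K c XM cycle_poly = 0.
  move=> ncM; case: (eqVneq c X0) => [->|nc0]; first exact: ident_cycle_poly0.
  have n0c : (X0 == c) = false by apply/eqP => e; move: nc0; rewrite -e eqxx.
  have E : ident K c XM cycle_poly = - msym (tperm c X0) (ident K X0 XM cycle_poly).
    have E0 : cycle_poly = - msym (tperm c X0) cycle_poly by rewrite msym_cycle_poly // opprK.
    rewrite {1}E0 (rmorphN (ident K c XM)); congr (- _); move: cycle_poly {E0}.
    apply: (@mpoly_morph_eq _ _ _ (ident K c XM \o msymr K (tperm c X0)) (msymr K (tperm c X0) \o ident K X0 XM)) => [k|j] /=.
      by rewrite comp_mpolyC -[k%:MP]mulr1 mul_mpolyC msymZ msym1 alg_mpolyC comp_mpolyC.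
    rewrite -!/(ident K _ _ _) msymXU !identX; case: tpermP => [->|->|].
    - by rewrite n0c (negPf nc0) msymXU tpermL.
    - by rewrite !eqxx msymXU tpermD // eq_sym.
    - by move=> /eqP/negPf jc /eqP/negPf jX; rewrite jc jX msymXU tpermD // eq_sym ?jX ?jc.
  by rewrite E ident_cycle_poly0 msym0 oppr0.
move=> nab; case: (eqVneq b XM) nab => [->|nbM] nab; first exact: H.
case: (eqVneq a XM) nab => [->|naM] nab; first by apply: sw; apply: H.
have := ident_sym a b cycle_poly; rewrite msym_cycle_poly // rmorphN => /eqP.
rewrite -subr_eq0 -opprD oppr_eq0 -mulr2n -scaler_nat -mul_mpolyC mulf_eq0 => /orP[|/eqP//].
by rewrite mpolyC_eq0 (negPf two_neq0).
Qed.

Section Quotient.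
Variable G : R.
Hypothesis defG : cycle_poly = vand K N * G.
Hypothesis G_out : forall c h, (m < h c)%N -> G@_h = 0.

Lemma vand_neq0 : vand K N != 0.
Proof.
have [w -> iw] := @ident_vand_cofactor K N X0 XM isT.
rewrite mulf_neq0 ?subX_neq0 //; apply: contraNneq iw => ->; by rewrite rmorph0.
Qed.

Lemma msym_quotient (a b : 'I_N) : a != b -> a != XM -> b != XM -> msym (tperm a b) G = G.
Proof.
move=> nab aM bM; apply: (mulfI vand_neq0); rewrite -defG.
have := msym_cycle_poly nab aM bM; rewrite {1}defG msymM msym_vand // mulNr => /oppr_inj <-.
by [].
Qed.

(** The cofactor w of the linear factor of [X0] and [XM] in the Vandermonde determinant is symmetric
    in them and nonzero on their diagonal, so [ident_euler_symmetric] turns the second order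
    condition on the cycle into a first order one on G. *)
Lemma quotient_wronskian h s : h X0 = 0%N -> h XM = 0%N ->
  \sum_(k < s.+1) ((s - k)%:R - k%:R) * G@_(h + U_(X0) *+ k + U_(XM) *+ (s - k)) = 0.
Proof.
move=> h0 hM; have [w vw iw] := @ident_vand_cofactor K N X0 XM isT.
have dX : ('X_X0 - 'X_XM : R) != 0 by rewrite subX_neq0.
have sw : msym (tperm X0 XM) w = w.
  apply: (mulfI dX); have := @msym_vand K N X0 XM isT.
  rewrite vw msymM -[msym _ (_ - _)]/(msymr K _ _) rmorphB /= !msymXU tpermL tpermR.
  by rewrite -mulNr opprB => /(mulfI _) ->; [rewrite // |rewrite subX_neq0].
have H := ident_euler_cycle_poly; rewrite defG vw -mulrA in H.
have := ident_euler_symmetric nX0M sw iw H => /(congr1 (mcoeff (h + U_(XM) *+ s))).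
rewrite mcoeff0 mcoeff_ident // => {2}<-; apply: eq_bigr => k _.
rewrite mcoeffB !mcoeff_euler -mulrBl; congr (_ * _).
by rewrite !(mnmDE, mulmnE, mnm1E) h0 hM !eqxx /= !mul0n !mul1n !addn0 !add0n.
Qed.

Definition seq_mnm (L : seq nat) b : 'X_{1..N} := [multinom nth 0%N (rcons L b) j | j < N].
(** [L] lists the exponents of the x's, beginning with [X0]; b is the exponent of y. *)
Definition quot_coef L b := G@_(seq_mnm L b).

Lemma quot_coef_adjacent s x y t b : (size s + size t).+2 = q.+1 ->
  quot_coef (s ++ [:: x, y & t]) b = quot_coef (s ++ [:: y, x & t]) b.
Proof.
move=> st; pose j : 'I_N := inord (size s); pose j1 : 'I_N := inord (size s).+1.
have ej : val j = size s by rewrite /= inordK //; lia.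
have ej1 : val j1 = (size s).+1 by rewrite /= inordK //; lia.
rewrite /quot_coef -{1}(@msym_quotient j j1) ?mcoeff_sym; first last.
- by rewrite -val_eqE ej1 /=; lia.
- by rewrite -val_eqE ej /=; lia.
- by rewrite -val_eqE ej ej1; lia.
congr (G@_ _); apply/mnmP => k; rewrite !mnmE.
rewrite !rcons_cat /= !nth_cat; case: tpermP => [->|->|].
- by rewrite ej ej1 ltnn subnn ltnNge leqnSn subSnn.
- by rewrite ej ej1 ltnn subnn ltnNge leqnSn subSnn.
move=> /eqP; rewrite -val_eqE ej => nj /eqP; rewrite -val_eqE ej1 => nj1.
case: ltnP => // hk; case E: (k - size s)%N => [|[|l]] //=; move: nj nj1 => /=; lia.
Qed.

Lemma quot_coef_perm L L' b : size L = q.+1 -> perm_eq L L' -> quot_coef L b = quot_coef L' b.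
Proof. by apply: (perm_eq_adjacent (f := quot_coef^~ b)) => *; apply: quot_coef_adjacent. Qed.

Lemma quot_coef_out L b x : size L = q.+1 -> (m < x)%N -> x \in rcons L b -> quot_coef L b = 0.
Proof.
move=> sL mx /(nthP 0%N) [k]; rewrite size_rcons sL => hk ek.
by apply: (@G_out (Ordinal hk)); rewrite mnmE /= ek.
Qed.

Lemma quot_coef_wronskian L s : size L = q ->
  \sum_(k < s.+1) ((s - k)%:R - k%:R) * quot_coef ((k : nat) :: L) (s - k) = 0.
Proof.
move=> sL; have h0 : seq_mnm (0%N :: L) 0%N X0 = 0%N by rewrite mnmE.
have hM : seq_mnm (0%N :: L) 0%N XM = 0%N by rewrite mnmE /= nth_rcons sL ltnn eqxx.
rewrite -[RHS](quotient_wronskian s h0 hM).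
apply: eq_bigr => k _; congr (_ * G@_ _); apply/mnmP => j.
rewrite !(mnmDE, mulmnE, mnm1E, mnmE) -!val_eqE /=.
case: j => -[|j] hj /=; first by rewrite mul1n mul0n addn0.
rewrite !nth_rcons sL mul0n addn0; case: ltnP => [hj'|]; first by rewrite ?eqSS (gtn_eqF hj') mul0n addn0.
by move=> hj'; have ej : j = q; [lia|rewrite eqSS ej eqxx mul1n].
Qed.

Lemma perm_m2s_U (k : nat) (f : 'X_{1..k}) a : perm_eq (m2s (f + U_(a))%MM) (a :: m2s f).
Proof.
apply/allP => x _ /=; apply/eqP.
have E (f' : 'X_{1..k}) y : count_mem y (m2s f') = f' y.
  by rewrite -[in RHS](s2mK f') mnmE.
by rewrite !E mnmDE mnm1E addnC.
Qed.

Lemma perm_m2s_s2m (k : nat) (l : seq 'I_k) : perm_eq (m2s (s2m l)) l.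
Proof.
apply/allP => x _ /=; apply/eqP.
have := congr1 (fun f : 'X_{1..k} => f x) (s2mK (s2m l)).
by rewrite !mnmE.
Qed.

(** If an exponent exceeds m, both sides are 0. Otherwise the first q + 2 - m entries of L are
    frozen, which makes sense as m <= q + 2, and the remaining m - 2 form the monomial to which
    [wronskian_symmetric] applies. *)
Lemma quot_coef_swap L a b : size L = q -> quot_coef (a :: L) b = quot_coef (b :: L) a.
Proof.
move=> sL; case: (boolP (all (leq^~ m) [:: a, b & L])) => [/and3P[am bm Lm]|]; last first.
  move=> /allPn[x xi]; rewrite -ltnNge => mx.
  rewrite !(@quot_coef_out _ _ x) //= ?sL //; move: xi; rewrite !inE !mem_rcons !inE.
    by rewrite orbCA.
  by [].
pose p := (q.+2 - m)%N; set P := take p L; set L' := drop p L.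
have sL' : size L' = m.-2 by rewrite size_drop sL /p; lia.
have sP : size P = p by rewrite size_takel // sL /p; lia.
pose c (f : 'X_{1..m.+1}) (k : 'I_m.+1) := quot_coef (P ++ [seq val x | x <- m2s f]) k.
have cE f (x : 'I_m.+1) k l : mdeg f = m.-2 -> perm_eq (m2s f) l ->
    c (f + U_(x))%MM k = quot_coef (val x :: P ++ [seq val y | y <- l]) k.
  move=> df pl; apply: quot_coef_perm.
    by rewrite size_cat size_map size_m2s mdegD mdeg1 df sP /p; lia.
  rewrite perm_sym -cat1s perm_catCA perm_cat2l cat1s -map_cons perm_map //.
  by rewrite perm_sym (perm_trans (perm_m2s_U _ _)) // perm_cons.
have sym := @wronskian_symmetric K m natU m2 c.
have am' : (a < m.+1)%N by []. have bm' : (b < m.+1)%N by [].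
pose l : seq 'I_m.+1 := [seq inord x | x <- L'].
have lL : [seq val y | y <- l] = L'.
  rewrite -map_comp -[RHS]map_id; apply/eq_in_map => x xL /=; rewrite inordK //.
  by rewrite ltnS; apply: (allP Lm); apply: mem_drop xL.
have dl : mdeg (s2m l) = m.-2.
  by rewrite -size_m2s (perm_size (perm_m2s_s2m l)) size_map.
have := sym _ (s2m l) (Ordinal am') (Ordinal bm') dl.
rewrite !(cE _ _ _ l) ?perm_m2s_s2m // lL cat_take_drop; apply.
move=> f s df.
have sz : size (P ++ [seq val x | x <- m2s f]) = q.
  by rewrite size_cat size_map size_m2s df sP /p; lia.
rewrite -[RHS](@quot_coef_wronskian (P ++ [seq val x | x <- m2s f]) s.+1) //.
rewrite -(@sum_antidiagonal _ m s.+1 (fun x y => (y%:R - x%:R) * quot_coef (x :: P ++ [seq val x | x <- m2s f]) y)); last first.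
  move=> x y /orP[]mx; rewrite (quot_coef_out _ mx) ?mulr0 //= ?sz //; first by rewrite inE eqxx.
  by rewrite inE mem_rcons inE eqxx orbT.
apply: eq_bigr => y _; apply: eq_bigr => x _; congr (_ * _).
by rewrite (cE _ _ _ (m2s f)).
Qed.

Lemma msym_quotient_last : msym (tperm X0 XM) G = G.
Proof.
apply/mpolyP => h; rewrite mcoeff_sym; pose L := [seq h j | j <- inner_vars].
have sL : size L = q by rewrite !size_map size_iota.
have E (f : 'X_{1..N}) : (forall j, j \in inner_vars -> f j = h j) -> f = seq_mnm (f X0 :: L) (f XM).
  move=> fh; apply/mnmP => j; rewrite mnmE; case: j => -[|j] hj /=.
    by congr (f _); apply: val_inj.
  rewrite nth_rcons sL; case: ltnP => [hjq|hqj]; last first.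
    have ej : j = q by lia.
    by move/eqP: (ej) => ->; congr (f _); apply: val_inj; rewrite /= ej.
  rewrite (nth_map X0) ?size_map ?size_iota // (nth_map 0%N) ?size_iota // nth_iota // add1n.
  have -> : Ordinal hj = inord j.+1 by apply: val_inj; rewrite /= inordK //; lia.
  by apply: fh; apply: map_f; rewrite mem_iota; lia.
rewrite [X in G@_X]E; last first.
  by move=> j; rewrite mem_inner_vars mnmE => /andP[j0 jM]; rewrite tpermD // eq_sym.
rewrite [in RHS](E h) // !mnmE tpermL tpermR.
exact: quot_coef_swap.
Qed.

End Quotient.

(** As G is symmetric in all variables, the cycle polynomial alternates in [X0] and y as well; its
    coefficients are the full contractions that determine the form. *)
Theorem contr_cycle_antisym a k : contr (eps a) (cc k) + contr (eps k) (cc a) = 0.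
Proof.
have [G defG Gout] := vandermonde_factor ident_cycle_poly.
have G_out c h : (m < h c)%N -> G@_h = 0.
  move=> hc; apply: (Gout c g); last by move: hc; rewrite /=; lia.
  by move=> f gf; rewrite mcoeff_cycle_poly (cycle_coef_out gf).
have asym : msym (tperm X0 XM) cycle_poly = - cycle_poly.
  by rewrite defG msymM msym_vand // (msym_quotient_last defG G_out) mulNr.
apply: (@contr_eps_eq0 _ _ q).
  by apply: extdegD; apply: extdeg_contr.
move=> e se; rewrite contrsD ffunE.
pose h := seq_mnm (a :: map val e) k.
have h_inner : [seq eps (h j) | j <- inner_vars] = [seq (fun b => (b == x)%:R) | x <- e].
  have -> : [seq (fun b => (b == x)%:R) | x <- e] = [seq eps x | x <- map val e] by rewrite -map_comp.
  rewrite (map_comp eps h); congr (map eps _).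
  apply: (@eq_from_nth _ 0%N); rewrite ?size_map ?size_iota // => x hx.
  rewrite (nth_map X0) ?size_map ?size_iota // (nth_map 0%N) ?size_iota // nth_iota // add1n.
  by rewrite mnmE inordK ?ltnS 1?ltnW //= nth_rcons size_map se hx.
have := congr1 (mcoeff h) asym; rewrite mcoeff_sym mcoeffN !mcoeff_cycle_poly !cycle_coef_split.
set h' := [multinom _ | _ < _].
have -> : [seq eps (h' j) | j <- inner_vars] = [seq eps (h j) | j <- inner_vars].
  apply/eq_in_map => j; rewrite mem_inner_vars mnmE => /andP[j0 jM].
  by rewrite tpermD // eq_sym.
have h0 : h X0 = a by rewrite mnmE.
have hM : h XM = k by rewrite mnmE /= nth_rcons size_map se ltnn eqxx.
have -> : h' X0 = k by rewrite mnmE tpermL hM.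
have -> : h' XM = a by rewrite mnmE tpermR h0.
by rewrite h_inner h0 hM => ->; rewrite addrN.
Qed.

End CycleSymmetry.

(** * Comparison of graded free resolutions *)

Section Resolutions.
Variables (K : fieldType) (n : nat).
Local Notation S := {mpoly K[n]}.

Section HomogeneousMatrices.
Variables (p q : nat) (s : 'I_p -> nat) (t : 'I_q -> nat).

(** The matrix of a degree preserving map between graded free modules with generators in degrees s
    and t. *)
Definition hom_mx (A : 'M[S]_(p, q)) :=
  forall r c h, (A r c)@_h != 0 -> (mdeg h + t c = s r)%N.

Lemma hom_mxD A B : hom_mx A -> hom_mx B -> hom_mx (A + B).
Proof.
move=> hA hB r c h; rewrite mxE mcoeffD; case: (eqVneq (A r c)@_h 0) => [->|/hA //].
by rewrite add0r; apply: hB.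
Qed.

Lemma hom_mxN A : hom_mx A -> hom_mx (- A).
Proof. by move=> hA r c h; rewrite mxE mcoeffN oppr_eq0; apply: hA. Qed.

End HomogeneousMatrices.

Lemma hom_mx1 p s : @hom_mx p p s s 1%:M.
Proof.
move=> r c h; rewrite mxE; case: (eqVneq r c) => [->|_]; last by rewrite mcoeff0 eqxx.
by rewrite mcoeff1; case: (eqVneq h 0%MM) => [->|_]; rewrite ?mdeg0 ?eqxx.
Qed.

Lemma hom_mxM p q r s t w (A : 'M[S]_(p, q)) (B : 'M[S]_(q, r)) :
  hom_mx s t A -> hom_mx t w B -> hom_mx s w (A *m B).
Proof.
move=> hA hB i k h; rewrite mxE raddf_sum /= => H.
apply/eqP/negPn/negP => /eqP hd; move/negP: H; apply.
apply/eqP; apply: big1 => j _; rewrite mcoeffM big1 // => -[h1 h2] /= /eqP eh.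
case: (eqVneq (A i j)@_h1 0) => [->|/hA e1]; first by rewrite mul0r.
case: (eqVneq (B j k)@_h2 0) => [->|/hB e2]; first by rewrite mulr0.
by case: hd; rewrite eh mdegD -e1 -e2; lia.
Qed.

(** The component of degree d of a coordinate whose basis vector has degree s; the equation, in
    place of a subtraction, gives 0 when d < s. *)
Definition hom_part (s d : nat) (a : S) : S :=
  \sum_(h <- msupp a | (mdeg h + s == d)%N) a@_h *: 'X_[h].

Lemma mcoeff_hom_part s d a h : (hom_part s d a)@_h = if (mdeg h + s == d)%N then a@_h else 0.
Proof.
rewrite raddf_sum /=; under eq_bigr => k _ do rewrite mcoeffZ mcoeffX.
case: (boolP (h \in msupp a)) => ha; last first.
  rewrite (memN_msupp_eq0 ha) big1_seq ?if_same // => k /andP[_ ka].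
  by case: eqP => [e|_]; [rewrite -e ka in ha|rewrite mulr0].
case: ifP => hd.
  rewrite -big_filter (bigD1_seq h) ?mem_filter ?hd ?filter_uniq //= eqxx mulr1.
  by rewrite big1 ?addr0 // => k /negPf ->; rewrite mulr0.
by rewrite big1 // => k hk; case: eqP => [e|_]; [rewrite -e hk in hd|rewrite mulr0].
Qed.

(** As [D] preserves degrees, the component of degree d of any preimage is again a preimage. *)
Lemma hom_lift_row p q s t (D : 'M[S]_(p, q)) d (x : 'rV_q) (y : 'rV_p) :
  hom_mx s t D -> hom_mx (fun=> d) t x -> x = y *m D ->
  exists2 y' : 'rV_p, hom_mx (fun=> d) s y' & x = y' *m D.
Proof.
move=> hD hx ex; exists (\row_r hom_part (s r) d (y 0 r)).
  by move=> i r h; rewrite mxE mcoeff_hom_part; case: ifP => [/eqP //|_]; rewrite eqxx.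
apply/matrixP => i c; apply/mpolyP => h; rewrite ord1 {i}.
transitivity (if (mdeg h + t c == d)%N then (x 0 c)@_h else 0).
  by case: eqP => // hd; apply/eqP; apply: contra_notT hd; exact: hx.
rewrite ex !mxE !raddf_sum /=.
transitivity (\sum_i (if (mdeg h + t c == d)%N then (y 0 i * D i c)@_h else 0)).
  by case: ifP => // _; rewrite big1.
apply: eq_bigr => r _; rewrite mxE !mcoeffM; case: ifP => hd.
  apply: eq_bigr => -[h1 h2] /= /eqP eh; rewrite mcoeff_hom_part.
  case: (eqVneq (D r c)@_h2 0) => [->|/hD e2]; first by rewrite !mulr0.
  have edeg := etrans (congr1 mdeg eh) (mdegD _ _).
  by case: eqP => // -[]; move: hd => /eqP; lia.
rewrite big1 // => -[h1 h2] /= /eqP eh; rewrite mcoeff_hom_part.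
case: (eqVneq (D r c)@_h2 0) => [->|/hD e2]; first by rewrite mulr0.
case: eqP => [e1|_]; last by rewrite mul0r.
have edeg := etrans (congr1 mdeg eh) (mdegD _ _).
by move: hd => /eqP []; lia.
Qed.

Lemma hom_lift_mx k p q (u : 'I_k -> nat) s t (D : 'M[S]_(p, q)) (A : 'M_(k, q)) :
  hom_mx s t D -> hom_mx u t A -> (forall i, exists y : 'rV_p, row i A = y *m D) ->
  exists2 Y : 'M_(k, p), hom_mx u s Y & A = Y *m D.
Proof.
move=> hD hA H.
have H' i : exists y : 'rV_p, hom_mx (fun=> u i) s y /\ row i A = y *m D.
  have [y ey] := H i; case: (hom_lift_row (d := u i) hD _ ey).
    by move=> j c h; rewrite mxE; apply: hA.
  by move=> y' hy' ey'; exists y'.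
have [Y HY] := fin_all_exists H'; exists (\matrix_(i, c) Y i 0 c).
  by move=> i c h; rewrite mxE; apply: (proj1 (HY i)).
apply/row_matrixP => i; rewrite row_mul (proj2 (HY i)); congr (_ *m _).
by apply/rowP => c; rewrite !mxE.
Qed.

Implicit Types F G : gfree_resolution K n.
Local Notation sh F i := (@gf_shift K n F i).

Lemma gf_diff_hom F i : hom_mx (sh F i.+1) (sh F i) (gf_diff F i).
Proof. exact: gf_diff_homog. Qed.

Lemma gf_diff_diff F i : gf_diff F i.+1 *m gf_diff F i = 0.
Proof.
apply/row_matrixP => r; rewrite row_mul row0.
by apply/gf_exact; exists (delta_mx 0 r); rewrite rowE.
Qed.

Lemma gf_lift F i k (u : 'I_k -> nat) (A : 'M_(k, gf_rank F i.+1)) :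
  hom_mx u (sh F i.+1) A -> A *m gf_diff F i = 0 ->
  exists2 Y : 'M_(k, gf_rank F i.+2), hom_mx u (sh F i.+2) Y & A = Y *m gf_diff F i.+1.
Proof.
move=> hA A0; apply: (hom_lift_mx (@gf_diff_hom F i.+1) hA) => r.
by apply/gf_exact; rewrite -row_mul A0 row0.
Qed.

Definition gf_augment F (x : 'rV[S]_(gf_rank F 0)) := \sum_r (x 0 r)@_0%MM * gf_aug r.

Lemma gf_lift0 F k (u : 'I_k -> nat) (A : 'M_(k, gf_rank F 0)) :
  hom_mx u (sh F 0) A -> (forall r, gf_augment (row r A) = 0) ->
  exists2 Y : 'M_(k, gf_rank F 1), hom_mx u (sh F 1) Y & A = Y *m gf_diff F 0.
Proof. by move=> hA A0; apply: (hom_lift_mx (@gf_diff_hom F 0) hA) => r; apply/gf_exact0/A0. Qed.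

Lemma mcoeff0M (a b : S) : (a * b)@_0%MM = a@_0%MM * b@_0%MM.
Proof. exact: (mcoeff0_is_multiplicative n K).1. Qed.

Lemma gf_augment_mul F k (A : 'M[S]_(k, gf_rank F 0)) (x : 'rV_k) :
  gf_augment (x *m A) = \sum_i (x 0 i)@_0%MM * gf_augment (row i A).
Proof.
rewrite /gf_augment; under eq_bigr => r _ do rewrite mxE raddf_sum mulr_suml /=.
rewrite exchange_big; apply: eq_bigr => i _; rewrite mulr_sumr; apply: eq_bigr => r _.
by rewrite mcoeff0M mxE mulrA.
Qed.

Lemma gf_augment_diff F (r : 'I_(gf_rank F 1)) : gf_augment (row r (gf_diff F 0)) = 0.
Proof. by apply/gf_exact0; exists (delta_mx 0 r); rewrite rowE. Qed.

Section ChainMap.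
Variables F G : gfree_resolution K n.

(** What the j-th map has to satisfy for the next lift to exist; it is carried along to allow a
    recursive choice. *)
Definition chain_ok j : 'M[S]_(gf_rank F j, gf_rank G j) -> Prop :=
  match j with
  | 0 => fun a => forall r, gf_augment (row r a) = gf_aug r
  | j'.+1 => fun a => (gf_diff F j'.+1 *m a) *m gf_diff G j' = 0
  end.

Definition chain_piece j := {a : 'M[S]_(gf_rank F j, gf_rank G j) | hom_mx (sh F j) (sh G j) a /\ chain_ok a}.

Lemma chain_start : exists a : 'M[S]_(gf_rank F 0, gf_rank G 0), hom_mx (sh F 0) (sh G 0) a /\ chain_ok a.
Proof.
have [r0 a0] := gf_aug_surj G.
exists (\matrix_(r, c) (if c == r0 then (gf_aug r / gf_aug r0)%:MP else 0)); split.
  move=> r c h; rewrite mxE; case: (eqVneq c r0) => [->|_]; last by rewrite mcoeff0 eqxx.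
  rewrite mcoeffC; case: (eqVneq (gf_aug r) 0) => [->|Fr]; first by rewrite !mul0r eqxx.
  case: (eqVneq h 0%MM) => [->|_]; last by rewrite mulr0 eqxx.
  by rewrite mdeg0 (gf_aug_homog a0) (gf_aug_homog Fr).
move=> r; rewrite /gf_augment (bigD1 r0) //= !mxE eqxx mcoeffC eqxx mulr1 divfK // big1 ?addr0 // => c nc.
by rewrite !mxE (negPf nc) mcoeff0 mul0r.
Qed.

Lemma chain_step j (a : chain_piece j) :
  exists b : 'M[S]_(gf_rank F j.+1, gf_rank G j.+1),
  (hom_mx (sh F j.+1) (sh G j.+1) b /\ chain_ok b) /\ b *m gf_diff G j = gf_diff F j *m sval a.
Proof.
case: a => a [ha oka] /=.
have [b hb eb] : exists2 b : 'M[S]_(gf_rank F j.+1, gf_rank G j.+1),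
    hom_mx (sh F j.+1) (sh G j.+1) b & gf_diff F j *m a = b *m gf_diff G j.
  have hda := hom_mxM (@gf_diff_hom F j) ha.
  case: j a ha oka hda => [|j] a ha oka hda; last exact: gf_lift.
  apply: gf_lift0 => // r; rewrite row_mul gf_augment_mul -[RHS](gf_augment_diff r).
  by apply: eq_bigr => i _; rewrite oka.
exists b; split=> //; split=> //=.
by rewrite -mulmxA -eb mulmxA gf_diff_diff mul0mx.
Qed.

Fixpoint chain_map_piece j : chain_piece j :=
  match j with
  | 0 => constructive_indefinite_description _ chain_start
  | j'.+1 => let b := constructive_indefinite_description _ (chain_step (chain_map_piece j')) in
             exist _ (sval b) (proj1 (svalP b))
  end.

Lemma chain_map_exists : exists a : forall j, 'M[S]_(gf_rank F j, gf_rank G j),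
  [/\ forall j, hom_mx (sh F j) (sh G j) (a j), forall r, gf_augment (row r (a 0%N)) = gf_aug r
    & forall j, a j.+1 *m gf_diff G j = gf_diff F j *m a j].
Proof.
exists (fun j => sval (chain_map_piece j)); split=> [j|r|j].
- exact: (proj1 (svalP (chain_map_piece j))).
- exact: (proj2 (svalP (chain_map_piece 0)) r).
exact: (proj2 (svalP (constructive_indefinite_description _ (chain_step (chain_map_piece j))))).
Qed.

End ChainMap.

Section Homotopy.
Variables (F : gfree_resolution K n) (f : forall j, 'M[S]_(gf_rank F j)).
Hypothesis f_hom : forall j, hom_mx (sh F j) (sh F j) (f j).
Hypothesis f_aug : forall r, gf_augment (row r (f 0)) = 0.
Hypothesis f_chain : forall j, f j.+1 *m gf_diff F j = gf_diff F j *m f j.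

(** The second condition makes f_(j+1) - d h_j vanish after the differential, so that the next
    homotopy exists. *)
Definition htpy_piece j := {h : 'M[S]_(gf_rank F j, gf_rank F j.+1) |
  hom_mx (sh F j) (sh F j.+1) h /\ gf_diff F j *m (f j - h *m gf_diff F j) = 0}.

Lemma htpy_start : exists h : 'M[S]_(gf_rank F 0, gf_rank F 1),
  (hom_mx (sh F 0) (sh F 1) h /\ gf_diff F 0 *m (f 0 - h *m gf_diff F 0) = 0) /\ f 0 = h *m gf_diff F 0.
Proof.
have [h hh eh] := gf_lift0 (@f_hom 0) f_aug.
by exists h; split=> //; split=> //; rewrite eh subrr mulmx0.
Qed.

Lemma htpy_step j (h : htpy_piece j) : exists h' : 'M[S]_(gf_rank F j.+1, gf_rank F j.+2),
  (hom_mx (sh F j.+1) (sh F j.+2) h' /\ gf_diff F j.+1 *m (f j.+1 - h' *m gf_diff F j.+1) = 0) /\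
  f j.+1 = h' *m gf_diff F j.+1 + gf_diff F j *m sval h.
Proof.
case: h => h [hh eh] /=.
have H1 : hom_mx (sh F j.+1) (sh F j.+1) (f j.+1 - gf_diff F j *m h).
  exact: (hom_mxD (@f_hom j.+1) (hom_mxN (hom_mxM (@gf_diff_hom F j) hh))).
have H2 : (f j.+1 - gf_diff F j *m h) *m gf_diff F j = 0.
  by rewrite mulmxBl f_chain -eh mulmxBr mulmxA.
have [h' hh' eh'] := gf_lift H1 H2; exists h'.
have e : f j.+1 = h' *m gf_diff F j.+1 + gf_diff F j *m h by rewrite -eh' subrK.
by split=> //; split=> //; rewrite e addrAC subrr add0r mulmxA gf_diff_diff mul0mx.
Qed.

Fixpoint htpy_map_piece j : htpy_piece j :=
  match j with
  | 0 => let b := constructive_indefinite_description _ htpy_start in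
             exist _ (sval b) (proj1 (svalP b))
  | j'.+1 => let b := constructive_indefinite_description _ (htpy_step (htpy_map_piece j')) in
             exist _ (sval b) (proj1 (svalP b))
  end.

Lemma htpy_exists : exists h : forall j, 'M[S]_(gf_rank F j, gf_rank F j.+1),
  [/\ forall j, hom_mx (sh F j) (sh F j.+1) (h j), f 0 = h 0%N *m gf_diff F 0
    & forall j, f j.+1 = h j.+1 *m gf_diff F j.+1 + gf_diff F j *m h j].
Proof.
exists (fun j => sval (htpy_map_piece j)); split=> [j||j].
- exact: (proj1 (svalP (htpy_map_piece j))).
- exact: (proj2 (svalP (constructive_indefinite_description _ htpy_start))).
exact: (proj2 (svalP (constructive_indefinite_description _ (htpy_step (htpy_map_piece j))))).
Qed.

End Homotopy.

Section Tensor.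
Variable M : graded_module K n.

Definition tmul p q (A : 'M[S]_(p, q)) (y : 'I_p -> gm_ambient M) : 'I_q -> gm_ambient M :=
  fun c => \sum_r A r c *: y r.

Lemma tmulM p q r (A : 'M[S]_(p, q)) (B : 'M[S]_(q, r)) y c :
  tmul (A *m B) y c = tmul B (tmul A y) c.
Proof.
rewrite /tmul; under eq_bigr => i _ do rewrite mxE scaler_suml.
rewrite exchange_big; apply: eq_bigr => j _; rewrite scaler_sumr.
by apply: eq_bigr => i _; rewrite scalerA mulrC.
Qed.

Lemma tmulD p q (A B : 'M[S]_(p, q)) y c : tmul (A + B) y c = tmul A y c + tmul B y c.
Proof. by rewrite /tmul -big_split; apply: eq_bigr => i _; rewrite mxE scalerDl. Qed.

Lemma tmul1 p y c : @tmul p p 1%:M y c = y c.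
Proof.
rewrite /tmul (bigD1 c) //= mxE eqxx scale1r big1 ?addr0 // => i ni.
by rewrite mxE (negPf ni) scale0r.
Qed.

Lemma eq_tmul p q (A : 'M[S]_(p, q)) y z c : y =1 z -> tmul A y c = tmul A z c.
Proof. by move=> e; apply: eq_bigr => i _; rewrite e. Qed.

Lemma tmul_eq0 p q (A : 'M[S]_(p, q)) y c : (forall r, y r = 0) -> tmul A y c = 0.
Proof. by move=> y0; apply: big1 => i _; rewrite y0 scaler0. Qed.

Definition tpiece p (s : 'I_p -> nat) d (x : 'I_p -> gm_ambient M) :=
  forall r, if (s r <= d)%N then gm_piece (d - s r) (x r) else x r = 0.

Lemma tpieceD p (s : 'I_p -> nat) d x y : tpiece s d x -> tpiece s d y ->
  tpiece s d (fun r => x r + y r).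
Proof.
move=> hx hy r; have := hx r; have := hy r; case: ifP => _ h1 h2; first exact: gm_pieceD.
by rewrite h1 h2 addr0.
Qed.

Lemma tpiece_tmul p q s t (A : 'M[S]_(p, q)) d x : hom_mx s t A -> tpiece s d x -> tpiece t d (tmul A x).
Proof.
move=> hA hx c; have H r : if (t c <= d)%N then gm_piece (d - t c) (A r c *: x r) else A r c *: x r = 0.
  case: (eqVneq (A r c) 0) => [->|nA].
    by rewrite scale0r; case: ifP => // _; apply: gm_piece0.
  have tsr : (t c <= s r)%N.
    have [h nh] : exists h, (A r c)@_h != 0.
      by exists (mlead (A r c)); rewrite mleadc_eq0.
    by rewrite -(hA _ _ _ nh) leq_addl.
  have := hx r; case: (leqP (s r) d) => srd; last by move=> ->; rewrite scaler0; case: ifP => // _; apply: gm_piece0.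
  rewrite (leq_trans tsr srd) => hxr.
  have -> : (d - t c = (s r - t c) + (d - s r))%N by lia.
  apply: gm_pieceZ hxr; apply/dhomogP => h; rewrite mcoeff_msupp => /hA; rewrite /= => e.
  by rewrite -e addnK.
case: ifP H => _ H; last by apply: big1 => r _; rewrite H.
by rewrite /tmul; elim/big_rec: _ => [|r y _ hy]; [apply: gm_piece0|apply: gm_pieceD].
Qed.

End Tensor.

(** For comparison maps a : F -> G and b : G -> F, the difference of the identity and their
    composite on F is null-homotopic. If the image of x is the boundary of z, then x is the boundary
    of the image of z plus the homotopy applied to x. *)
Theorem tensor_homology_transfer F G M i d :
  tensor_homology_eq0 G M i d -> tensor_homology_eq0 F M i d.
Proof.
move=> HG x hx cx.
have [a [ha aa ca]] := chain_map_exists F G.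
have [b [hb ab cb]] := chain_map_exists G F.
pose f j : 'M[S]_(gf_rank F j) := 1%:M - a j *m b j.
have fh j : hom_mx (sh F j) (sh F j) (f j).
  exact: (hom_mxD (@hom_mx1 _ _) (hom_mxN (hom_mxM (ha j) (hb j)))).
have f_chain j : f j.+1 *m gf_diff F j = gf_diff F j *m f j.
  by rewrite mulmxBl mulmxBr mul1mx mulmx1 -mulmxA cb mulmxA ca mulmxA.
have f_aug r : gf_augment (row r (f 0%N)) = 0.
  have E (y z : 'rV[S]_(gf_rank F 0)) : gf_augment (y - z) = gf_augment y - gf_augment z.
    by rewrite /gf_augment -sumrB; apply: eq_bigr => k _; rewrite !mxE mcoeffB mulrBl.
  rewrite raddfB /= E row_mul gf_augment_mul.
  under [X in _ - X]eq_bigr => k _ do rewrite ab.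
  rewrite -/(gf_augment (row r (a 0%N))) aa /gf_augment (bigD1 r) //= !mxE eqxx mcoeff1 eqxx mul1r.
  by rewrite big1 ?addr0 ?subrr // => k nk; rewrite !mxE eq_sym (negPf nk) mcoeff0 mul0r.
have [h [hh h0 hS]] := htpy_exists fh f_aug f_chain.
have cy : tensor_cycle (F := G) (M := M) (i := i) (tmul (a i) x).
  case: i x hx cx {HG} => [//|i] x hx cx c.
  rewrite -[LHS]/(tmul (gf_diff G i) (tmul (a i.+1) x) c) -tmulM ca tmulM.
  exact: tmul_eq0.
have [z [hz ez]] := HG _ (tpiece_tmul (ha i) hx) cy.
exists (fun r => tmul (b i.+1) z r + tmul (h i) x r); split.
  by apply: tpieceD; [apply: tpiece_tmul (hb _) hz|apply: tpiece_tmul (hh _) hx].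
move=> c; rewrite /tensor_diff.
under eq_bigr => r _ do rewrite scalerDr.
rewrite big_split -/(tmul (gf_diff F i) (tmul (b i.+1) z) c) -/(tmul (gf_diff F i) (tmul (h i) x) c) /=.
rewrite -!tmulM cb tmulM -(eq_tmul (b i) c ez) -tmulM -[LHS]tmul1.
have -> : 1%:M = a i *m b i + f i by rewrite addrC subrK.
rewrite tmulD; congr (_ + _).
case: i x hx cx {HG cy z hz ez} c => [|i] x hx cx c; first by rewrite h0.
by rewrite hS tmulD [X in _ + X]tmulM (tmul_eq0 _ _ cx) addr0.
Qed.

End Resolutions.

(** * The Koszul resolution *)

Lemma contr_sqr (R : comNzRingType) n (u : 'I_n -> R) (z : ext R n) : contr u (contr u z) = 0.
Proof.
apply/ffunP=> A; rewrite !ffunE.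
pose F a b := if (a \notin A) && (b \notin A) && (a != b) then
   esgn R a A * esgn R b (a |: A) * u a * u b * z (b |: (a |: A)) else 0.
transitivity (\sum_a \sum_b F a b).
  rewrite big_mkcond; apply: eq_bigr => a _; rewrite /F.
  case aA: (a \notin A) => /=; last by rewrite big1.
  rewrite ffunE mulr_sumr big_mkcond; apply: eq_bigr => b _.
  rewrite !inE negb_or [b == a]eq_sym andbC; case: ifP => // _; ring.
apply: sum_antisym => [a b|a]; rewrite /F; last by rewrite eqxx andbF.
rewrite [b == a]eq_sym [(b \notin A) && _]andbC; case: ifP => [/andP[/andP[aA bA] ab]|]; last by rewrite oppr0.
rewrite (esgnU R a bA) (esgnU R b aA) signr_lt // setUCA; ring.
Qed.

Section Koszul.
Variables (K : fieldType) (n : nat).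
Local Notation S := {mpoly K[n]}.
Local Notation X := (fun a : 'I_n => 'X_a : S).
Implicit Types (z y : ext S n) (A B : {set 'I_n}) (h d : 'X_{1..n}).

Definition set_mnm A : 'X_{1..n} := [multinom (a \in A : nat) | a < n].
Definition mpos d : {set 'I_n} := [set a | d a != 0%N].

Lemma esgnC a A : esgn S a A = (esgn K a A)%:MP.
Proof. by rewrite /esgn rmorph_sign. Qed.

(** The part of multidegree d, where e_a has the degree of X_a. Subtraction of exponents is
    truncated, hence the test on [A]. *)
Definition slice d z : ext K n :=
  [ffun A : {set 'I_n} => (if A \subset mpos d then (z A)@_(d - set_mnm A) else 0 : K^o)].

Definition supp_vec d : 'I_n -> K := fun a => (a \in mpos d)%:R.

(** In a fixed multidegree the monomial is determined by [A], so the differential becomes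
    contraction with a constant vector, the indicator of the support of d. *)
Lemma slice_contr d z : slice d (contr X z) = contr (supp_vec d) (slice d z).
Proof.
apply/ffunP => A; rewrite !ffunE; case: ifP => Ad; last first.
  rewrite big1 // => a aA; rewrite ffunE subUset Ad andbF mulr0 //.
rewrite raddf_sum /=; apply: eq_bigr => a aA; rewrite esgnC -mulrA mcoeffCM -mulrA; congr (_ * _).
rewrite ffunE subUset Ad andbT sub1set /supp_vec; case: (boolP (a \in mpos d)) => ad; last first.
  by rewrite mul0r mcoeffXM_eq0 // mnmBE; move: ad; rewrite inE negbK => /eqP ->.
rewrite mul1r; have -> : (d - set_mnm A)%MM = (U_(a) + (d - set_mnm (a |: A)))%MM.
  apply/mnmP => b; rewrite mnmDE !mnmBE mnm1E !mnmE !inE; move: ad aA; rewrite inE.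
  by case: (eqVneq a b) => [<-|nab]; [move=> + /negPf ->; rewrite ?eqxx /=; lia|rewrite ?[b == a]eq_sym ?(negPf nab)].
by rewrite mulrC mcoeffMX.
Qed.

Definition unit_vec v : 'I_n -> K := fun a => (a == v)%:R.

(** For d <> 0, multiplication by e_v with v in the support of d is a contracting homotopy without
    denominators. *)
Definition slice_htpy d z : ext K n :=
  if [pick v in mpos d] is Some v then wedge (unit_vec v) (slice d z) else 0.

(** The homotopy lowers polynomial degrees, so the sizes of the coefficients of z bound the
    monomials needed. *)
Definition koszul_htpy z : ext S n := [ffun B : {set 'I_n} =>
  \sum_(h : 'X_{1..n < \max_(A : {set 'I_n}) msize (z A)}) slice_htpy (h + set_mnm B)%MM z B *: 'X_[h]].

Lemma slice_htpy_supp d z B : ~~ (B \subset mpos d) -> slice_htpy d z B = 0.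
Proof.
rewrite /slice_htpy; case: pickP => [v vd|_]; last by rewrite ffunE.
move=> Bd; rewrite ffunE big1 // => a aB; rewrite ffunE /unit_vec.
case: eqP => [->|_]; last by rewrite mulr0 mul0r.
case: ifP => [H|_]; last by rewrite mulr0.
case/negP: Bd; apply/subsetP => b bB; case: (eqVneq b v) => [->//|nb].
by move/subsetP: H; apply; rewrite !inE nb.
Qed.

Lemma mcoeff_koszul_htpy z B h : (koszul_htpy z B)@_h = slice_htpy (h + set_mnm B)%MM z B.
Proof.
rewrite ffunE; set k := \max_(A : _) _.
case: (ltnP (mdeg h) k) => hk; first by rewrite (mcoeff_mpoly (fun h => slice_htpy (h + set_mnm B)%MM z B)).
transitivity (0 : K).
  rewrite raddf_sum big1 //= => h' _; rewrite mcoeffZ mcoeffX; case: eqP => [e|_]; last by rewrite mulr0.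
  by have := bmdeg h'; rewrite e ltnNge hk.
rewrite /slice_htpy; case: pickP => [v vd|_]; last by rewrite ffunE.
rewrite ffunE big1 // => a aB; rewrite ffunE /unit_vec; case: eqP => [ea|_]; last by rewrite mulr0 mul0r.
case: ifP => _; last by rewrite mulr0.
rewrite (@memN_msupp_eq0 _ _ (z (B :\ a))) ?mulr0 //; apply: msize_mdeg_ge.
apply: leq_trans (@leq_bigmax _ (fun A : {set 'I_n} => msize (z A)) (B :\ a)) _; apply: leq_trans hk _.
have -> : (h + set_mnm B - set_mnm (B :\ a))%MM = (h + U_(a))%MM.
  apply/mnmP => b; rewrite mnmBE !mnmDE mnm1E !mnmE !inE [a == b]eq_sym.
  by case: (eqVneq b a) => [->|_]; rewrite ?aB /= ?addn0 ?addnK ?subn0.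
by rewrite mdegD leq_addr.
Qed.

Lemma slice_koszul_htpy d z : slice d (koszul_htpy z) = slice_htpy d z.
Proof.
apply/ffunP => B; rewrite ffunE; case: (boolP (B \subset mpos d)) => Bd; last first.
  by rewrite slice_htpy_supp.
rewrite mcoeff_koszul_htpy; congr (slice_htpy _ z B); apply/mnmP => a.
rewrite mnmDE mnmBE !mnmE subnK //; case aB: (a \in B) => //.
by move/subsetP: Bd => /(_ _ aB); rewrite inE; lia.
Qed.

(** In multidegree d <> 0, e_v pairs to 1 with the indicator of the support. In multidegree 0 only
    the constant coefficient is left, and it vanishes by assumption. *)
Theorem koszul_exact z : contr X z = 0 -> (z set0)@_0%MM = 0 -> contr X (koszul_htpy z) = z.
Proof.
move=> cz z0; apply/ffunP => A; apply/mpolyP => h.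
pose d := (h + set_mnm A)%MM.
have Ad : A \subset mpos d.
  by apply/subsetP => a aA; rewrite inE mnmDE !mnmE aA; lia.
have dA : (d - set_mnm A)%MM = h by apply/mnmP => a; rewrite mnmBE mnmDE addnK.
have E y : (y A)@_h = slice d y A by rewrite ffunE Ad dA.
rewrite !E slice_contr slice_koszul_htpy /slice_htpy; case: pickP => [v vd|nd].
  rewrite contr_wedge -slice_contr cz.
  have -> : slice d 0 = 0 by apply/ffunP => B; rewrite !ffunE mcoeff0 if_same.
  rewrite raddf0 subr0 (bigD1 v) //= big1 ?addr0.
    by rewrite /supp_vec vd /unit_vec eqxx mulr1 scale1r.
  by move=> a /negPf nv; rewrite /unit_vec nv mulr0.
have d0 : d = 0%MM.
  by apply/mnmP => a; rewrite mnm0E; have := nd a; rewrite inE; case: (d a).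
have A0 : A = set0 by apply/setP => a; rewrite inE; apply/negP => /(subsetP Ad); rewrite nd.
rewrite raddf0 [LHS]ffunE [RHS]ffunE A0 sub0set d0.
suff -> : (0 - set_mnm set0 = 0 :> 'X_{1..n})%MM by rewrite z0.
by apply/mnmP => a; rewrite mnmBE mnm0E.
Qed.

Definition ksets i : {set {set 'I_n}} := [set A : {set 'I_n} | #|A| == i].
Definition kset i (r : 'I_#|ksets i|) : {set 'I_n} := enum_val r.

Lemma card_kset i (r : 'I_#|ksets i|) : #|kset r| = i.
Proof. by have := enum_valP r; rewrite inE => /eqP. Qed.

Lemma kset_surj i A : #|A| = i -> exists r : 'I_#|ksets i|, kset r = A.
Proof.
move=> cA; have iA : A \in ksets i by rewrite inE cA.
by exists (enum_rank_in iA A); rewrite /kset enum_rankK_in.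
Qed.

Definition koszul_diff i : 'M[S]_(#|ksets i.+1|, #|ksets i|) :=
  \matrix_(r, c) \sum_(a | (a \notin kset c) && (kset r == a |: kset c)) esgn S a (kset c) * 'X_a.

Definition row_ext i (x : 'rV[S]_#|ksets i|) : ext S n := [ffun A : {set 'I_n} => (\sum_(r | kset r == A) x 0 r : S^o)].

Lemma kset_inj i : injective (@kset i). Proof. exact: enum_val_inj. Qed.

Lemma row_extE i (x : 'rV[S]_#|ksets i|) r : row_ext x (kset r) = x 0 r.
Proof. by rewrite ffunE (big_pred1 r) // => c; rewrite /= (inj_eq (@kset_inj i)). Qed.

Lemma extdeg_row_ext i (x : 'rV[S]_#|ksets i|) : extdeg i (row_ext x).
Proof.
by move=> A nA; rewrite ffunE big_pred0 // => r; apply/eqP => e; rewrite -e card_kset eqxx in nA.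
Qed.

Lemma extdeg_contr_row i (x : 'rV[S]_#|ksets i.+1|) : extdeg i (contr X (row_ext x)).
Proof. by apply: extdeg_contr; apply: extdeg_row_ext. Qed.

Lemma koszul_diffE i (x : 'rV[S]_#|ksets i.+1|) c :
  (x *m koszul_diff i) 0 c = contr X (row_ext x) (kset c).
Proof.
rewrite !mxE ffunE; under eq_bigr => r _ do rewrite mxE mulr_sumr.
rewrite (exchange_big_dep [pred a | a \notin kset c]) /=; last by move=> r a _ /andP[].
apply: eq_bigr => a ac; rewrite ffunE mulr_sumr.
by apply: eq_big => [r|r _]; [rewrite ac|rewrite mulrC].
Qed.

Lemma koszul_diff_eq0 i (x : 'rV[S]_#|ksets i.+1|) :
  x *m koszul_diff i = 0 <-> contr X (row_ext x) = 0.
Proof.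
split=> H; last by apply/rowP => c; rewrite koszul_diffE H !mxE ffunE.
apply/ffunP => A; rewrite [RHS]ffunE; case: (eqVneq #|A| i) => [/kset_surj[c <-]|nA].
  by rewrite -koszul_diffE H mxE.
exact: (extdeg_contr_row x).
Qed.

Lemma row_ext_mul i (x : 'rV[S]_#|ksets i.+1|) : row_ext (x *m koszul_diff i) = contr X (row_ext x).
Proof.
apply/ffunP => A; case: (eqVneq #|A| i) => [/kset_surj[c <-]|nA].
  by rewrite row_extE koszul_diffE.
by rewrite (extdeg_row_ext _ nA) (extdeg_contr_row x nA).
Qed.

Lemma koszul_preimage i (x : 'rV[S]_#|ksets i|) : contr X (row_ext x) = 0 ->
  (row_ext x set0)@_0%MM = 0 -> exists y : 'rV[S]_#|ksets i.+1|, x = y *m koszul_diff i.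
Proof.
move=> cx x0; pose y := koszul_htpy (row_ext x); exists (\row_r y (kset r)).
apply/rowP => c; rewrite koszul_diffE -row_extE -{1}(koszul_exact cx x0) !ffunE.
apply: eq_bigr => a ac; congr (_ * _).
have [r er] : exists r : 'I_#|ksets i.+1|, kset r = a |: kset c.
  by apply: kset_surj; rewrite cardsU1 ac card_kset.
by rewrite -er row_extE mxE.
Qed.

Lemma koszul_diff_homog i r c h : (koszul_diff i r c)@_h != 0 -> (mdeg h + i = i.+1)%N.
Proof.
move=> H; suff /dhomogP /(_ h) : koszul_diff i r c \is 1.-homog.
  by rewrite mcoeff_msupp /= => /(_ H) ->.
rewrite mxE; apply: rpred_sum => a _; rewrite esgnC mul_mpolyC rpredZ //.
by rewrite dhomogX /= mdeg1.
Qed.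

Lemma kset0 (r : 'I_#|ksets 0|) : kset r = set0.
Proof. by apply/eqP; rewrite -cards_eq0 card_kset. Qed.

Lemma koszul_aug_surj : exists r : 'I_#|ksets 0|, (1 : K) != 0.
Proof. by have [r _] := @kset_surj 0 set0 (cards0 _); exists r; apply: oner_neq0. Qed.

Lemma koszul_exact0 (x : 'rV[S]_#|ksets 0|) :
  \sum_r (x 0 r)@_0%MM * 1 = 0 <-> exists y : 'rV[S]_#|ksets 1|, x = y *m koszul_diff 0.
Proof.
have E : \sum_r (x 0 r)@_0%MM * 1 = (row_ext x set0)@_0%MM.
  rewrite ffunE raddf_sum /=; apply: eq_big => [r|r _]; last by rewrite mulr1.
  by rewrite kset0 eqxx.
rewrite E; split=> [x0|[y ->]].
  by apply: koszul_preimage x0; apply: contr_extdeg0; apply: extdeg_row_ext.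
rewrite row_ext_mul ffunE raddf_sum big1 //= => a _.
by rewrite esgnC -mulrA mcoeffCM mcoeffXM_eq0 ?mulr0 // mnm0E.
Qed.

Lemma koszul_exactS i (x : 'rV[S]_#|ksets i.+1|) :
  x *m koszul_diff i = 0 <-> exists y : 'rV[S]_#|ksets i.+2|, x = y *m koszul_diff i.+1.
Proof.
rewrite koszul_diff_eq0; split=> [H|[y ->]]; last by rewrite row_ext_mul contr_sqr.
by apply: koszul_preimage => //; rewrite (extdeg_row_ext x) ?cards0 // mcoeff0.
Qed.

Definition koszul_resolution : gfree_resolution K n :=
  @GFreeResolution K n (fun i => #|ksets i|) (fun i _ => i) koszul_diff (fun=> 1)
    koszul_diff_homog (fun _ _ => erefl) koszul_aug_surj koszul_exact0 koszul_exactS.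

End Koszul.

(** * Sections of O(1) on the tangential variety *)

Section Sections.
Variables (K : fieldType) (g : nat).
Local Notation S := {mpoly K[g.+1]}.
Local Notation B := {mpoly K[3]}.
Local Notation Q := (tangent_frac K g).
Local Notation t := ('X_0 : B).
Local Notation u := ('X_1 : B).
Local Notation v := ('X_2 : B).
Local Notation i0 := (0%R : 'I_3).
Local Notation i1 := (1%R : 'I_3).
Local Notation i2 := (2%R : 'I_3).
Local Notation z := (@tangent_coord K g).
Local Notation tofrac := (@FracField.tofrac B).

Definition tmap : {rmorphism S -> B} := comp_mpoly [tuple z i | i < g.+1].

Lemma tmapX i : tmap 'X_i = z i.
Proof. by rewrite /tmap /= comp_mpolyXU -tnth_nth tnth_mktuple. Qed.

Lemma tmapC c : tmap c%:MP = c%:MP.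
Proof. exact: comp_mpolyC. Qed.

Lemma tmap_ind (P : B -> Prop) :
  (forall c, P c%:MP) -> (forall b c, P b -> P c -> P (b + c)) -> (forall b c, P b -> P c -> P (b * c)) ->
  (forall i, P (z i)) -> forall p, P (tmap p).
Proof.
move=> PC PD PM Pz p; rewrite (mpolyE p) rmorph_sum /=.
elim/big_ind: _ => // [|h _]; first by rewrite -mpolyC0.
rewrite -mul_mpolyC rmorphM; apply: (PM (tmap _) (tmap _)); first by rewrite tmapC.
rewrite mpolyXE_id rmorph_prod; elim/big_ind: _ => // [|i _]; first by rewrite -mpolyC1.
rewrite rmorphXn; elim: (h i) => [|k IH]; first by rewrite expr0 -mpolyC1.
by rewrite exprS; apply: (PM (tmap 'X_i)) => //; rewrite tmapX.
Qed.

Lemma tmap_homog_ind (P : nat -> B -> Prop) :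
  (forall d, P d 0) -> P 0%N 1 -> (forall c d b, P d b -> P d (c%:MP * b)) ->
  (forall d b c, P d b -> P d c -> P d (b + c)) ->
  (forall d e b c, P d b -> P e c -> P (d + e)%N (b * c)) ->
  (forall i, P 1%N (z i)) -> forall d p, p \is d.-homog -> P d (tmap p).
Proof.
move=> P0 P1 PC PD PM Pz d p hp; rewrite (mpolyE p) rmorph_sum /= big_seq.
elim/big_ind: _ => // [|h hh]; first exact: PD.
rewrite -mul_mpolyC rmorphM; have -> : tmap (p@_h)%:MP = (p@_h)%:MP by exact: tmapC.
apply: PC; have -> : d = mdeg h by move/dhomogP: hp => /(_ _ hh).
rewrite mpolyXE_id rmorph_prod mdegE; elim/big_ind2: _ => // [d1 b1 d2 b2|i _]; first exact: PM.
rewrite rmorphXn; elim: (h i) => [|k IH]; first by rewrite expr0.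
by rewrite exprS -add1n; apply: PM IH; rewrite [X in P _ X]tmapX.
Qed.

Definition uvdeg (d : nat) (b : B) := forall h, b@_h != 0 -> (h i1 + h i2 = d)%N.

Lemma uvdegM d e b c : uvdeg d b -> uvdeg e c -> uvdeg (d + e) (b * c).
Proof.
move=> hb hc h; apply: contra_neq_eq => hd; rewrite mcoeffM big1 // => -[h1 h2] /= /eqP eh.
case: (eqVneq b@_h1 0) => [->|/hb e1]; first by rewrite mul0r.
case: (eqVneq c@_h2 0) => [->|/hc e2]; first by rewrite mulr0.
by case/eqP: hd; rewrite eh !mnmDE -e1 -e2; lia.
Qed.

Lemma uvdegD d b c : uvdeg d b -> uvdeg d c -> uvdeg d (b + c).
Proof.
move=> hb hc h; rewrite mcoeffD; case: (eqVneq b@_h 0) => [->|/hb //].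
by rewrite add0r; apply: hc.
Qed.

Lemma uvdegC c d b : uvdeg d b -> uvdeg d (c%:MP * b).
Proof. by move=> hb h; rewrite mcoeffCM mulf_eq0 negb_or => /andP[_ /hb]. Qed.

Lemma uvdeg0 d : uvdeg d 0.
Proof. by move=> h; rewrite mcoeff0 eqxx. Qed.

Lemma uvdeg1 : uvdeg 0 1.
Proof. by move=> h; rewrite mcoeff1; case: (eqVneq h 0%MM) => [->|_]; rewrite ?mnm0E ?eqxx. Qed.

Lemma uvdegX i : uvdeg ((i == i1) + (i == i2)) 'X_i.
Proof.
move=> h; rewrite mcoeffX; case: (eqVneq U_(i)%MM h) => [<-|_]; last by rewrite eqxx.
by rewrite !mnm1E.
Qed.

Lemma uvdeg_tX k d b : uvdeg d b -> uvdeg d (b * t ^+ k).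
Proof.
move=> hb; elim: k => [|k IH]; first by rewrite expr0 mulr1.
by rewrite exprSr mulrA -[d]addn0; apply: (@uvdegM _ 0%N) IH _; exact: (@uvdegX i0).
Qed.

Lemma uvdeg_coord i : uvdeg 1 (z i).
Proof.
apply: uvdegD; apply: uvdeg_tX; first exact: uvdegX.
by rewrite -mpolyC_nat; apply: uvdegC; exact: uvdegX.
Qed.

Lemma uvdeg_tmap d p : p \is d.-homog -> uvdeg d (tmap p).
Proof.
apply: tmap_homog_ind.
- exact: uvdeg0.
- exact: uvdeg1.
- by move=> *; apply: uvdegC.
- by move=> *; apply: uvdegD.
- by move=> *; apply: uvdegM.
- exact: uvdeg_coord.
Qed.

(** At (u, v) = (1, 0) this is the restriction to the rational normal curve. *)
Definition psi (u0 v0 : K) : {rmorphism B -> {poly K}} :=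
  mmap (@polyC K) (fun j : 'I_3 => if j == 0 then 'X else if j == 1 then u0%:P else v0%:P).

Lemma psiC u0 v0 c : psi u0 v0 c%:MP = c%:P.
Proof. exact: mmapC. Qed.

Lemma psiX u0 v0 j : psi u0 v0 'X_j = if j == 0 then 'X else if j == 1 then u0%:P else v0%:P.
Proof. by rewrite /psi /= mmapX mmap1U. Qed.

Lemma psi_coord u0 v0 i : psi u0 v0 (z i) = u0%:P * 'X^i + i%:R * v0%:P * 'X^(i.-1).
Proof.
by rewrite /tangent_coord rmorphD !rmorphM !rmorphXn rmorph_nat !psiX.
Qed.

Lemma psi_coord10 i : psi 1 0 (z i) = 'X^i.
Proof. by rewrite psi_coord mulr0 mul0r addr0 mul1r. Qed.

(* Infinitesimally, [z_i] is [(t + v)^i] at [u = 1]; this persists for all polynomials in the [z_i]. *)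
Definition osculating (b : B) := psi 1 0 (b^`M(2)) = (psi 1 0 b)^`().

Lemma osculating_tmap p : osculating (tmap p).
Proof.
apply: tmap_ind => [c|b c|b c|i]; rewrite /osculating.
- by rewrite mderivC rmorph0 psiC derivC.
- by rewrite mderivD !rmorphD derivD => -> ->.
- by rewrite mderivM rmorphD !rmorphM derivM => -> ->.
rewrite psi_coord10 derivXn /tangent_coord mderivD !mderivM.
have D k : (t ^+ k)^`M(2) = 0.
  elim: k => [|k IH]; first by rewrite expr0 -mpolyC1 mderivC.
  by rewrite exprS mderivM IH mulr0 addr0 mderivX mnm1E scale0r mul0r.
rewrite !D !mulr0 !addr0 !(mderivX, mnm1E) scale0r mul0r add0r -mpolyC_nat mderivC mul0r add0r /=.
have -> : (U_(2) - U_(2) = 0 :> 'X_{1..3})%MM by apply/mnmP => j; rewrite mnmBE mnm0E subnn.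
by rewrite scale1r mpolyX0 mulr1 mpolyC_nat rmorphM rmorphXn rmorph_nat psiX mulr_natl.
Qed.

Lemma size_psi_tmap d p : p \is d.-homog -> (size (psi 1 0 (tmap p)) <= (g * d).+1)%N.
Proof.
apply: (@tmap_homog_ind (fun d b => size (psi 1 0 b) <= (g * d).+1)%N) => {d p}.
- by move=> d; rewrite rmorph0 size_poly0.
- by rewrite rmorph1 size_poly1.
- move=> c d b hb; rewrite rmorphM psiC mul_polyC; exact: leq_trans (size_scale_leq _ _) hb.
- by move=> d b c hb hc; rewrite rmorphD; apply: leq_trans (size_polyD _ _) _; rewrite geq_max hb.
- move=> d e b c hb hc; rewrite rmorphM; apply: leq_trans (size_polyMleq _ _) _.
  by move: hb hc; set x := size _; set y := size _; lia.
by move=> i; rewrite psi_coord10 size_polyXn muln1 ltn_ord.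
Qed.

Definition mon3 (a b c : nat) : 'X_{1..3} := [multinom nth 0%N [:: a; b; c] i | i < 3].

Lemma mon3E (h : 'X_{1..3}) : h = mon3 (h i0) (h i1) (h i2).
Proof.
apply/mnmP => -[i hi]; rewrite mnmE /=.
by case: i hi => [|[|[|]]] //= hi; congr (h _); apply: val_inj.
Qed.

Lemma coef_psi d b k : uvdeg d b -> (psi 1 0 b)`_k = b@_(mon3 k d 0).
Proof.
move=> hb; rewrite [in LHS](mpolyE b) rmorph_sum coef_sum.
have E h : (psi 1 0 (b@_h *: 'X_[h]))`_k = b@_h * ((h i0 == k) && (h i2 == 0%N))%:R.
  rewrite -mul_mpolyC rmorphM psiC coefCM mpolyXE_id rmorph_prod; congr (_ * _).
  under eq_bigr => j _ do rewrite rmorphXn psiX.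
  rewrite !big_ord_recl big_ord0 /= expr1n mul1r mulr1.
  have -> : lift ord0 (lift ord0 ord0) = i2 by apply: val_inj.
  have -> : ord0 = i0 by [].
  rewrite polyC0 expr0n -polyC_natr coefMC coefXn -natrM mulnb eq_sym.
  by [].
under eq_bigr => h _ do rewrite E.
have F h : h \in msupp b -> (h i0 == k) && (h i2 == 0%N) = (h == mon3 k d 0).
  rewrite mcoeff_msupp => /hb hd; rewrite {3}(mon3E h); apply/andP/eqP => [[/eqP -> /eqP e2]|/mnmP e].
    by move: hd; rewrite e2 addn0 => ->.
  by have := e i0; have := e i2; rewrite !mnmE /= => -> ->.
rewrite (eq_big_seq (fun h => b@_h * (h == mon3 k d 0)%:R)); last by move=> h /F ->.
case: (boolP (mon3 k d 0 \in msupp b)) => H.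
  rewrite (bigD1_seq _ H) ?msupp_uniq //= eqxx mulr1 big1 ?addr0 // => h /negPf ->.
  by rewrite mulr0.
rewrite (memN_msupp_eq0 H) big1_seq // => h /andP[_ hh].
by case: eqP => [e|_]; [rewrite -e hh in H|rewrite mulr0].
Qed.

Lemma uvdeg_deriv b : uvdeg 1 b -> uvdeg 0 b^`M(i2).
Proof.
move=> hb h; rewrite mcoeff_deriv => H.
have : b@_(h + U_(i2)) != 0 by apply: contraNneq H => ->; rewrite mul0rn.
by move/hb; rewrite !mnmDE !mnm1E /=; lia.
Qed.

(** An element of degree 1 in u and v is u P(t) + v Q(t), and the osculating condition says Q = P';
    so P determines it. *)
Lemma uvdeg1_inj b c : uvdeg 1 b -> uvdeg 1 c -> osculating b -> osculating c ->
  psi 1 0 b = psi 1 0 c -> b = c.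
Proof.
move=> hb hc ob oc e; apply/mpolyP => h.
case: (eqVneq (h i1 + h i2)%N 1%N) => [hd|hd]; last first.
  have [-> //] : b@_h = 0 /\ c@_h = 0.
  by split; apply/eqP; move: hd; [apply: contraNT => /hb ->|apply: contraNT => /hc ->].
rewrite (mon3E h); move: hd; case: (h i1) => [|[|]] //; case: (h i2) => [|[|]] // _.
  have := congr1 (fun p : {poly K} => p^`()`_(h i0)) e.
  rewrite -ob -oc !(coef_psi _ (uvdeg_deriv _)) // !mcoeff_deriv.
  have -> : (mon3 (h i0) 0 0 + U_(i2) = mon3 (h i0) 0 1)%MM.
    by apply/mnmP => -[[|[|[|]]] // hi]; rewrite mnmDE mnm1E !mnmE /= ?addn0.
  by rewrite mnmE /= !mulr1n.
by have := congr1 (fun p : {poly K} => p`_(h i0)) e; rewrite !(coef_psi _ hb) !(coef_psi _ hc).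
Qed.

Hypothesis g_gt0 : (0 < g)%N.

Lemma coord0 : z ord0 = u.
Proof. by rewrite /tangent_coord /= expr0 mulr1 !mul0r addr0. Qed.

Lemma var_factor (j : 'I_3) (b : B) : subst_var j 0 b = 0 -> exists c, b = 'X_j * c.
Proof. by move=> H; have [c] := subst_var_dvd j 0 b; rewrite H !subr0 => ->; exists c. Qed.

Lemma var_neq0 (j : 'I_3) : ('X_j : B) != 0.
Proof. by apply/eqP => /(congr1 (mcoeff U_(j)))/eqP; rewrite mcoeffXU eqxx mcoeff0 oner_eq0. Qed.

(** Modulo u, z_1 becomes v, which is nonzero in a domain; so the powers of u split off one by
    one. *)
Lemma coord1_coprime N N' (p q : B) : u ^+ N * q = z (inord 1) ^+ N' * p -> exists b, p = u ^+ N * b.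
Proof.
have sz : subst_var i1 0 (z (inord 1)) = v.
  rewrite /tangent_coord inordK // /= expr0 expr1 mulr1 mul1r rmorphD rmorphM !subst_varX /=.
  by rewrite mul0r add0r.
elim: N p => [|N IH] p; first by exists p; rewrite expr0 mul1r.
rewrite exprS -mulrA => e.
have : subst_var i1 0 p = 0.
  have := congr1 (subst_var i1 0) e; rewrite rmorphM subst_varX /= mul0r rmorphM rmorphXn sz => /esym/eqP.
  by rewrite mulf_eq0 expf_eq0 (negPf (var_neq0 _)) andbF => /eqP.
case/var_factor => c ec; move: e; rewrite ec [RHS]mulrCA => /(mulfI (var_neq0 i1)) e.
by have [b ->] := IH _ e; exists b; rewrite ?mulrA.
Qed.

Lemma tofrac_inj : injective tofrac.
Proof.
move=> b c e; apply/eqP; rewrite -subr_eq0 -(@tofrac_eq0 B) tofracB e subrr //.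
Qed.

Lemma tangent_section_integral d (s : Q) : tangent_section d s ->
  exists b, s = tofrac b /\ forall i, exists N p, p \is (d + N).-homog /\ z i ^+ N * b = tmap p.
Proof.
move=> hs; have [N [p [hp ep]]] := hs ord0; have [N' [p' [hp' ep']]] := hs (inord 1).
have E i k : ('X_i ^+ k : S) *: s = tofrac (z i ^+ k) * s.
  by rewrite -tmapX -rmorphXn.
rewrite E in ep; rewrite E in ep'.
have [b eb] : exists b, tmap p = u ^+ N * b.
  apply: (@coord1_coprime N N' (tmap p) (tmap p')); apply: tofrac_inj.
  rewrite !tofracM -[tofrac (tmap p)]ep -[tofrac (tmap p')]ep' coord0.
  by rewrite mulrCA.
have es : s = tofrac b.
  have n0 : tofrac (z ord0 ^+ N) != 0 by rewrite tofrac_eq0 coord0 expf_neq0 ?var_neq0.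
  by apply: (mulfI n0); rewrite ep -[tangent_map p]/(tmap p) eb coord0 tofracM.
exists b; split=> // i; have [k [q [hq eq]]] := hs i.
by exists k, q; split=> //; apply: tofrac_inj; rewrite tofracM -es -E eq.
Qed.

(** Division by u^N respects the degree and the osculating condition, since u is free of v and
    becomes 1 at (1, 0). The degree bound in t comes from the chart of z_g, where z_g^N becomes
    'X^(g N). *)
Lemma tangent_section_form d (s : Q) : tangent_section d s ->
  exists b, [/\ s = tofrac b, uvdeg d b, osculating b & (size (psi 1 0 b) <= (g * d).+1)%N].
Proof.
case/tangent_section_integral => b [es hb]; exists b.
have [N [p [hp ep]]] := hb ord0; rewrite coord0 in ep.
have [N' [p' [hp' ep']]] := hb ord_max.
split=> //.
- move=> h; have := @uvdeg_tmap _ _ hp (U_(i1) *+ N + h)%MM.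
  rewrite -ep mulrC mpolyXn mcoeffMX => H /H.
  by rewrite !mnmDE !mulmnE !mnm1E /=; lia.
- have := osculating_tmap p; rewrite -ep /osculating mderivM.
  have -> : (u ^+ N)^`M(i2) = 0.
    elim: (N) => [|k IH]; first by rewrite expr0 -mpolyC1 mderivC.
    by rewrite exprS mderivM IH mulr0 addr0 mderivX mnm1E scale0r mul0r.
  by rewrite mul0r add0r !rmorphM rmorphXn psiX /= expr1n !mul1r.
case: (eqVneq b 0) => [->|b0]; first by rewrite rmorph0 size_poly0.
have := size_psi_tmap hp'; rewrite -ep' rmorphM rmorphXn psi_coord10 -exprM /=.
case: (eqVneq (psi 1 0 b) 0) => [->|p0]; first by rewrite size_poly0.
by rewrite mulrC size_mulXn // mulnDr addnC -addSn leq_add2r.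
Qed.

(** Restricted to the curve, s is a polynomial of degree at most g; the combination of the z_i with
    its coefficients has the same restriction, hence equals s by [uvdeg1_inj]. *)
Lemma tangent_section1_linear (s : Q) : tangent_section 1 s ->
  exists c : 'I_g.+1 -> K, s = tofrac (\sum_i (c i)%:MP * z i).
Proof.
case/tangent_section_form => b [-> hb ob]; rewrite muln1 => sb.
exists (fun i => (psi 1 0 b)`_i); congr (tofrac _).
pose p : S := \sum_(i < g.+1) (psi 1 0 b)`_i *: 'X_i.
have ep : tmap p = \sum_(i < g.+1) ((psi 1 0 b)`_i)%:MP * z i.
  rewrite rmorph_sum; apply: eq_bigr => i _.
  by rewrite -mul_mpolyC rmorphM; congr (_ * _); [exact: tmapC|exact: tmapX].
rewrite -ep; apply: uvdeg1_inj => //; [|exact: osculating_tmap|].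
  apply: uvdeg_tmap; apply: rpred_sum => i _; apply: rpredZ; by rewrite dhomogX /= mdeg1.
rewrite ep (rmorph_sum (psi 1 0)); apply/polyP => k; rewrite [RHS]coef_sum.
under eq_bigr => i _ do rewrite (rmorphM (psi 1 0)) psiC psi_coord10 coefCM coefXn.
case: (ltnP k g.+1) => hk; last first.
  rewrite nth_default ?(leq_trans sb) // big1 // => i _.
  by case: eqP => [e|_]; [move: (ltn_ord i); rewrite -e ltnNge hk|rewrite mulr0].
rewrite (bigD1 (Ordinal hk)) //= eqxx mulr1 big1 ?addr0 // => i.
by rewrite -val_eqE /= eq_sym => /negPf ->; rewrite mulr0.
Qed.

End Sections.

(** * Vanishing of the Koszul homology *)

Section KoszulStrand.
Variables (K : fieldType) (g q : nat).
Hypothesis g_gt0 : (0 < g)%N.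
Local Notation m := (g - q.+1)%N.
Hypothesis natU : forall i, (0 < i <= m)%N -> (i%:R : K) != 0.
Hypothesis m2 : (2 <= m)%N.
Hypothesis mq : (m <= q.+2)%N.
Local Notation B := {mpoly K[3]}.
Local Notation Q := (tangent_frac K g).
Local Notation z := (@tangent_coord K g).
Local Notation tofrac := (@FracField.tofrac B).
Local Notation M := (tangent_section_module K g).
Local Notation kset := (@kset g.+1 _).

Lemma tensor_diff_koszul j (b : 'I_#|ksets g.+1 j.+1| -> B) (y : 'I_#|ksets g.+1 j.+1| -> Q) (c : 'I_#|ksets g.+1 j|) :
  (forall r, y r = tofrac (b r)) ->
  \sum_r koszul_diff K g.+1 j r c *: y r =
  tofrac (\sum_(a | a \notin kset c) (esgn K a (kset c))%:MP * z a * \sum_(r | kset r == a |: kset c) b r).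
Proof.
move=> yb.
transitivity (tofrac (\sum_r \sum_(a | (a \notin kset c) && (kset r == a |: kset c))
    (esgn K a (kset c))%:MP * z a * b r)).
  rewrite rmorph_sum; apply: eq_bigr => r _.
  rewrite yb -[LHS]tofracM mxE -mulr_suml; congr (tofrac (_ * _)).
  rewrite -[LHS]/(tmap K g _) rmorph_sum; apply: eq_bigr => a _.
  by rewrite esgnC rmorphM; congr (_ * _); [exact: tmapC|exact: tmapX].
congr (tofrac _); rewrite (exchange_big_dep [pred a | a \notin kset c]) /=; last by move=> r a _ /andP[].
apply: eq_bigr => a ac; rewrite mulr_sumr; apply: eq_bigl => r.
by rewrite ac.
Qed.

Lemma contr_epsE (a : 'I_g.+1) (w : ext K g.+1) (A : {set 'I_g.+1}) :
  contr (eps K a) w A = if a \notin A then esgn K a A * w (a |: A) else 0.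
Proof.
rewrite ffunE big_mkcond (bigD1 a) //= big1 ?addr0 => [|b /negPf nb].
  by case: ifP => // _; rewrite /eps eqxx mulr1.
by case: ifP => // _; rewrite /eps (inj_eq val_inj) nb mulr0 mul0r.
Qed.

Section Cycle.
Variable cc : nat -> ext K g.+1.
Hypothesis cc_deg : forall k, extdeg q.+1 (cc k).
Hypothesis cc_out : forall k, (g < k)%N -> cc k = 0.
Hypothesis cc_cycle : forall A : {set 'I_g.+1}, #|A| = q ->
  \sum_(k < g.+1) \sum_(a < g.+1) (contr (eps K a) (cc k) A)%:MP * (z a * z k) = 0.

Lemma cycle_specialize (wt : nat -> nat -> K) s (A : {set 'I_g.+1}) : #|A| = q ->
  \sum_(k < g.+1) \sum_(a < g.+1)
    (contr (eps K a) (cc k) A)%:P * (wt a k)%:P * 'X^(a + k) = 0 ->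
  (\sum_(k < s.+1) wt k (s - k)%N *: contr (eps K k) (cc (s - k))) A = 0.
Proof.
move=> cA /(congr1 (fun p : {poly K} => p`_s)); rewrite coef0 coef_sum => H.
rewrite sum_ffunE -(@sum_antidiagonal _ g s (fun a k => (wt a k *: contr (eps K a) (cc k)) A)); last first.
  move=> a b /orP[/contr_eps_out -> |/cc_out ->]; first by rewrite scaler0 ffunE.
  by rewrite raddf0 scaler0 ffunE.
rewrite -[RHS]H; apply: eq_bigr => k _; rewrite coef_sum big_mkcond; apply: eq_bigr => a _.
rewrite -polyCM coefCM coefXn eq_sym; case: ifP => _; last by rewrite mulr0.
by rewrite mulr1 ffunE mulrC.
Qed.

Lemma sum_contr_eq0 (wt : nat -> nat -> K) s :
  (forall A : {set 'I_g.+1}, #|A| = q -> \sum_(k < g.+1) \sum_(a < g.+1)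
    (contr (eps K a) (cc k) A)%:P * (wt a k)%:P * 'X^(a + k) = 0) ->
  \sum_(k < s.+1) wt k (s - k)%N *: contr (eps K k) (cc (s - k)) = 0.
Proof.
move=> H; apply/ffunP => A; rewrite [RHS]ffunE; case: (eqVneq #|A| q) => [cA|nA].
  exact: cycle_specialize (H _ cA).
have := @extdeg_sum K g.+1 q 'I_s.+1 predT (fun k => wt k (s - k)%N *: contr (eps K k) (cc (s - k))).
by apply=> // k _; apply: extdegZ; apply: extdeg_contr.
Qed.

Lemma cycle_psi u0 v0 (A : {set 'I_g.+1}) : #|A| = q ->
  \sum_(k < g.+1) \sum_(a < g.+1) (contr (eps K a) (cc k) A)%:P * (psi u0 v0 (z a) * psi u0 v0 (z k)) = 0.
Proof.
move=> /cc_cycle e; rewrite -[RHS](rmorph0 (psi u0 v0)) -e [RHS](rmorph_sum (psi u0 v0)) /=.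
apply: eq_bigr => k _; rewrite -/(psi u0 v0 _) [RHS](rmorph_sum (psi u0 v0)).
by apply: eq_bigr => a _; rewrite !(rmorphM (psi u0 v0)) psiC.
Qed.

Lemma cycle_antisym a k : contr (eps K a) (cc k) + contr (eps K k) (cc a) = 0.
Proof.
apply: (contr_cycle_antisym natU m2 mq cc_deg cc_out) => s.
  rewrite -[RHS](@sum_contr_eq0 (fun _ _ => 1) s) => [|A cA].
    by apply: eq_bigr => j _; rewrite scale1r.
  rewrite -[RHS](cycle_psi 1 0 cA); apply: eq_bigr => j _; apply: eq_bigr => i _.
  by rewrite !psi_coord10 mulr1 exprD.
apply: (@sum_contr_eq0 (fun a k => (a * k)%:R)) => A cA.
(* At (0, 1) the product z_a z_k becomes a k 'X^(a + k - 2); the factor 'X^2 restores the exponent a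
   + k and absorbs the truncated predecessors. *)
rewrite -[RHS](mulr0 'X^2) -[X in _ = _ * X](cycle_psi 0 1 cA) mulr_sumr.
apply: eq_bigr => j _; rewrite mulr_sumr; apply: eq_bigr => i _.
rewrite !psi_coord !mul0r !add0r !mulr1 -mulrA [RHS]mulrCA; congr (_ * _).
have E (l : nat) : 'X * (l%:R * 'X^(l.-1)) = l%:R * 'X^l :> {poly K}.
  by case: l => [|l]; rewrite ?mul0r ?mulr0 // mulrCA -exprS.
rewrite polyC_natr natrM exprD.
transitivity (('X * (i%:R * 'X^(i.-1))) * ('X * (j%:R * 'X^(j.-1))) : {poly K}); last by ring.
by rewrite !E; ring.
Qed.

(** By antisymmetry the coefficient at [C] may be read off from any v in [C]. *)
Definition primitive : ext K g.+1 := [ffun C : {set 'I_g.+1} =>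
  (if [pick v in C] is Some v then esgn K v C * cc v (C :\ v) else 0 : K^o)].

Lemma cc_antisym (a k : 'I_g.+1) (A : {set 'I_g.+1}) : a \notin A -> k \notin A ->
  esgn K a A * cc k (a |: A) = - (esgn K k A * cc a (k |: A)).
Proof.
move=> aA kA; have := congr1 (fun w : ext K g.+1 => w A) (cycle_antisym a k).
by rewrite /= [LHS]ffunE [RHS]ffunE !contr_epsE aA kA => /eqP; rewrite addr_eq0 => /eqP.
Qed.

(** For k outside A, [cc_antisym] makes the value independent of the v picked. For k in A, it shows
    that twice the value of cc_k at A is 0, and 2 is invertible. *)
Lemma contr_primitive (k : 'I_g.+1) (A : {set 'I_g.+1}) : cc k A = contr (eps K k) primitive A.
Proof.
have two0 : (2%:R : K) != 0 by apply: natU; rewrite m2.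
rewrite contr_epsE; case: (boolP (k \in A)) => kA /=.
  have kA' : k \notin A :\ k by rewrite setD11.
  have /eqP := cc_antisym kA' kA'; rewrite setD1K // -subr_eq0 opprK -mulr2n -mulr_natl.
  rewrite !mulf_eq0 (negPf two0) /= => /orP[/eqP e|/eqP //].
  by have := esgn_sqr K k (A :\ k); rewrite e mul0r => /esym/eqP; rewrite oner_eq0.
rewrite ffunE; case: pickP => [v vC|/(_ k)]; last by rewrite setU11.
case: (eqVneq v k) => [->|nvk].
  by rewrite setU1K // esgnU1 mulrA esgn_sqr mul1r.
have vA : v \in A by move: vC; rewrite !inE (negPf nvk).
pose A' := A :\ v.
have vA' : v \notin A' by rewrite setD11.
have kA' : k \notin A' by rewrite !inE negb_and kA orbT.
have eA : A = v |: A' by rewrite setD1K.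
have eC : (k |: A) :\ v = k |: A'.
  by rewrite setDUl; congr (_ :|: _); apply/setDidPl; rewrite disjoints1 inE eq_sym.
rewrite -(esgnD1 K v) eC {2}eA (esgnU K k vA') (esgnU K v kA').
have H := cc_antisym vA' kA'; rewrite -eA in H.
have -> : (-1) ^+ (v < k)%N * esgn K k A' * ((-1) ^+ (k < v)%N * esgn K v A' * cc v (k |: A')) =
  esgn K v A' * - (esgn K k A' * cc v (k |: A')) * ((-1) ^+ (k < v)%N * (-1) ^+ (k < v)%N).
  by rewrite (signr_lt K nvk); ring.
by rewrite -H -expr2 sqrr_sign mulr1 mulrA esgn_sqr mul1r.
Qed.

End Cycle.

Theorem koszul_strand_exact :
  tensor_homology_eq0 (koszul_resolution K g.+1) M q.+1 (q.+1 + 1).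
Proof.
move=> x hx cx.
(* The degree q + 2 minus the shift q + 1 is 1: the entries are sections of O(1). *)
have Hc r : exists c : 'I_g.+1 -> K, x r = tofrac (\sum_i (c i)%:MP * z i).
  by have := hx r; rewrite /= leq_addr addKn => /(tangent_section1_linear g_gt0).
have [c Ec] := fin_all_exists Hc.
pose cc (k : nat) : ext K g.+1 := [ffun A : {set 'I_g.+1} =>
  (\sum_(r | kset r == A) (if insub k is Some j then c r j else 0) : K^o)].
have cc_kset r (k : 'I_g.+1) : cc k (kset r) = c r k.
  by rewrite ffunE (big_pred1 r) ?valK // => r'; rewrite /= (inj_eq (@kset_inj _ _)).
have cc_deg k : extdeg q.+1 (cc k).
  move=> A nA; rewrite ffunE big_pred0 // => r; apply/eqP => e.
  by rewrite -e card_kset eqxx in nA.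
have cc_out k : (g < k)%N -> cc k = 0.
  move=> gk; apply/ffunP => A; rewrite !ffunE big1 // => r _.
  by rewrite insubF // ltnS leqNgt gk.
have cc_sum A : \sum_(r : 'I_#|ksets g.+1 q.+1| | kset r == A) \sum_i (c r i)%:MP * z i =
    \sum_(k < g.+1) (cc k A)%:MP * z k.
  rewrite exchange_big; apply: eq_bigr => k _; rewrite -mulr_suml; congr (_ * _).
  by rewrite ffunE rmorph_sum; apply: eq_bigr => r _; rewrite valK.
have cc_cycle (A : {set 'I_g.+1}) : #|A| = q -> \sum_(k < g.+1) \sum_(a < g.+1)
    (contr (eps K a) (cc k) A)%:MP * (z a * z k) = 0.
  case/kset_surj => r0 <-; have := cx r0; rewrite /tensor_diff (tensor_diff_koszul _ Ec).
  move/eqP; rewrite tofrac_eq0 => /eqP e; rewrite -[RHS]e exchange_big [RHS]big_mkcond; apply: eq_bigr => a _.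
  case: ifP => ar; last by rewrite big1 // => k _; rewrite contr_epsE ar mul0r.
  rewrite cc_sum mulr_sumr; apply: eq_bigr => k _.
  by rewrite contr_epsE ar mpolyCM; ring.
pose w := primitive cc.
exists (fun r => tofrac (w (kset r))%:MP); split.
  move=> r /=; rewrite addn1 leqnn subnn => i; exists 0%N, (w (kset r))%:MP; split.
    by rewrite addn0 -[_%:MP]mulr1 mul_mpolyC rpredZ // dhomog1.
  by rewrite expr0 scale1r -[tangent_map _]/(tmap K g _) tmapC.
move=> r; rewrite /tensor_diff (tensor_diff_koszul r (fun=> erefl)) Ec; congr (tofrac _).
rewrite [RHS]big_mkcond; apply: eq_bigr => k _.
rewrite -cc_kset (contr_primitive cc_deg cc_out cc_cycle) contr_epsE; case: ifP => kr; last by rewrite mul0r.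
have [r' er'] : exists r' : 'I_#|ksets g.+1 q.+2|, kset r' = k |: kset r.
  by apply: kset_surj; rewrite cardsU1 kr card_kset.
rewrite (big_pred1 r') => [|l]; last by rewrite -er' /= (inj_eq (@kset_inj _ _)).
by rewrite er' mpolyCM; ring.
Qed.

End KoszulStrand.

Theorem theorem1p1 (K : closedFieldType) (g : nat) (hg : (3 <= g)%N)
    (hK : [pchar K] =i pred0 \/
          exists2 p : nat, p \in [pchar K] & (g + 2 <= 2 * p)%N) :
  tangent_koszul_eq0 K g (g %/ 2) 1.
Proof.
move=> F; apply: (@tensor_homology_transfer _ _ _ (koszul_resolution K g.+1)).
(* With q = g/2 - 1, m = g - g/2 is g/2 or g/2 + 1, so that 2 <= m <= q + 2. *)
have -> : (g %/ 2 = (g %/ 2).-1.+1)%N by rewrite prednK // divn_gt0 //; lia.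
apply: koszul_strand_exact; try lia.
move=> i hi; case: hK => [/pcharf0P -> |[p pK gp]]; first by lia.
(* 2p >= g + 2 forces p > m, so p divides none of 1, ..., m. *)
by rewrite -(dvdn_pcharf pK); apply/negP => /dvdn_leq; lia.
Qed.
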